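(* Let $k\geq 1$ and let $(G_1,\dots,G_k)$ be a random vector with distribution $\gamma_k$. Then $$(G_1,\dots,G_k)\overset{(d)}{=}\Big(\frac{E_1}{C_1},\frac{E_2}{C_2},\dots,\frac{E_k}{C_k}\Big),$$ where $E_1,\dots,E_k$ are i.i.d. exponential random variables with parameter $1$, independent of the random vector $(C_1,\dots,C_k)$, which has law $\nu_k$.
   Context: Let $B_1,B_2,\dots$ be i.i.d. two-sided standard Brownian motions (i.e. $(B(t))_{t\ge0}$ and $(B(-t))_{t\ge0}$ are independent standard linear Brownian motions) and $I^{(n)}=B_n\circ\cdots\circ B_1$. It is known that for any $m\ge1$ and any distinct nonzero reals $t_1,\dots,t_m$, $(I^{(n)}(t_1),\dots,I^{(n)}(t_m))$ converges in distribution as $n\to\infty$ to a law $\mu_m$ not depending on the $t_i$'s. For a finite sequence $\ell_0,\dots,\ell_k$ with increasing rearrangement $\hat\ell_0\le\dots\le\hat\ell_k$, its gaps sequence is $(\hat\ell_i-\hat\ell_{i-1})_{1\le i\le k}$. $\gamma_k$ denotes the law of the gaps sequence of a $\mu_{k+1}$-distributed vector $(I_1,\dots,I_{k+1})$. For $x_1,\dots,x_k$ put $\bar x_0=0$, $\bar x_i=x_1+\dots+x_i$. For a permutation $\tau$ of $\{0,1,\dots,k\}$ and $c=(c_1,\dots,c_k)\in(0,\infty)^k$, let, for $i\in\{1,\dots,k\}$, $E_{\tau,i}=\{j\in\{1,\dots,k\}:\min(\tau(j-1),\tau(j))<i\le\max(\tau(j-1),\tau(j))\}$, $F_{\tau,i}(c)=\sum_{j\in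 E_{\tau,i}}\sqrt{2c_j}$, $F_\tau(c)=(F_{\tau,1}(c),\dots,F_{\tau,k}(c))$, and $w_\tau(c)=2^{-k}\prod_{i=1}^k \sqrt{2c_i}/F_{\tau,i}(c)$. Let $Q$ be the Markov kernel on $(0,\infty)^k$ given by $Q(c,\cdot)=\sum_{\tau}w_\tau(c)\,\delta_{F_\tau(c)}$ (sum over all permutations $\tau$ of $\{0,\dots,k\}$). For any probability measure $\nu^{(0)}$ supported in $[2,2k^2]^k$, $\nu^{(0)}Q^n$ converges weakly as $n\to\infty$ to a probability measure $\nu_k$ not depending on $\nu^{(0)}$; this is the $\nu_k$ of the statement. *)

(* Defs.v *)
From HB Require Import structures.
From mathcomp Require Import all_boot all_order all_algebra all_fingroup.
From mathcomp Require Import all_classical all_reals all_analysis.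

Set Implicit Arguments.
Unset Strict Implicit.
Unset Printing Implicit Defensive.

Import Order.TTheory GRing.Theory Num.Theory.
Import numFieldNormedType.Exports.

Local Open Scope classical_set_scope.
Local Open Scope ring_scope.

Section Defs.
Context {R : realType}.

(** Iterated composition: [iterBM B n t = B (n-1) (... (B 0 t))].
    With [B m] playing the role of the paper's [B_(m+1)], this is
    [I^(n) = B_n o ... o B_1]; [iterBM B 0 = id]. *)
Fixpoint iterBM (B : nat -> R -> R) (n : nat) (t : R) : R :=
  if n is m.+1 then B m (iterBM B m t) else t.

(** Identification of row vectors (which carry the usual topology of R^m)
    with tuples (which carry the product sigma-algebra). *)
Definition row_to_tuple m (v : 'rV[R]_m) : m.-tuple R := [tuple v ord0 i | i < m].

Definition bounded_continuous m (f : m.-tuple R -> R) : Prop :=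
  continuous (f \o @row_to_tuple m) /\ exists M : R, forall x, `|f x| <= M.

Definition cvg_in_law d (Omega : measurableType d) (P : probability Omega R)
    m (X : nat -> Omega -> m.-tuple R) (mu : probability (m.-tuple R) R) : Prop :=
  forall f : m.-tuple R -> R, bounded_continuous f ->
    (fun n => (\int[P]_w (f (X n w))%:E)%E) @ \oo --> (\int[mu]_x (f x)%:E)%E.

Definition iid_two_sided_BM d (Omega : measurableType d) (P : probability Omega R)
    (B : nat -> Omega -> R -> R) : Prop :=
  [/\ (forall n t, measurable_fun setT (fun w => B n w t)),
      (forall n w, continuous (B n w)),
      (forall n w, B n w 0 = 0) &
      (forall (N r : nat) (t : 'I_r.+1 -> R),
        (forall i : 'I_r, t (widen_ord (leqnSn r) i) < t (lift ord0 i)) ->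
        forall A : 'I_N -> 'I_r -> set R, (forall n i, measurable (A n i)) ->
        P (\bigcap_(p in [set: 'I_N * 'I_r])
             [set w | A p.1 p.2 (B p.1 w (t (lift ord0 p.2))
                                 - B p.1 w (t (widen_ord (leqnSn r) p.2)))])
        = (\prod_(p : 'I_N * 'I_r)
             normal_prob 0 (Num.sqrt (t (lift ord0 p.2) - t (widen_ord (leqnSn r) p.2)))
               (A p.1 p.2))%E)].

Definition gaps k (l : k.+1.-tuple R) : k.-tuple R :=
  let s := sort <=%R (tval l) in [tuple nth 0 s i.+1 - nth 0 s i | i < k].

(** The Markov kernel Q on (0,oo)^k. Permutations tau of {0,...,k} are
    elements of {perm 'I_k.+1}. Index [i : 'I_k] stands for the paper's
    i+1 in {1..k}, index [j : 'I_k] for the paper's j+1, so that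
    tau(j-1) = tau (widen j) and tau(j) = tau (lift ord0 j). *)
Definition Eset k (tau : {perm 'I_k.+1}) (i j : 'I_k) : bool :=
  let a := nat_of_ord (tau (widen_ord (leqnSn k) j)) in
  let b := nat_of_ord (tau (lift ord0 j)) in
  (minn a b <= i < maxn a b)%N.

Definition Fcomp k (tau : {perm 'I_k.+1}) (c : k.-tuple R) (i : 'I_k) : R :=
  \sum_(j < k | Eset tau i j) Num.sqrt (2 * tnth c j).

Definition Fmap k (tau : {perm 'I_k.+1}) (c : k.-tuple R) : k.-tuple R :=
  [tuple Fcomp tau c i | i < k].

Definition wt k (tau : {perm 'I_k.+1}) (c : k.-tuple R) : R :=
  (2 ^- k) * \prod_(i < k) (Num.sqrt (2 * tnth c i) / Fcomp tau c i).

(** Action of Q on test functions: (Q f)(c) = sum_tau w_tau(c) f(F_tau(c)),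
    so that (nu0 Q^n)(f) = nu0 (Q^n f). *)
Definition Qop k (f : k.-tuple R -> R) (c : k.-tuple R) : R :=
  \sum_(tau : {perm 'I_k.+1}) wt tau c * f (Fmap tau c).

Definition is_nu_k k (nu : probability (k.-tuple R) R) : Prop :=
  nu [set c | forall i, 0 < tnth c i] = 1%E /\
  forall nu0 : probability (k.-tuple R) R,
    nu0 [set c | forall i, 2 <= tnth c i <= 2 * (k ^ 2)%:R] = 1%E ->
    forall f : k.-tuple R -> R, bounded_continuous f ->
      (fun n => (\int[nu0]_c (iter n (@Qop k) f c)%:E)%E) @ \oo
        --> (\int[nu]_c (f c)%:E)%E.

End Defs.

(* Main.v *)
(** Evaluate a two-sided Brownian motion at k+1 points whose consecutive gaps
    are independent exponential variables of parameters c_1, ..., c_k.  The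
    successive increments are then independent symmetric Laplace variables of
    parameters sqrt(2 c_j).  Sorting the k+1 values splits the space of
    increments into sectors indexed by the permutations tau of {0, ..., k}; on
    the sector of tau, the joint density of the increments is, in terms of the
    new gaps, w_tau(c) times a product of exponential densities of parameters
    F_{tau,i}(c).  One composition thus acts on the mixing law of the parameters
    as the kernel Q.  Starting from c = (2, ..., 2), the gaps of I^(n) mixed over
    the initial exponential gaps have a law given by delta_c Q^n, and both sides
    are passed to the limit by dominated convergence against continuous test
    functions with values in [0, 1]. *)
Require Import Defs.
From HB Require Import structures.
From mathcomp Require Import all_boot all_order all_algebra all_fingroup.
From mathcomp Require Import all_classical all_reals all_analysis.
From mathcomp Require Import measurable_realfun.
From mathcomp Require Import ring lra.

Set Implicit Arguments.
Unset Strict Implicit.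
Unset Printing Implicit Defensive.

Import Order.TTheory GRing.Theory Num.Theory.
Import numFieldNormedType.Exports.

Local Open Scope classical_set_scope.
Local Open Scope ring_scope.

(** * Boxes and uniqueness of measures on tuples *)

Section TupleMeasure.
Context {R : realType}.

(** The independence hypothesis concerns only rectangles of increments over one deterministic list
    of times, whereas [B n] is evaluated at the random points reached so far. These points are
    therefore rounded to a finite grid containing 0; on each value of the rounded points,
    independence of the grid increments applies, and path continuity removes the rounding. The
    Gaussian formula asks moreover for distinct points, so coincident ones are reached by
    perturbation. The sectors come from a linear change of variables on increments. To avoid its
    determinant, a base point spread uniformly over [0, 1] is added: increments become k+1 free
    points, on which permutations visibly preserve Lebesgue measure. The average of a test function
    at [e / c] may fail to be continuous where some c_i vanishes, so it cannot be fed directly to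
    the limit defining [nu]. Since c >= 2 gives sqrt(2c) >= 2 and every E_{tau,i} is nonempty, [2,
    oo)^k is stable under the maps F_tau; truncating the parameters from below is thus invisible
    along the iterates started at (2, ..., 2). *)

Definition rect n (A : 'I_n -> set R) : set (n.-tuple R) :=
  [set x | forall i, A i (tnth x i)].

Definition box n (a b : 'I_n -> R) : set (n.-tuple R) :=
  rect (fun i => `]a i, b i[%classic).

Lemma measurable_rect n (A : 'I_n -> set R) :
  (forall i, measurable (A i)) -> measurable (rect A).
Proof.
move=> mA; rewrite (_ : rect A = \bigcap_(i in [set: 'I_n])
    ((fun x : n.-tuple R => tnth x i) @^-1` A i)); last first.
  by apply/seteqP; split => [x Ax i _|x Ax i]; exact: Ax.
apply: fin_bigcap_measurable => // i _.
by rewrite -[X in measurable X]setTI; apply: measurable_tnth.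
Qed.

Lemma measurable_box n (a b : 'I_n -> R) : measurable (box a b).
Proof. by apply: measurable_rect => i; exact: measurable_itv. Qed.

Lemma box_cover n : \bigcup_k box (fun _ : 'I_n => - k%:R) (fun _ => k%:R) = setT.
Proof.
apply/seteqP; split => // x _.
exists (Num.truncn (\sum_(i < n) `|tnth x i|)).+1 => // i; rewrite /= in_itv/= -ltr_norml.
apply: le_lt_trans (truncnS_gt _).
by rewrite (bigD1 i)//= lerDl sumr_ge0.
Qed.

(** A slab constraining one coordinate to an open interval is the union over k of the boxes whose
    other sides are []-k, k[], so boxes generate every coordinate map. *)
Lemma measurable_tuple_box n : @measurable _ (n.-tuple R) =
  <<s [set S | exists a b : 'I_n -> R, S = box a b] >>.
Proof.
set G := [set S | _].
apply/seteqP; split; last first.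
  apply: smallest_sub; first exact: sigma_algebra_measurable.
  by move=> _ [a [b ->]]; exact: measurable_box.
have tnthG (i : 'I_n) : measurable_fun (setT : set (g_sigma_algebraType G))
    (fun x : n.-tuple R => tnth x i).
  apply: (measurability _ (RGenOpens.measurableE R)) => _ [_ [x [y ->]] <-].
  rewrite setTI (_ : _ @^-1` _ = \bigcup_k box
    (fun j => if j == i then x else - k%:R) (fun j => if j == i then y else k%:R)).
    apply: bigcupT_measurable => k; apply: sub_sigma_algebra.
    by eexists; eexists; reflexivity.
  apply/seteqP; split => [z /= xzy|z [k _ /(_ i)]]; last by rewrite eqxx.
  have [k _ zk] : (\bigcup_k box (fun _ : 'I_n => - k%:R) (fun _ => k%:R)) z.
    by rewrite box_cover.
  by exists k => // j; case: eqVneq => [->//|_]; exact: zk.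
apply: smallest_sub.
  exact: (@sigma_algebra_measurable _ (g_sigma_algebraType G)).
elim/big_ind : _ => // [A B AG BG|i _]; first by move=> X [/AG|/BG].
by move=> _ [A mA <-]; exact: tnthG.
Qed.

(** Boxes form a pi-system (intersect sides by max and min) exhausting the space by the cubes []-k,
    k[]. Most identifications of laws below reduce to this. *)
Lemma box_measure_unique n (m1 m2 : {measure set (n.-tuple R) -> \bar R}) :
  (forall a b, m1 (box a b) = m2 (box a b)) ->
  (forall a b, m1 (box a b) < +oo)%E ->
  forall S, measurable S -> m1 S = m2 S.
Proof.
move=> m12 m1oo S mS.
apply: (measure_unique [set S | exists a b : 'I_n -> R, S = box a b]
  (fun k => box (fun _ : 'I_n => - k%:R) (fun _ => k%:R))) => //.
- exact: measurable_tuple_box.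
- move=> _ _ [a [b ->]] [a' [b' ->]].
  exists (fun i => Num.max (a i) (a' i)), (fun i => Num.min (b i) (b' i)).
  have E i (u : R) : (u \in `]Num.max (a i) (a' i), Num.min (b i) (b' i)[) =
      (u \in `]a i, b i[) && (u \in `]a' i, b' i[).
    by rewrite !in_itv/= gt_max lt_min andbACA.
  apply/seteqP; split => x.
    by move=> [xab xab'] i; rewrite /= E; apply/andP; split; [exact: xab|exact: xab'].
  by move=> xab; split => i; have := xab i; rewrite /= E => /andP[].
- by move=> k; eexists; eexists; reflexivity.
- exact: box_cover.
- by move=> _ [a [b ->]]; exact: m12.
Qed.

End TupleMeasure.

(** * Measures given by a density *)

Section Density.
Context d (T : measurableType d) (R : realType).
Variables (nu : {measure set T -> \bar R}) (p : T -> R).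
Hypotheses (mp' : measurable_fun setT p) (p0 : forall x, 0 <= p x).

Let mp : measurable_fun setT (EFin \o p).
Proof. exact/measurable_EFinP. Qed.

Lemma density_measure : exists m : {measure set T -> \bar R},
  forall A, measurable A -> m A = (\int[nu]_(x in A) (p x)%:E)%E.
Proof.
pose m := (fun A => \int[nu]_(x in A) (p x)%:E)%E.
have m0 : m set0 = 0%E by rewrite /m integral_set0.
have m_ge0 A : (0 <= m A)%E by apply: integral_ge0 => x _; rewrite lee_fin.
have m_sigma : semi_sigma_additive m.
  move=> F mF tF mUF; rewrite /m; apply: cvg_toP.
    apply: ereal_nondecreasing_is_cvgn => i j ij.
    by apply: lee_sum_nneg_natr => // k _ _; apply: integral_ge0 => x _; rewrite lee_fin.
  rewrite ge0_integral_bigcup//.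
  - exact: measurable_funTS.
  - by move=> x _; rewrite lee_fin.
pose mm : {measure set T -> \bar R} :=
  HB.pack m (isMeasure.Build _ _ _ m m0 m_ge0 m_sigma).
by exists mm.
Qed.

Import HBNNSimple.

(** The identity holds for indicators by hypothesis, then for simple functions, and passes to [f] by
    monotone convergence on both sides. *)
Lemma integral_density (m : {measure set T -> \bar R}) :
  (forall A, measurable A -> m A = (\int[nu]_(x in A) (p x)%:E)%E) ->
  forall f, measurable_fun setT f -> (forall x, (0 <= f x)%E) ->
  (\int[m]_x f x = \int[nu]_x (f x * (p x)%:E))%E.
Proof.
move=> mE f mf f0.
pose g := nnsfun_approx measurableT mf.
have fE x : f x = limn (fun n => (g n x)%:E).
  by apply/esym/cvg_lim => //; apply: cvg_nnsfun_approx.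
have ndg x : {homo (fun n => (g n x)%:E) : a b / (a <= b)%N >-> (a <= b)%E}.
  by move=> a b ab; rewrite lee_fin; exact/lefP/nd_nnsfun_approx.
have sf n : (\int[m]_x (g n x)%:E = \int[nu]_x ((g n x)%:E * (p x)%:E))%E.
  transitivity (\sum_(y \in range (g n)) \int[m]_x (y * \1_(g n @^-1` [set y]) x)%:E)%E.
    rewrite -ge0_integral_fsum//.
    - by apply: eq_integral => x _; rewrite fimfunE -fsumEFin.
    - by move=> y; apply/measurable_EFinP; exact: measurable_funM.
    - by move=> y x _; rewrite EFinM nnfun_muleindic_ge0.
  transitivity (\sum_(y \in range (g n))
      \int[nu]_x ((y * \1_(g n @^-1` [set y]) x)%:E * (p x)%:E))%E; last first.
    rewrite -ge0_integral_fsum//.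
    - apply: eq_integral => x _; rewrite fimfunE -fsumEFin// ge0_mule_fsuml//.
      by move=> y; rewrite EFinM nnfun_muleindic_ge0.
    - by move=> y; apply: emeasurable_funM => //; apply/measurable_EFinP; exact: measurable_funM.
    - by move=> y x _; rewrite mule_ge0 ?lee_fin// -lee_fin EFinM nnfun_muleindic_ge0.
  apply: eq_fsbigr => y /set_mem [z _ gzy].
  have y0 : 0 <= y by rewrite -gzy.
  under eq_integral do rewrite EFinM.
  rewrite ge0_integralZl//; last by apply/measurable_EFinP.
  rewrite integral_indic// setIT mE//.
  under [RHS]eq_integral do rewrite EFinM -muleA.
  rewrite ge0_integralZl//; last 2 first.
  - by apply: emeasurable_funM => //; apply/measurable_EFinP.
  - by move=> x _; rewrite mule_ge0// lee_fin.
  congr (_ * _)%E; rewrite integral_mkcond; apply: eq_integral => x _.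
  by rewrite patchE indicE; case: ifP => _; rewrite ?mul1e ?mul0e.
transitivity (limn (fun n => \int[m]_x (g n x)%:E))%E.
  under eq_integral do rewrite fE.
  rewrite monotone_convergence//.
    by move=> n; apply/measurable_EFinP.
  by move=> n x _; rewrite lee_fin.
under eq_fun do rewrite sf.
rewrite -monotone_convergence//.
- apply: eq_integral => x _; rewrite [in RHS]fE.
  apply/cvg_lim => //; apply: cvgeZr => //.
  by apply: ereal_nondecreasing_is_cvgn; exact: ndg.
- by move=> n; apply: emeasurable_funM => //; apply/measurable_EFinP.
- by move=> n x _; rewrite mule_ge0// lee_fin.
- by move=> x _ a b ab; apply: lee_wpmul2r; [rewrite lee_fin|exact: ndg].
Qed.

End Density.

Lemma emeasurable_prod d (T : measurableType d) (R : realType) (D : set T) (I : Type)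
    (s : seq I) (h : I -> T -> \bar R) : (forall i, measurable_fun D (h i)) ->
  measurable_fun D (fun x => \prod_(i <- s) h i x)%E.
Proof.
move=> mh; elim: s => [|i s IH].
  by rewrite (_ : (fun _ => _) = cst 1%E)//; apply/funext => x; rewrite big_nil.
rewrite (_ : (fun _ => _) = (h i \* (fun x => \prod_(i <- s) h i x))%E).
  exact: emeasurable_funM.
by apply/funext => x; rewrite big_cons.
Qed.

(** * Lebesgue measure on tuples as an iterated product *)

Section LebesgueTuple.
Context {R : realType}.
Notation leb := (@lebesgue_measure R).

Definition tcons n (p : R * n.-tuple R) : n.+1.-tuple R := [tuple of p.1 :: p.2].
Definition tuncons n (x : n.+1.-tuple R) : R * n.-tuple R := (thead x, [tuple of behead x]).

Lemma tconsK n : cancel (@tcons n) (@tuncons n).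
Proof. by move=> [a x]; rewrite /tuncons theadE; congr pair; apply: val_inj. Qed.

Lemma tnth_tcons0 n p : tnth (@tcons n p) ord0 = p.1.
Proof. exact: tnth0. Qed.

Lemma tnth_tconsS n p i : tnth (@tcons n p) (lift ord0 i) = tnth p.2 i.
Proof. exact: tnthS. Qed.

Lemma measurable_tcons n : measurable_fun setT (@tcons n).
Proof. exact: measurable_cons. Qed.

Lemma measurable_tuncons n : measurable_fun setT (@tuncons n).
Proof.
apply: measurable_fun_pair; last exact: measurable_behead.
exact: (@measurable_tnth _ _ n.+1 ord0).
Qed.

(** Sigma-finiteness is carried along because the next product and Tonelli's theorem require it; the
    exhausting sets are products of those of the factors, pulled back by [tuncons]. *)
Lemma lebesgue_tuple_step n (m : {sigma_finite_measure set (n.-tuple R) -> \bar R}) :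
  exists m' : {sigma_finite_measure set (n.+1.-tuple R) -> \bar R},
  forall A, m' A = (leb \x m)%E (@tcons n @^-1` A).
Proof.
pose q : {measure set (n.+1.-tuple R) -> \bar R} := pushforward (leb \x m)%E (@tcons n).
pose p := q (@measurable_tcons n).
have p_sigma : sigma_finite setT p.
  have /sigma_finiteP[F [TF ndF Foo]] := sigma_finiteT leb.
  have /sigma_finiteP[G [TG ndG Goo]] := sigma_finiteT m.
  exists (fun i => @tuncons n @^-1` (F i `*` G i)).
    apply/seteqP; split => // x _.
    have [i _ Fi] : (\bigcup_i F i) (tuncons x).1 by rewrite -TF.
    have [j _ Gj] : (\bigcup_i G i) (tuncons x).2 by rewrite -TG.
    exists (maxn i j) => //; split.
      by move: Fi; exact/subsetPset/ndF/leq_maxl.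
    by move: Gj; exact/subsetPset/ndG/leq_maxr.
  move=> i; have [mF Fi] := Foo i; have [mG Gi] := Goo i; split.
    by rewrite -[X in measurable X]setTI; apply: measurable_tuncons => //; exact: measurableX.
  rewrite /p /= /pushforward -comp_preimage (_ : _ \o _ = id); last first.
    by apply/funext => x /=; rewrite tconsK.
  by rewrite product_measure1E// lte_mul_pinfty// ge0_fin_numE.
pose p' : {sigma_finite_measure set (n.+1.-tuple R) -> \bar R} :=
  HB.pack (Measure.sort p) (Measure_isSigmaFinite.Build _ _ _ p p_sigma).
by exists p'.
Qed.

(** The recursion starts from the unit mass on the empty tuple. *)
Fixpoint lebesgue_tuple n : {sigma_finite_measure set (n.-tuple R) -> \bar R} :=
  if n is n'.+1 then sval (cid (lebesgue_tuple_step (lebesgue_tuple n')))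
  else \d_([tuple] : 0.-tuple R).

Notation lebt := lebesgue_tuple.

Lemma lebesgue_tupleSE n A : lebt n.+1 A = (leb \x lebt n)%E (@tcons n @^-1` A).
Proof. by rewrite /=; case: cid. Qed.

Lemma integral_lebesgue_tuple0 (h : 0.-tuple R -> \bar R) : (forall x, (0 <= h x)%E) ->
  (\int[lebt 0]_x h x = h [tuple])%E.
Proof.
move=> h0; rewrite (_ : h = cst (h [tuple])).
  by rewrite integral_cst//= diracT mule1.
by apply/funext => x; rewrite (tuple0 x).
Qed.

Lemma integral_lebesgue_tupleS n (h : n.+1.-tuple R -> \bar R) :
  measurable_fun setT h -> (forall x, (0 <= h x)%E) ->
  (\int[lebt n.+1]_x h x = \int[leb]_a \int[lebt n]_x h (tcons (a, x)))%E.
Proof.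
move=> mh h0.
pose q : {measure set (n.+1.-tuple R) -> \bar R} :=
  pushforward (leb \x lebt n)%E (@tcons n).
rewrite (eq_measure_integral (q (@measurable_tcons n))); last first.
  by move=> A mA _; exact: lebesgue_tupleSE.
rewrite ge0_integral_pushforward//=; last exact: measurable_tcons.
rewrite preimage_setT fubini_tonelli1//.
apply: measurableT_comp => //; exact: measurable_tcons.
Qed.

Lemma measurable_lebesgue_tuple_inner n (h : n.+1.-tuple R -> \bar R) :
  measurable_fun setT h -> (forall x, (0 <= h x)%E) ->
  measurable_fun setT (fun a => \int[lebt n]_x h (tcons (a, x)))%E.
Proof.
move=> mh h0; apply: (measurable_fun_fubini_tonelli_F (h \o @tcons n)) => //=.
by apply: measurableT_comp => //; exact: measurable_tcons.
Qed.

Lemma measurable_tcons_section n (h : n.+1.-tuple R -> \bar R) a :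
  measurable_fun setT h -> measurable_fun setT (fun x => h (tcons (a, x))).
Proof.
move=> mh; apply: (measurableT_comp mh); first exact: (measurable_cons (measurable_cst a) (@measurable_id _ _ _)).
Qed.

Lemma integral_lebesgue_tuple_prod n (h : 'I_n -> R -> \bar R) :
  (forall i, measurable_fun setT (h i)) -> (forall i x, (0 <= h i x)%E) ->
  (\int[lebt n]_x \prod_(i < n) h i (tnth x i) = \prod_(i < n) \int[leb]_a h i a)%E.
Proof.
elim: n h => [|n IH] h mh h0.
  rewrite integral_lebesgue_tuple0; first by rewrite !big_ord0.
  by move=> x; apply: prode_ge0.
have mhp m (g : 'I_m -> R -> \bar R) : (forall i, measurable_fun setT (g i)) ->
    measurable_fun setT (fun x : m.-tuple R => \prod_(i < m) g i (tnth x i))%E.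
  move=> mg; apply: emeasurable_prod => i _.
  by apply: measurableT_comp => //; exact: measurable_tnth.
rewrite integral_lebesgue_tupleS//; last 2 first.
- exact: mhp.
- by move=> x; apply: prode_ge0.
rewrite big_ord_recl -IH//.
rewrite -ge0_integralZr//; last first.
  by apply: integral_ge0 => x _; apply: prode_ge0.
  exact: mh.
apply: eq_integral => a _.
have /ge0_integralZl := mhp _ (fun i => h (lift ord0 i)) (fun i => mh _).
move=> /(_ (lebt n) measurableT (h ord0 a)) <- //; last by move=> x _; apply: prode_ge0.
apply: eq_integral => x _; rewrite big_ord_recl tnth_tcons0.
by congr (_ * _)%E; apply: eq_bigr => i _; rewrite tnth_tconsS.
Qed.

End LebesgueTuple.

(** * Permutations, translations and partial sums as changes of variables *)

Section ChangeOfVariables.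
Context {R : realType}.
Notation leb := (@lebesgue_measure R).
Notation lebt := (@lebesgue_tuple R).

Lemma indic_rect n (A : 'I_n -> set R) (x : n.-tuple R) :
  (\1_(rect A) x : R)%:E = (\prod_(i < n) (\1_(A i) (tnth x i) : R)%:E)%E.
Proof.
rewrite prodEFin; congr EFin; rewrite indicE.
have [xA|] := boolP (x \in rect A).
  move: xA; rewrite inE => xA; rewrite big1// => i _.
  by rewrite indicE mem_set//; exact: xA.
move=> /negP xA; have /existsP[i xi] : [exists i, tnth x i \notin A i].
  apply: contrapT => /negP; rewrite negb_exists => /forallP xA'.
  apply: xA; rewrite inE => i.
  by apply/set_mem; have := xA' i; rewrite negbK.
by rewrite (bigD1 i)//= indicE (negbTE xi) mul0r.
Qed.

Lemma lebesgue_tuple_rect n (A : 'I_n -> set R) : (forall i, measurable (A i)) ->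
  lebt n (rect A) = (\prod_(i < n) leb (A i))%E.
Proof.
move=> mA; rewrite -(setIT (rect A)) -integral_indic//; last exact: measurable_rect.
under eq_integral do rewrite indic_rect.
rewrite (@integral_lebesgue_tuple_prod _ _ (fun i u => (\1_(A i) u : R)%:E)).
- apply: eq_bigr => i _; rewrite integral_indic//; last exact: mA.
  by congr (leb _); exact: setIT.
- by move=> i; apply/measurable_EFinP; exact: measurable_indic.
- by move=> i x; rewrite lee_fin.
Qed.

Lemma lebesgue_tuple_box_fin n (a b : 'I_n -> R) : (lebt n (box a b) < +oo)%E.
Proof.
rewrite lebesgue_tuple_rect; last by move=> i; exact: measurable_itv.
rewrite (eq_bigr (fun i => (fine (leb `]a i, b i[%classic))%:E)); last first.
  by move=> i _; rewrite fineK// lebesgue_measure_itv/=; case: ifP.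
by rewrite prodEFin ltry.
Qed.

Definition tperm_tuple n (s : {perm 'I_n}) (x : n.-tuple R) : n.-tuple R :=
  [tuple tnth x (s i) | i < n].

Lemma tperm_tupleK n (s : {perm 'I_n}) : cancel (tperm_tuple s) (tperm_tuple s^-1).
Proof. by move=> x; apply: eq_from_tnth => i; rewrite !tnth_mktuple permKV. Qed.

Lemma measurable_tperm_tuple n (s : {perm 'I_n}) : measurable_fun setT (tperm_tuple s).
Proof.
apply/measurable_fun_tnthP => i.
rewrite (_ : _ \o _ = (fun x : n.-tuple R => tnth x (s i))).
  exact: measurable_tnth.
by apply/funext => x /=; rewrite tnth_mktuple.
Qed.

(** The preimage of a box is the box with permuted sides, whose volume is the same product in
    another order. *)
Lemma integral_lebesgue_tuple_perm n (s : {perm 'I_n}) (h : n.-tuple R -> \bar R) :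
  measurable_fun setT h -> (forall x, (0 <= h x)%E) ->
  (\int[lebt n]_x h (tperm_tuple s x) = \int[lebt n]_x h x)%E.
Proof.
move=> mh h0.
pose q : {measure set (n.-tuple R) -> \bar R} := pushforward (lebt n) (tperm_tuple s).
pose p := q (measurable_tperm_tuple s).
transitivity (\int[p]_x h x)%E.
  by rewrite ge0_integral_pushforward//=; exact: measurable_tperm_tuple.
apply: eq_measure_integral => A mA _; apply: box_measure_unique => //.
  move=> a b; rewrite /p /= /pushforward.
  rewrite (_ : _ @^-1` _ = box (fun i => a (s^-1 i)%g) (fun i => b (s^-1 i)%g)).
    rewrite !lebesgue_tuple_rect; try by move=> i; exact: measurable_itv.
    by rewrite [RHS](reindex_perm s^-1%g).
  apply/seteqP; split => x /= xab i.
    by have := xab (s^-1 i)%g; rewrite tnth_mktuple permKV.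
  by have := xab (s i); rewrite tnth_mktuple permK.
move=> a b; rewrite /p /= /pushforward.
rewrite (_ : _ @^-1` _ = box (fun i => a (s^-1 i)%g) (fun i => b (s^-1 i)%g)).
  exact: lebesgue_tuple_box_fin.
apply/seteqP; split => x /= xab i.
  by have := xab (s^-1 i)%g; rewrite tnth_mktuple permKV.
by have := xab (s i); rewrite tnth_mktuple permK.
Qed.

Lemma integral_translation (a : R) (h : R -> \bar R) :
  measurable_fun setT h -> (forall x, (0 <= h x)%E) ->
  (\int[leb]_x h (a + x)%R = \int[leb]_x h x)%E.
Proof.
move=> mh h0.
have mt : measurable_fun setT (fun x : R => a + x) by apply: measurable_funD.
pose q : {measure set (measurableTypeR R) -> \bar R} :=
  pushforward leb ((fun x : R => a + x) : measurableTypeR R -> measurableTypeR R).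
pose p := q mt.
transitivity (\int[p]_x h x)%E.
  by rewrite (@ge0_integral_pushforward _ _ (measurableTypeR R) (measurableTypeR R)).
apply: eq_measure_integral => A mA _; apply/esym/lebesgue_measure_unique => //.
move=> _ [[u v] _ <-]; rewrite /p /= /pushforward.
rewrite (_ : _ @^-1` _ = `]u - a, v - a]%classic).
  by rewrite !lebesgue_measure_itv/= !lte_fin ltrD2r; case: ifP => // _;
    rewrite -!EFinB; congr EFin; ring.
by apply/seteqP; split => x /=; rewrite !in_itv/= ltrBlDl lerBrDl.
Qed.

(** The points with base [a] and successive increments [y]; [pts 0 y] lists the partial sums of [y],
    starting with 0. *)
Definition pts n (a : R) (y : n.-tuple R) : n.+1.-tuple R :=
  [tuple a + \sum_(j < n | (j < i)%N) tnth y j | i < n.+1].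

Lemma pts_tcons n a b (y : n.-tuple R) :
  pts a (tcons (b, y)) = tcons (a, pts (a + b) y).
Proof.
apply: eq_from_tnth => i; rewrite tnth_mktuple.
have [j ->|->] := unliftP ord0 i; last first.
  by rewrite tnth_tcons0 big_pred0// addr0.
rewrite tnth_tconsS tnth_mktuple/= -addrA; congr (_ + _).
rewrite big_mkcond big_ord_recl/= tnth_tcons0/=; congr (_ + _).
rewrite [RHS]big_mkcond; apply: eq_bigr => l _.
by rewrite tnth_tconsS.
Qed.

Lemma measurable_pts n : measurable_fun setT (fun p : R * n.-tuple R => pts p.1 p.2).
Proof.
apply/measurable_fun_tnthP => i.
rewrite (_ : _ \o _ = (fun p : R * n.-tuple R =>
  p.1 + \sum_(j <- seq.filter (fun j : 'I_n => (j < i)%N) (index_enum 'I_n)) tnth p.2 j)); last first.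
  by apply/funext => p /=; rewrite tnth_mktuple big_filter.
apply: measurable_funD => //; apply: measurable_sum => j.
by apply: (measurableT_comp (@measurable_tnth _ _ _ j)).
Qed.

(** The change from points to base and increments is triangular with unit diagonal; it is obtained
    one coordinate at a time from translation invariance. *)
Lemma integral_lebesgue_tuple_pts n (h : n.+1.-tuple R -> \bar R) :
  measurable_fun setT h -> (forall x, (0 <= h x)%E) ->
  (\int[lebt n.+1]_x h x = \int[leb]_a \int[lebt n]_y h (pts a y))%E.
Proof.
elim: n h => [|n IH] h mh h0.
  rewrite integral_lebesgue_tupleS//; apply: eq_integral => a _.
  apply: eq_integral => x _; congr h; apply: eq_from_tnth => i.
  by rewrite (ord1 i) tnth_tcons0 tnth_mktuple big_pred0 ?addr0.
rewrite integral_lebesgue_tupleS//; apply: eq_integral => a _.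
have mha : measurable_fun setT (fun x => h (tcons (a, x))).
  exact: measurable_tcons_section.
(* With the first point fixed at [a], the second is [a + b]; the translation makes the increment [b]
   the variable, as in [pts_tcons]. *)
rewrite IH// -(integral_translation a); last 2 first.
- pose g (p : R * n.-tuple R) := h (tcons (a, pts p.1 p.2)).
  apply: (measurable_fun_fubini_tonelli_F g); last by move=> x; exact: h0.
  by apply: (measurableT_comp mha); exact: measurable_pts.
- by move=> b; apply: integral_ge0 => x _; exact: h0.
rewrite integral_lebesgue_tupleS//; last first.
  apply: (measurableT_comp mh).
  exact: (measurableT_comp (@measurable_pts n.+1) (measurable_pair1 a)).
by apply: eq_integral => b _; apply: eq_integral => y _; rewrite pts_tcons.
Qed.

End ChangeOfVariables.

(** * Decomposition of the space of increments into sectors *)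

Section SortedChangeOfVariables.
Context {R : realType}.
Notation leb := (@lebesgue_measure R).
Notation lebt := (@lebesgue_tuple R).

Definition diffs n (z : n.+1.-tuple R) : n.-tuple R :=
  [tuple tnth z (lift ord0 i) - tnth z (widen_ord (leqnSn n) i) | i < n].

Definition pos_tuple n : set (n.-tuple R) := rect (fun _ => `]0, +oo[%classic).

Lemma pos_tupleP n (y : n.-tuple R) : pos_tuple y <-> forall i, 0 < tnth y i.
Proof. by split => y0 i; have := y0 i; rewrite /= in_itv/= andbT. Qed.

Lemma measurable_pos_tuple n : measurable (@pos_tuple n).
Proof. by apply: measurable_rect => i; exact: measurable_itv. Qed.

Lemma diffs_pts n a (y : n.-tuple R) : diffs (pts a y) = y.
Proof.
apply: eq_from_tnth => i; rewrite !tnth_mktuple/=.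
rewrite opprD addrACA subrr add0r (bigD1 i)/=; last by rewrite /bump.
rewrite (eq_bigl (fun j : 'I_n => (j < i)%N)); first by rewrite addrK.
by move=> j; rewrite /bump/= add1n ltnS [in RHS]ltn_neqAle andbC.
Qed.

Lemma measurable_diffs n : measurable_fun setT (@diffs n).
Proof.
apply/measurable_fun_tnthP => i.
rewrite (_ : _ \o _ = (fun z : n.+1.-tuple R =>
    tnth z (lift ord0 i) - tnth z (widen_ord (leqnSn n) i))).
  by apply: measurable_funB; exact: measurable_tnth.
by apply/funext => x /=; rewrite tnth_mktuple.
Qed.

Lemma pos_diffs_sorted n (z : n.+1.-tuple R) :
  pos_tuple (diffs z) <-> sorted <%R z.
Proof.
split => [/pos_tupleP zpos|/(sortedP 0) zs].
  apply/(sortedP 0) => i; rewrite size_tuple ltnS => ilt.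
  have := zpos (Ordinal ilt); rewrite tnth_mktuple subr_gt0.
  by rewrite !(tnth_nth 0)/= /bump/= add1n.
apply/pos_tupleP => i; rewrite tnth_mktuple subr_gt0.
have := zs i; rewrite size_tuple ltnS => /(_ (ltn_ord i)).
by rewrite !(tnth_nth 0)/= /bump/= add1n.
Qed.

(** Some permutation sorts [z], and only one does because the entries are distinct. *)
Lemma sum_indic_sorted n (z : n.+1.-tuple R) : uniq z ->
  (\sum_(s : {perm 'I_n.+1}) (\1_(@pos_tuple n) (diffs (tperm_tuple s^-1 z)) : R)%:E = 1)%E.
Proof.
move=> uz.
have [p zp] : exists p : 'S_n.+1, sort <=%R z = tperm_tuple p z.
  by apply/tuple_permP; rewrite perm_sort.
have sz : sorted <%R (tperm_tuple p z).
  by rewrite -zp sort_lt_sorted.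
rewrite (bigD1 p^-1%g)//= big1 ?adde0.
  by rewrite invgK indicE mem_set//; exact/pos_diffs_sorted.
move=> s sp; rewrite indicE memNset// => /pos_diffs_sorted ss.
move/eqP: sp; apply; rewrite -[LHS]invgK; congr (_^-1)%g.
have E : tperm_tuple s^-1 z = tperm_tuple p z :> seq R.
  apply: lt_sorted_eq => // x; apply: perm_mem.
  rewrite (@perm_trans _ z)//.
    by apply/tuple_permP; exists s^-1%g.
  by rewrite perm_sym; apply/tuple_permP; exists p.
have /val_inj {}E := E.
apply/permP => i; have := congr1 (fun t : n.+1.-tuple R => tnth t i) E.
rewrite !tnth_mktuple !(tnth_nth 0) => /eqP.
by rewrite nth_uniq ?size_tuple// => /eqP /val_inj.
Qed.

Lemma measurable_diag m (k l : 'I_m) :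
  measurable [set z : m.-tuple R | tnth z k = tnth z l].
Proof.
have /= := @measurable_fun_eqr _ _ R setT _ _ (@measurable_tnth _ _ m k) (@measurable_tnth _ _ m l).
move=> /(_ measurableT [set true]); rewrite setTI => /(_ _); set A := _ @^-1` _.
rewrite (_ : A = [set z | tnth z k = tnth z l]); first exact.
by apply/seteqP; split => z /= /eqP.
Qed.

Lemma lebesgue_tuple_hyperplane m (k : 'I_m) (a : R) :
  lebt m [set x | tnth x k = a] = 0%E.
Proof.
rewrite (_ : [set x | _] = rect (fun l => if l == k then [set a] else setT)).
  rewrite lebesgue_tuple_rect; last first.
    by move=> l; case: ifP => // _; exact: measurable_set1.
  by rewrite (bigD1 k)//= eqxx lebesgue_measure_set1 mul0e.
apply/seteqP; split => [x /= xk l|x /(_ k)]; last by rewrite eqxx.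
by case: eqVneq => [->|].
Qed.

(** Slicing along the first coordinate gives either a diagonal in one dimension less or a
    hyperplane, which is a rectangle with a side reduced to a point. *)
Lemma lebesgue_tuple_diag n (i j : 'I_n) : i != j ->
  lebt n [set z | tnth z i = tnth z j] = 0%E.
Proof.
have mdiag m := @measurable_diag m.
have E m (k l : 'I_m.+1) : lebt m.+1 [set z | tnth z k = tnth z l] =
    (\int[leb]_a (lebt m [set x | tnth (tcons (a, x)) k = tnth (tcons (a, x)) l]))%E.
  rewrite -[in LHS](setIT [set z | _]) -integral_indic//.
  have mi : measurable_fun setT (fun z : m.+1.-tuple R =>
      (\1_[set z | tnth z k = tnth z l] z : R)%:E).
    by apply/measurable_EFinP; apply: measurable_indic; exact: mdiag.
  have i0 z : (0 <= (\1_[set z : m.+1.-tuple R | tnth z k = tnth z l] z : R)%:E)%E.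
    by rewrite lee_fin.
  rewrite integral_lebesgue_tupleS//.
  apply: eq_integral => a _.
  rewrite -[in RHS](setIT [set z | _]) -integral_indic//.
  rewrite -[X in measurable X]setTI.
  have mc : measurable_fun setT (fun x : m.-tuple R => tcons (a, x)).
    exact: (measurable_cons (measurable_cst a) (@measurable_id _ _ _)).
  exact: (mc measurableT _ (mdiag _ k l)).
  exact: mdiag.
have slice0 m a (k : 'I_m) := @lebesgue_tuple_hyperplane m k a.
elim: n i j => [[]//|n IH] i j ij.
rewrite E; apply: integral0_eq => a _.
have [i' ei|ei] := unliftP ord0 i; have [j' ej|ej] := unliftP ord0 j; rewrite ei ej.
- rewrite (_ : [set x | _] = [set x | tnth x i' = tnth x j']).
    by apply: IH; apply: contraNneq ij => e; rewrite ei ej e.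
  by apply/seteqP; split => x /=; rewrite !tnth_tconsS.
- rewrite (_ : [set x | _] = [set x | tnth x i' = a]) ?slice0//.
  by apply/seteqP; split => x /=; rewrite tnth_tconsS tnth_tcons0.
- rewrite (_ : [set x | _] = [set x | tnth x j' = a]) ?slice0//.
  by apply/seteqP; split => x /=; rewrite tnth_tconsS tnth_tcons0 => /esym.
- by rewrite ei ej eqxx in ij.
Qed.

Lemma lebesgue_tuple_ae_uniq n : {ae lebt n, forall z : n.-tuple R, uniq z}.
Proof.
have aeij (p : 'I_n * 'I_n) : {ae lebt n, forall z : n.-tuple R,
    p.1 != p.2 -> tnth z p.1 != tnth z p.2}.
  have [->|ij] := eqVneq p.1 p.2; first by apply: aeW => z; rewrite eqxx.
  exists [set z | tnth z p.1 = tnth z p.2]; split.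
  - exact: measurable_diag.
  - exact: lebesgue_tuple_diag.
  - by move=> z /= /not_implyP[_ /negP]; rewrite negbK => /eqP.
have FF := ae_filter_ringOfSetsType (lebt n).
have := @filter_forall _ _ _ _ FF aeij; apply: filterS => z zij.
apply/(uniqP 0) => i j; rewrite !inE size_tuple => ilt jlt.
move=> /eqP; apply: contraTeq => ij.
by have := zij (Ordinal ilt, Ordinal jlt); rewrite !(tnth_nth 0); exact.
Qed.

(** The integral over increments is lifted to one over [n+1] points, the first of them weighted by a
    density [phi] of mass 1. Almost every configuration is sorted by exactly one permutation, and
    each piece is brought to sorted points by permuting coordinates, which preserves the measure;
    the base is then integrated out. *)
Lemma integral_sorted_sectors n (h : n.-tuple R -> \bar R) :
  measurable_fun setT h -> (forall x, (0 <= h x)%E) ->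
  (\int[lebt n]_x h x = \sum_(s : {perm 'I_n.+1}) \int[lebt n]_y
     ((\1_(@pos_tuple n) y : R)%:E * h (diffs (tperm_tuple s (pts 0 y)))))%E.
Proof.
move=> mh h0.
pose phi (a : R) : \bar R := (\1_(`[0, 1]%classic : set R) a : R)%:E.
have phi0 a : (0 <= phi a)%E by rewrite lee_fin.
have mphi : measurable_fun setT phi.
  by apply/measurable_EFinP; exact: measurable_indic.
have iphi : (\int[leb]_a phi a = 1)%E.
  rewrite integral_indic//= (_ : _ `&` _ = `[0, 1]%classic); last exact: setIT.
  by rewrite lebesgue_measure_itv/= lte_fin ltr01 oppr0 adde0.
have iphit b : (\int[leb]_a phi (a + b)%R = 1)%E.
  by under eq_integral do rewrite addrC; rewrite integral_translation.
pose H (z : n.+1.-tuple R) := (phi (tnth z ord0) * h (diffs z))%E.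
have mH : measurable_fun setT H.
  apply: emeasurable_funM.
    by apply: (measurableT_comp mphi); exact: measurable_tnth.
  by apply: (measurableT_comp mh); exact: measurable_diffs.
have H0 z : (0 <= H z)%E by rewrite mule_ge0.
pose I (z : n.+1.-tuple R) : \bar R := (\1_(@pos_tuple n) (diffs z) : R)%:E.
have mI : measurable_fun setT I.
  apply/measurable_EFinP/measurableT_comp; last exact: measurable_diffs.
  by apply: measurable_indic; exact: measurable_pos_tuple.
have I0 z : (0 <= I z)%E by rewrite lee_fin.
transitivity (\int[lebt n.+1]_z H z)%E.
  rewrite integral_lebesgue_tuple_pts//.
  rewrite -[LHS]mul1e -iphi -ge0_integralZr//; last exact: integral_ge0.
  apply: eq_integral => a _.
  rewrite -ge0_integralZl//; apply: eq_integral => y _.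
  by rewrite /H diffs_pts tnth_mktuple big_pred0 ?addr0.
transitivity (\int[lebt n.+1]_z (\sum_(s : {perm 'I_n.+1}) I (tperm_tuple s^-1 z) * H z))%E.
  apply: ge0_ae_eq_integral => //.
  - apply: emeasurable_sum => s; apply: emeasurable_funM => //.
    by apply: (measurableT_comp mI); exact: measurable_tperm_tuple.
  - by move=> z _; apply: sume_ge0 => s _; rewrite mule_ge0.
  - apply: filterS (@lebesgue_tuple_ae_uniq n.+1) => z uz _.
    rewrite -ge0_sume_distrl; last by move=> s _; exact: I0.
    by rewrite sum_indic_sorted// mul1e.
rewrite ge0_integral_sum//; last 2 first.
- move=> s; apply: emeasurable_funM => //.
  by apply: (measurableT_comp mI); exact: measurable_tperm_tuple.
- by move=> s z _; rewrite mule_ge0.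
apply: eq_bigr => s _.
rewrite -(integral_lebesgue_tuple_perm s); last 2 first.
- apply: emeasurable_funM => //.
  by apply: (measurableT_comp mI); exact: measurable_tperm_tuple.
- by move=> z; rewrite mule_ge0.
under eq_integral do rewrite tperm_tupleK.
have mHs : measurable_fun setT (fun z => H (tperm_tuple s z)).
  by apply: (measurableT_comp mH); exact: measurable_tperm_tuple.
rewrite integral_lebesgue_tuple_pts; last 2 first.
- exact: emeasurable_funM.
- by move=> z; rewrite mule_ge0.
pose g (p : R * n.-tuple R) := (I (pts p.1 p.2) * H (tperm_tuple s (pts p.1 p.2)))%E.
have mg : measurable_fun setT g.
  by apply: emeasurable_funM; [apply: (measurableT_comp mI)|apply: (measurableT_comp mHs)];
    exact: measurable_pts.
have g0 p : (0 <= g p)%E by rewrite mule_ge0.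
(* The base point [a] is integrated first: the increments do not depend on it, and its weight is a
   translate of [phi], hence of mass 1. *)
have FT := @fubini_tonelli _ _ _ _ R leb (lebt n) g mg g0.
transitivity (\int[leb]_a \int[lebt n]_y g (a, y))%E; first by [].
etransitivity; first exact: FT.
apply: eq_integral => y _; rewrite /g /I/=.
under eq_integral => a _.
  rewrite diffs_pts /H (_ : diffs _ = diffs (tperm_tuple s (pts 0 y))); last first.
    by apply: eq_from_tnth => i; rewrite !tnth_mktuple; ring.
  rewrite muleA [(_ * phi _)%E]muleC -muleA !tnth_mktuple.
  over.
rewrite ge0_integralZr//.
- by rewrite iphit mul1e.
- by apply: (measurableT_comp mphi); exact: measurable_funD.
- by rewrite mule_ge0// lee_fin.
Qed.

End SortedChangeOfVariables.

(** * Measurability of the inverse and of the Gaussian density *)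

(** Inversion is discontinuous at 0, where its value is 0, but it is the pointwise limit of the
    continuous functions [x / (x^2 + 1/(n+1))], which also vanish at 0. *)
Lemma measurable_invr (R : realType) : measurable_fun [set: R] (@GRing.inv R).
Proof.
have hV (x : R) : x / (x ^+ 2 + n.+1%:R^-1) @[n --> \oo] --> x^-1.
  have [->|x0] := eqVneq x 0.
    by rewrite invr0; under eq_fun do rewrite mul0r; exact: cvg_cst.
  have -> : x^-1 = x * (x ^+ 2 + 0)^-1 by rewrite addr0; field.
  apply: cvgMr; apply: cvgV; first by rewrite addr0 expf_neq0.
  by apply: cvgD; [exact: cvg_cst|exact: cvg_harmonic].
pose h (n : nat) (x : R) : R := x / (x ^+ 2 + n.+1%:R^-1).
apply: (@measurable_fun_cvg _ _ _ _ h) => [n|x _]; last exact: hV.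
rewrite /h.
apply: continuous_measurable_fun => x.
apply: cvgM; first exact: cvg_id.
apply: cvgV; first by rewrite gt_eqF// ltr_wpDl// ?sqr_ge0// invr_gt0.
by apply: cvgD; [exact: exprn_continuous|exact: cvg_cst].
Qed.

Lemma measurable_funV d (T : measurableType d) (R : realType) (f : T -> R) :
  measurable_fun setT f -> measurable_fun setT (fun x => (f x)^-1).
Proof. exact: measurableT_comp (@measurable_invr R). Qed.

Lemma measurable_fun_sqrt d (T : measurableType d) (R : realType) (f : T -> R) :
  measurable_fun setT f -> measurable_fun setT (fun x => Num.sqrt (f x)).
Proof.
apply: measurableT_comp; apply: continuous_measurable_fun; exact: sqrt_continuous.
Qed.

Lemma measurable_normal_pdf2 d (T : measurableType d) (R : realType) (s x : T -> R) :
  measurable_fun setT s -> measurable_fun setT x ->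
  measurable_fun setT (fun t => normal_pdf 0 (s t) (x t)).
Proof.
move=> ms mx.
have mpi : measurable_fun setT (fun t => (s t) ^+ 2 * pi *+ 2).
  under eq_fun do rewrite -mulr_natr.
  by apply: measurable_funM => //; apply: measurable_funM => //; exact: measurable_funX.
rewrite /normal_pdf; apply: measurable_fun_if => //.
- exact: measurable_fun_eqr.
- apply: measurable_funTS; apply: measurableT_comp => //.
- apply: measurable_funTS; apply: measurable_funM.
    by apply: measurable_funV; exact: measurable_fun_sqrt.
  apply: measurableT_comp => //; apply: measurable_funM.
    apply: measurableT_comp => //; apply: measurable_funX.
    by under eq_fun do rewrite subr0.
  apply: measurable_funV; under eq_fun do rewrite -mulr_natr.
  by apply: measurable_funM => //; exact: measurable_funX.
Qed.

(** * An exponential mixture of centred Gaussians is a Laplace law *)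

Section LaplaceDensity.
Context {R : realType}.
Notation leb := (@lebesgue_measure R).

Let g : R -> R := normal_pdf 0 1.
Let G (u : R) : R := fine (normal_prob 0 1 `]-oo, u]).

Let normal_prob_itvNyc_cvg : normal_prob (0:R) 1 `]-oo, u] @[u --> +oo] --> 1%E.
Proof.
pose idT : measurableTypeR R -> R := idfun.
pose X : {RV normal_prob (0:R) 1 >-> R} :=
  HB.pack idT (@isMeasurableFun.Build _ _ _ _ idT (@measurable_id _ _ setT)).
exact: (cvg_cdfy1 X).
Qed.

Let normal_prob_itvNyc_cvgNy : normal_prob (0:R) 1 `]-oo, u] @[u --> -oo] --> 0%E.
Proof.
pose idT : measurableTypeR R -> R := idfun.
pose X : {RV normal_prob (0:R) 1 >-> R} :=
  HB.pack idT (@isMeasurableFun.Build _ _ _ _ idT (@measurable_id _ _ setT)).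
exact: (cvg_cdfNy0 X).
Qed.

Let cvgGy : G u @[u --> +oo] --> (1 : R).
Proof. exact: (fine_cvg normal_prob_itvNyc_cvg). Qed.

Let cvgGNy : G u @[u --> -oo] --> (0 : R).
Proof. exact: (fine_cvg normal_prob_itvNyc_cvgNy). Qed.

Let is_derive_G (u : R) : is_derive u (1 : R) G (g u).
Proof.
have /= := @continuous_FTC1 R g -oo%O u (u + 1).
case.
- by rewrite ltrDl.
- apply: (@integrableS _ _ _ leb setT) => //; exact: integrable_normal_pdf.
- by rewrite ltNyr.
- by apply: continuous_normal_pdf; exact: oner_neq0.
- rewrite derive1E => dG <-; exact/derivableP.
Qed.

Let normal_pdf_std (u : R) : g u = (Num.sqrt (pi *+ 2))^-1 * expR (- u ^+ 2 / 2).
Proof.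
by rewrite /g normal_pdfE ?oner_neq0// /normal_peak /normal_fun subr0 expr1n mul1r.
Qed.

(** Completing the square: the cross term of [(W + b/W)^2 / 2] is [b], which the prefactor cancels.
    The right side is even in [b], so [b] and [-b] yield the same Gaussian factor. *)
Let gaussian_shift (W b : R) : W != 0 ->
  expR b * g (W + b / W) =
  (Num.sqrt (pi *+ 2))^-1 * expR (- (W ^+ 2 / 2) - b ^+ 2 / (2 * W ^+ 2)).
Proof.
move=> W0; rewrite normal_pdf_std mulrCA -expRD; congr (_ * expR _).
by field.
Qed.

(** The integrand has an explicit primitive on the positive axis. With [s = sqrt(2c)], [b = s |x|],
    [w = sqrt(2e)] and [G] the normal distribution function, it is [A = s/2 (e^b G(w + b/w) + e^(-b)
    G(w - b/w))]: by [gaussian_shift] the derivatives of the two terms share one Gaussian factor and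
    their [b/w^3] parts cancel. At infinity both values of [G] tend to 1; at 0 they tend to 1 and 0,
    since [x != 0] makes [b] positive. The difference of the limits is [s/2 e^(-b)]. *)
Lemma laplace_mixture (c x : R) : 0 < c -> x != 0 ->
  (\int[leb]_e (exponential_pdf 1 e * normal_pdf 0 (Num.sqrt (e / c)) x)%:E =
   (Num.sqrt (2 * c) / 2 * expR (- (Num.sqrt (2 * c) * `|x|)))%:E)%E.
Proof.
move=> c0 x0.
set s : R := Num.sqrt (2 * c).
have s0 : 0 < s by rewrite sqrtr_gt0 mulr_gt0.
set b : R := s * `|x|.
have b0 : 0 < b by rewrite mulr_gt0// normr_gt0.
have b2 : b ^+ 2 = 2 * c * x ^+ 2.
  by rewrite exprMn sqr_sqrtr ?real_normK ?num_real// mulr_ge0// ltW.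
pose w (e : R) : R := Num.sqrt (2 * e).
pose A (e : R) : R :=
  s / 2 * (expR b * G (w e + b / w e) + expR (- b) * G (w e + (- b) / w e)).
pose f (e : R) : R := exponential_pdf 1 e * normal_pdf 0 (Num.sqrt (e / c)) x.
have w0 (e : R) : 0 < e -> 0 < w e by move=> e0; rewrite sqrtr_gt0 mulr_gt0.
have w2 (e : R) : 0 < e -> w e ^+ 2 = 2 * e.
  by move=> e0; rewrite sqr_sqrtr// mulr_ge0// ltW.
have fE (e : R) : 0 < e -> f e = s * (Num.sqrt (pi *+ 2))^-1 *
    expR (- (w e ^+ 2 / 2) - b ^+ 2 / (2 * w e ^+ 2)) / w e.
  move=> e0; rewrite /f exponential_pdfE ?ltW// mul1r.
  have ec0 : 0 < Num.sqrt (e / c) by rewrite sqrtr_gt0 divr_gt0.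
  rewrite normal_pdfE ?gt_eqF// /normal_peak /normal_fun subr0 sqr_sqrtr ?divr_ge0 ?ltW//.
  rewrite mulrCA -expRD b2 w2//.
  have -> : - (1) * e + - x ^+ 2 / (e / c *+ 2) =
      - (2 * e / 2) - 2 * c * x ^+ 2 / (2 * (2 * e)).
    by rewrite -mulr_natr; field; rewrite !gt_eqF.
  rewrite [RHS]mulrAC; congr (_ * expR _).
  have piE (q : R) : e / c * q *+ 2 = (2 * e) * (q *+ 2) / (2 * c).
    by rewrite !mulr2n; field; rewrite gt_eqF.
  rewrite piE.
  have pi20 : 0 < pi *+ 2 :> R by rewrite mulrn_wgt0// pi_gt0.
  rewrite sqrtrM ?mulr_ge0 ?ltW// sqrtrM ?mulr_ge0 ?ltW// sqrtrV ?mulr_ge0 ?ltW//.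
  rewrite -/(w e) -/s; have : Num.sqrt (pi *+ 2) != 0 :> R by rewrite gt_eqF// sqrtr_gt0.
  move: (Num.sqrt (pi *+ 2)) => q q0; field.
  by rewrite q0 !gt_eqF//= w0.
have dA (e : R) : 0 < e -> is_derive e (1 : R) A (f e).
  move=> e0; have we := w0 _ e0; have wn0 := lt0r_neq0 we.
  have e20 : 0 < 2 * e by rewrite mulr_gt0.
  have dwe : is_derive e (1 : R) w ((w e)^-1).
    have d1 := @is_derive1_sqrt R _ e20.
    apply: (is_derive_eq (@is_derive1_comp _ Num.sqrt (fun e => 2 * e) e _ _ d1 _)).
    by rewrite scaler1/= -/(w e); field.
  have dV : is_derive e (1 : R) (fun e => (w e)^-1) (- (w e) ^- 2 *: (w e)^-1).
    exact: is_deriveV.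
  have dG (t : R) : is_derive e (1 : R) (fun e => G (w e + t / w e))
      (g (w e + t / w e) * ((w e)^-1 - t * (w e) ^- 3)).
    have du : is_derive e (1 : R) (fun e => w e + t / w e) ((w e)^-1 - t * (w e) ^- 3).
      have dtV := @is_deriveZ _ _ _ _ t _ _ _ dV.
      apply: (is_derive_eq (@is_deriveD _ _ _ _ _ _ _ _ _ dwe dtV)).
      by rewrite /GRing.scale/=; field.
    exact: (@is_derive1_comp _ G _ e _ _ (is_derive_G _) du).
  have dZ1 := @is_deriveZ _ _ _ _ (expR b) _ _ _ (dG b).
  have dZ2 := @is_deriveZ _ _ _ _ (expR (- b)) _ _ _ (dG (- b)).
  have dS := @is_deriveZ _ _ _ _ (s / 2) _ _ _ (@is_deriveD _ _ _ _ _ _ _ _ _ dZ1 dZ2).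
  apply: (is_derive_eq dS).
  rewrite fE// /GRing.scale/=.
  have h1 := @gaussian_shift (w e) b wn0; have h2 := @gaussian_shift (w e) (- b) wn0.
  rewrite sqrrN in h2.
  rewrite mulrA h1 [X in _ + X]mulrA h2.
  move: (Num.sqrt (pi *+ 2))^-1 => q; field.
  exact: wn0.
have wy : w e @[e --> +oo] --> +oo.
  apply/cvgryPge => M; near=> e.
  have M1 : `|M| ^+ 2 <= 2 * e.
    by rewrite -ler_pdivrMl//; near: e; apply: nbhs_pinfty_ge; rewrite num_real.
  apply: (le_trans (ler_norm M)).
  have -> : `|M| = Num.sqrt (`|M| ^+ 2) by rewrite sqrtr_sqr normr_id.
  by rewrite ler_wsqrtr.
have wty (t : R) : w e + t / w e @[e --> +oo] --> +oo.
  apply/cvgryPge => M; near=> e.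
  have we : Num.max 1 (M + `|t|) <= w e.
    by near: e; move/cvgryPge : wy; exact.
  move: we; rewrite ge_max => /andP[we1 weM].
  have we0 : 0 < w e by rewrite (lt_le_trans _ we1).
  have : - `|t| <= t / w e.
    rewrite lerNl (le_trans (ler_norm _))// normrN normrM ler_piMr//.
    by rewrite normfV gtr0_norm// invf_le1.
  by move: (t / w e) => u; lra.
have Ay : A e @[e --> +oo] --> s / 2 * (expR b + expR (- b)).
  apply: cvgMr; rewrite -[X in X + _]mulr1 -[X in _ + X]mulr1.
  apply: cvgD; apply: cvgMr; exact: (cvg_comp _ _ (wty _) cvgGy).
(* Chosen so that [w (en n)] is exactly [1/(n+1)]: the lower end of integration tends to 0 along
   this sequence. *)
pose en (n : nat) : R := n.+1%:R ^- 2 / 2.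
have en0 n : 0 < en n by rewrite divr_gt0// invr_gt0 exprn_gt0.
have wen n : w (en n) = n.+1%:R^-1.
  by rewrite /w /en mulrCA divff// mulr1 -exprVn sqrtr_sqr ger0_norm.
have nty (t : R) : 0 < t -> t * n.+1%:R @[n --> \oo] --> +oo.
  move=> t0; apply/cvgryPge => M; near=> n.
  rewrite -ler_pdivrMl// (@le_trans _ _ n%:R)//; last by rewrite ler_nat.
  by near: n; exact: nbhs_infty_ger.
have Aen : A (en n) @[n --> \oo] --> s / 2 * expR b.
  rewrite -(addr0 (expR b)) -[X in X + _]mulr1 -(mulr0 (expR (- b))).
  apply: cvgMr; apply: cvgD; apply: cvgMr.
    apply: (cvg_comp _ G _ cvgGy) => //=.
    apply/cvgryPge => M; near=> n; rewrite wen invrK.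
    rewrite (@le_trans _ _ (b * n.+1%:R))// ?lerDr ?invr_ge0//.
    by near: n; move/cvgryPge : (nty _ b0); exact.
  apply: (cvg_comp _ G _ cvgGNy) => //=.
  apply/cvgrNyPle => M; near=> n; rewrite wen invrK mulNr lerBlDr.
  rewrite (@le_trans _ _ 1)//; first by rewrite invf_le1// ler1n.
  rewrite -lerBlDl; near: n; move/cvgryPge : (nty _ b0); exact.
have f0 (e : R) : 0 <= f e.
  by rewrite mulr_ge0// ?normal_pdf_ge0// exponential_pdf_ge0.
have mf : measurable_fun setT f.
  apply: measurable_funM; first exact: measurable_exponential_pdf.
  apply: measurable_normal_pdf2 => //.
  by apply: measurable_fun_sqrt; exact: measurable_funM.
have In n : (\int[leb]_(e in `[en n, +oo[) (f e)%:E =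
    (s / 2 * (expR b + expR (- b)) - A (en n))%:E)%E.
  have ae (e : R) : en n <= e -> 0 < e by apply: lt_le_trans.
  have cA (e : R) : 0 < e -> {for e, continuous A}.
    by move=> e0; have [dA1 _] := dA _ e0; exact/differentiable_continuous/derivable1_diffP.
  rewrite [RHS]EFinB; apply: (@ge0_continuous_FTC2y R f A (en n)).
  - by move=> e _; exact: f0.
  - apply: continuous_in_subspaceT => e; rewrite inE/= in_itv/= andbT => /ae e0.
    pose F (e : R) := s * (Num.sqrt (pi *+ 2))^-1 *
      expR (- (w e ^+ 2 / 2) - b ^+ 2 / (2 * w e ^+ 2)) / w e.
    have cw : w y @[y --> e] --> w e.
      apply: (cvg_comp (fun y => 2 * y) Num.sqrt _ (@sqrt_continuous R (2 * e))).
      by apply: cvgM; [exact: cvg_cst|exact: cvg_id].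
    have cw2 : w y ^+ 2 @[y --> e] --> w e ^+ 2.
      exact: (cvg_comp _ (fun u => u ^+ 2) cw (@exprn_continuous R 2 (w e))).
    have cF : F y @[y --> e] --> F e.
      apply: cvgM; last by apply: cvgV => //; rewrite gt_eqF// w0.
      apply: cvgM; first exact: cvg_cst.
      apply: (cvg_comp _ expR); last exact: continuous_expR.
      apply: cvgB; first by apply: cvgN; apply: cvgM => //; exact: cvg_cst.
      apply: cvgM; first exact: cvg_cst.
      apply: cvgV; first by rewrite gt_eqF// mulr_gt0// exprn_gt0// w0.
      by apply: cvgM => //; exact: cvg_cst.
    rewrite /continuous_at (fE _ e0) -/(F e); apply: cvg_trans cF.
    by apply: near_eq_cvg; near=> y; rewrite fE//; near: y; exact: lt_nbhsr.
  - exact: Ay.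
  - by move=> e /ltW /ae e0; have [] := dA _ e0.
  - by apply: cvg_at_right_filter; exact: cA.
  - move=> e; rewrite in_itv/= andbT => /ltW /ae e0.
    by have [_] := dA _ e0; rewrite derive1E.
have -> : (\int[leb]_e (f e)%:E = \int[leb]_(e in `]0%R, +oo[) (f e)%:E)%E.
  rewrite integral_itv_obnd_cbnd; last first.
    by apply/measurable_EFinP; exact: measurable_funTS.
  rewrite [RHS]integral_mkcond; apply: eq_integral => e _.
  rewrite patchE; case: ifPn => // /negP e0.
  rewrite /f lt0_exponential_pdf ?mul0r// ltNge; apply/negP => e0'.
  by apply: e0; rewrite inE/= in_itv/= e0'.
have Fcvg : (\int[leb]_(e in `[en n, +oo[) (f e)%:E)%E @[n --> \oo] -->
    (\int[leb]_(e in \bigcup_n `[en n, +oo[%classic) (f e)%:E)%E.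
  apply: ge0_nondecreasing_set_cvg_integral => //.
  - move=> n m nm; apply/subsetPset => e /=; rewrite !in_itv/= !andbT; apply: le_trans.
    rewrite /en ler_wpM2r// lef_pV2 ?posrE ?exprn_gt0//.
    by rewrite ler_pXn2r ?nnegrE// ler_nat.
  - by move=> n; apply/measurable_EFinP; exact: measurable_funTS.
  - by move=> n e _; rewrite lee_fin.
rewrite (_ : \bigcup_n _ = `]0, +oo[%classic) in Fcvg; last first.
  apply/seteqP; split => [e [n _]|e] /=; rewrite !in_itv/= !andbT.
    exact: lt_le_trans.
  move=> e0; have : n.+1%:R^-1 @[n --> \oo] --> (0 : R) by exact: cvg_harmonic.
  move=> /cvgrPdist_lt /(_ _ e0)[n _ /(_ n (leqnn _))].
  rewrite sub0r normrN ger0_norm// => ne; exists n => //=.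
  rewrite in_itv/= andbT (le_trans _ (ltW ne))//.
  have q0 : 0 < n.+1%:R^-1 :> R by rewrite invr_gt0.
  have q1 : n.+1%:R^-1 <= 1 :> R by rewrite invf_le1// ler1n.
  rewrite /en /= /harmonic -exprVn; move: q0 q1; move: (n.+1%:R^-1 : R) => q q0 q1.
  by nra.
suff F2 : (\int[leb]_(e in `[en n, +oo[) (f e)%:E)%E @[n --> \oo] -->
    (s / 2 * expR (- b))%:E by exact: (cvg_unique _ Fcvg F2).
rewrite (funext In); apply: cvg_EFin; first by near=> n.
rewrite (_ : s / 2 * expR (- b) =
  s / 2 * (expR b + expR (- b)) - s / 2 * expR b); last by ring.
by apply: cvgB; [exact: cvg_cst|exact: Aen].
Unshelve. all: by end_near.
Qed.

End LaplaceDensity.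

(** * Order statistics and gaps *)

Section GapsOfSorted.
Context {R : realType}.

Lemma gaps_sorted n (z z' : n.+1.-tuple R) : sorted <=%R z -> perm_eq z' z ->
  gaps z' = diffs z.
Proof.
move=> sz zz'; apply: eq_from_tnth => i; rewrite !tnth_mktuple.
have -> : sort <=%R (tval z') = z.
  apply: (@sorted_eq _ <=%R) => //; [exact: le_trans|exact: le_anti| |].
    by apply: sort_sorted; exact: le_total.
  by rewrite perm_sort.
by rewrite !(tnth_nth 0).
Qed.

(** Replaces an order statistic by a count of entries, which no longer involves sorting.
    Measurability and continuity of [gaps] both rest on it. *)
Lemma le_nth_sort (s : seq R) i a : (i < size s)%N ->
  (nth 0 (sort <=%R s) i <= a) = (i < count (fun x : R => (x <= a)%R) s)%N.
Proof.
move=> is_.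
have /seq.permP <- := permEl (perm_sort <=%R s).
have : (i < size (sort <=%R s))%N by rewrite size_sort.
have : sorted <=%R (sort <=%R s) by apply: sort_sorted; exact: le_total.
elim: (sort _ s) i {is_} => // x t IH i /= xt.
have tsorted : sorted <=%R t by apply: path_sorted xt.
have cnt0 : x <= a = false -> count (fun x => x <= a) t = 0%N.
  move=> xa; apply/eqP; rewrite -leqn0 leqNgt -has_count; apply/hasPn => y yt.
  have /allP/(_ _ yt) xy := order_path_min (@le_trans _ R) xt.
  by apply/negP => ya; move: xa; rewrite (le_trans xy ya).
case: i => [_|i] /=.
  by case: (boolP (x <= a)) => //= /negbTE /cnt0 ->.
rewrite ltnS => it; rewrite IH//.
case: (boolP (x <= a)) => //= /negbTE /cnt0 -> //.
Qed.

(** Rebuilding points from the permuted increments returns the original points up to a permutation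
    and a shift, neither of which affects gaps. The tuple [p] below has the shift built in, so that
    only a permutation remains. *)
Lemma diffs_tperm_pts n (s : {perm 'I_n.+1}) (y : n.-tuple R) : (forall i, 0 < tnth y i) ->
  gaps (pts 0 (diffs (tperm_tuple s (pts 0 y)))) = y.
Proof.
move=> y0; set z := tperm_tuple s _.
have zE i : tnth (pts 0 (diffs z)) i = tnth z i - tnth z ord0.
  rewrite tnth_mktuple add0r; case: i; elim=> [|i IH] ilt.
    rewrite big_pred0//= (_ : Ordinal ilt = ord0) ?subrr//; exact: val_inj.
  have ilt' : (i < n)%N by rewrite -ltnS.
  rewrite (bigD1 (Ordinal ilt'))//= (eq_bigl (fun j : 'I_n => (j < i)%N)); last first.
    by move=> j; rewrite ltnS [in RHS]ltn_neqAle andbC.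
  rewrite (IH (ltnW ilt)) tnth_mktuple addrA.
  have -> : lift ord0 (Ordinal ilt') = Ordinal ilt by apply: val_inj.
  have -> : widen_ord (leqnSn n) (Ordinal ilt') = Ordinal (ltnW ilt) by apply: val_inj.
  by rewrite subrK.
pose p := pts (- tnth z ord0) y.
rewrite (@gaps_sorted _ p) ?diffs_pts//.
  have : sorted <%R p.
    by apply/pos_diffs_sorted; rewrite diffs_pts; exact/pos_tupleP.
  by rewrite lt_sorted_uniq_le => /andP[].
apply/tuple_permP; exists s; congr tval; apply: eq_from_tnth => i.
rewrite zE [RHS]tnth_mktuple /p /z {1}/tperm_tuple tnth_mktuple.
by rewrite /pts !tnth_mktuple add0r addrC.
Qed.

End GapsOfSorted.

(** * Scaling exponential variables, in one and several dimensions *)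

Section ScaledExponential.
Context {R : realType}.
Notation leb := (@lebesgue_measure R).
Notation lebt := (@lebesgue_tuple R).

Lemma integral_scaling (c : R) (h : R -> \bar R) : 0 < c ->
  measurable_fun setT h -> (forall x, (0 <= h x)%E) ->
  (c^-1%:E * \int[leb]_x h (x / c)%R = \int[leb]_x h x)%E.
Proof.
move=> c0 mh h0.
have mt : measurable_fun setT (fun x : R => x / c) by apply: measurable_funM.
pose q : {measure set (measurableTypeR R) -> \bar R} :=
  pushforward leb ((fun x : R => x / c) : measurableTypeR R -> measurableTypeR R).
pose p := q mt.
have ci0 : 0 <= c^-1 by rewrite invr_ge0 ltW.
pose r : {nonneg R} := NngNum ci0.
have -> : (\int[leb]_x h (x / c)%R = \int[p]_x h x)%E.
  by rewrite (@ge0_integral_pushforward _ _ (measurableTypeR R) (measurableTypeR R)).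
transitivity (\int[mscale r p]_x h x)%E.
  by rewrite ge0_integral_mscale.
apply: eq_measure_integral => A mA _; apply/esym/lebesgue_measure_unique => //.
move=> _ [[u v] _ <-].
have pE : p `]u, v]%classic = leb `]u * c, v * c]%classic.
  congr (leb _); apply/seteqP.
  by split => x /=; rewrite !in_itv/= ltr_pdivlMr// ler_pdivrMr.
transitivity (c^-1%:E * p `]u, v]%classic)%E; last by [].
rewrite pE !lebesgue_measure_itv/= !lte_fin ltr_pM2r//.
case: ifP => [_|_]; last by rewrite mule0.
by rewrite -!EFinB -EFinM -mulrBl mulrC mulfK// gt_eqF.
Qed.

(** A standard exponential variable divided by [c] is exponential of parameter [c]. *)
Lemma exponential_scaling (c : R) (h : R -> \bar R) : 0 < c ->
  measurable_fun setT h -> (forall x, (0 <= h x)%E) ->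
  (\int[leb]_x (h (x / c)%R * (exponential_pdf 1 x)%:E) =
   \int[leb]_x (h x * (exponential_pdf c x)%:E))%E.
Proof.
move=> c0 mh h0.
have pdf_ge0 (x : R) : 0 <= exponential_pdf c x by rewrite exponential_pdf_ge0// ltW.
have mp : measurable_fun setT (fun x => h x * (exponential_pdf c x)%:E)%E.
  apply: emeasurable_funM => //; apply/measurable_EFinP.
  exact: measurable_exponential_pdf.
rewrite -[RHS](integral_scaling c0)//; last by move=> x; rewrite mule_ge0// lee_fin.
rewrite -ge0_integralZl//; last 3 first.
- apply: (measurableT_comp mp); exact: measurable_funM.
- by move=> x _; rewrite mule_ge0// lee_fin.
- by rewrite lee_fin invr_ge0 ltW.
apply: eq_integral => x _; rewrite muleCA; congr (_ * _)%E; rewrite -EFinM.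
have [x0|x0] := ltP x 0.
  by rewrite !lt0_exponential_pdf ?mulr0// pmulr_llt0// invr_gt0.
congr EFin; rewrite exponential_pdfE// (@exponential_pdfE _ c) ?(divr_ge0 _ (ltW c0))//.
rewrite mulrA mulVf ?gt_eqF//; congr (_ * expR _).
by field; rewrite gt_eqF.
Qed.

(** A coordinatewise map transports a product density as soon as it does so in each coordinate.
    Quantifying over all [h] lets the induction hypothesis be applied with the first coordinate
    frozen. *)
Lemma integral_lebesgue_tuple_transport n (T p q : 'I_n -> R -> R) :
  (forall i, measurable_fun setT (T i)) ->
  (forall i, measurable_fun setT (p i)) -> (forall i x, 0 <= p i x) ->
  (forall i, measurable_fun setT (q i)) -> (forall i x, 0 <= q i x) ->
  (forall i h, measurable_fun setT h -> (forall x, (0 <= h x)%E) ->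
    (\int[leb]_x (h (T i x) * (p i x)%:E) = \int[leb]_x (h x * (q i x)%:E))%E) ->
  forall h, measurable_fun setT h -> (forall x, (0 <= h x)%E) ->
  (\int[lebt n]_x (h [tuple T i (tnth x i) | i < n] *
      (\prod_(i < n) p i (tnth x i))%:E) =
   \int[lebt n]_x (h x * (\prod_(i < n) q i (tnth x i))%:E))%E.
Proof.
have mprod m (g : 'I_m -> R -> R) : (forall i, measurable_fun setT (g i)) ->
    measurable_fun setT (fun x : m.-tuple R => \prod_(i < m) g i (tnth x i)).
  move=> mg; apply: measurable_prod => i _.
  by apply: (measurableT_comp (mg i)); exact: measurable_tnth.
have mtup m (S : 'I_m -> R -> R) : (forall i, measurable_fun setT (S i)) ->
    measurable_fun setT (fun x : m.-tuple R => [tuple S i (tnth x i) | i < m]).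
  move=> mS; apply/measurable_fun_tnthP => i.
  rewrite (_ : _ \o _ = (fun x : m.-tuple R => S i (tnth x i))).
    by apply: (measurableT_comp (mS i)); exact: measurable_tnth.
  by apply/funext => x /=; rewrite tnth_mktuple.
elim: n T p q => [|n IH] T p q mT mp p0 mq q0 Tpq h mh h0.
  rewrite !integral_lebesgue_tuple0; last 2 first.
  - by move=> x; rewrite mule_ge0// lee_fin prodr_ge0.
  - by move=> x; rewrite mule_ge0// lee_fin prodr_ge0.
  by rewrite !big_ord0; congr (h _ * _)%E; rewrite tuple0.
rewrite !integral_lebesgue_tupleS; last 4 first.
- by apply: emeasurable_funM => //; apply/measurable_EFinP; exact: mprod.
- by move=> x; rewrite mule_ge0// lee_fin prodr_ge0.
- apply: emeasurable_funM; last by apply/measurable_EFinP; exact: mprod.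
  by apply: (measurableT_comp mh); exact: mtup.
- by move=> x; rewrite mule_ge0// lee_fin prodr_ge0.
pose H (a : R) := (\int[lebt n]_x
  (h (tcons (a, x)) * (\prod_(i < n) q (lift ord0 i) (tnth x i))%:E))%E.
have mha a : measurable_fun setT (fun x => h (tcons (a, x))).
  exact: measurable_tcons_section.
have H0 a : (0 <= H a)%E.
  by apply: integral_ge0 => x _; rewrite mule_ge0// lee_fin prodr_ge0.
have mH : measurable_fun setT H.
  pose g (x : n.+1.-tuple R) :=
    (h x * (\prod_(i < n) q (lift ord0 i) (tnth x (lift ord0 i)))%:E)%E.
  have mg : measurable_fun setT g.
    apply: emeasurable_funM => //; apply/measurable_EFinP; apply: measurable_prod => i _.
    by apply: (measurableT_comp (mq _)); exact: measurable_tnth.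
  have := measurable_lebesgue_tuple_inner mg.
  rewrite (_ : (fun _ => _) = H).
    by apply=> x; rewrite /g mule_ge0// lee_fin prodr_ge0.
  apply/funext => a; apply: eq_integral => x _; rewrite /g.
  by congr (_ * _%:E)%E; apply: eq_bigr => i _; rewrite tnth_tconsS.
transitivity (\int[leb]_a (H (T ord0 a) * (p ord0 a)%:E))%E.
  apply: eq_integral => a _; rewrite /H -(IH (fun i => T (lift ord0 i))
    (fun i => p (lift ord0 i)) (fun i => q (lift ord0 i)))//; last first.
    by move=> i g mg g0; exact: Tpq.
  rewrite -ge0_integralZr//; last 3 first.
  - apply: emeasurable_funM; last first.
      apply/measurable_EFinP.
      exact: (mprod n (fun i => p (lift ord0 i)) (fun i => mp _)).
    exact: (measurableT_comp (mha _) (mtup n (fun i => T (lift ord0 i)) (fun i => mT _))).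
  - by move=> x _; rewrite mule_ge0// lee_fin prodr_ge0.
  - by rewrite lee_fin.
  apply: eq_integral => x _; rewrite big_ord_recl tnth_tcons0 /= -muleA -EFinM.
  congr (h _ * _%:E)%E; last first.
    by rewrite mulrC; congr (_ * _); apply: eq_bigr => i _; rewrite tnth_tconsS.
  apply: eq_from_tnth => i; rewrite tnth_mktuple.
  have [j ->|->] := unliftP ord0 i; last by rewrite !tnth_tcons0.
  by rewrite !tnth_tconsS tnth_mktuple.
rewrite Tpq//; apply: eq_integral => a _.
rewrite /H -ge0_integralZr//; last 3 first.
- apply: emeasurable_funM => //; apply/measurable_EFinP.
  exact: (mprod n (fun i => q (lift ord0 i)) (fun i => mq _)).
- by move=> x _; rewrite mule_ge0// lee_fin prodr_ge0.
- by rewrite lee_fin.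
apply: eq_integral => x _; rewrite big_ord_recl tnth_tcons0 /= -muleA -EFinM.
congr (h _ * _%:E)%E.
by rewrite mulrC; congr (_ * _); apply: eq_bigr => i _; rewrite tnth_tconsS.
Qed.

End ScaledExponential.

(** * Gaussian increments over exponential time gaps *)

Section OneStep.
Context {R : realType}.
Notation leb := (@lebesgue_measure R).
Notation lebt := (@lebesgue_tuple R).

Definition exp_density k (c y : k.-tuple R) : R :=
  \prod_(i < k) exponential_pdf (tnth c i) (tnth y i).

(** The entries of [v] are variances; they will be the gaps between consecutive times. *)
Definition normal_density k (v x : k.-tuple R) : R :=
  \prod_(i < k) normal_pdf 0 (Num.sqrt (tnth v i)) (tnth x i).

Definition laplace_density k (c x : k.-tuple R) : R :=
  \prod_(i < k) (Num.sqrt (2 * tnth c i) / 2 *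
    expR (- (Num.sqrt (2 * tnth c i) * `|tnth x i|))).

Definition divt k (e c : k.-tuple R) : k.-tuple R :=
  [tuple tnth e i / tnth c i | i < k].

Lemma measurable_divt k d (T : measurableType d) (e c : T -> k.-tuple R) :
  measurable_fun setT e -> measurable_fun setT c ->
  measurable_fun setT (fun t => divt (e t) (c t)).
Proof.
move=> me mc; apply/measurable_fun_tnthP => i.
rewrite (_ : _ \o _ = (fun t => tnth (e t) i / tnth (c t) i)).
  apply: measurable_funM; last apply: measurable_funV.
    by apply: (measurableT_comp (@measurable_tnth _ _ _ i)).
  by apply: (measurableT_comp (@measurable_tnth _ _ _ i)).
by apply/funext => x /=; rewrite tnth_mktuple.
Qed.

Lemma exp_density_ge0 k (c y : k.-tuple R) : (forall i, 0 < tnth c i) -> 0 <= exp_density c y.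
Proof. by move=> c0; apply: prodr_ge0 => i _; rewrite exponential_pdf_ge0// ltW. Qed.

Lemma measurable_exp_density k (c : k.-tuple R) : measurable_fun setT (exp_density c).
Proof.
apply: measurable_prod => i _.
by apply: (measurableT_comp (measurable_exponential_pdf _)); exact: measurable_tnth.
Qed.

Lemma normal_density_ge0 k (v x : k.-tuple R) : 0 <= normal_density v x.
Proof. by apply: prodr_ge0 => i _; exact: normal_pdf_ge0. Qed.

Lemma laplace_density_ge0 k (c x : k.-tuple R) : 0 <= laplace_density c x.
Proof. by apply: prodr_ge0 => i _; rewrite mulr_ge0 ?divr_ge0 ?sqrtr_ge0 ?expR_ge0. Qed.

Lemma measurable_laplace_density k (c : k.-tuple R) : measurable_fun setT (laplace_density c).
Proof.
apply: measurable_prod => i _.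
apply: measurable_funM => //; apply: (measurableT_comp (@measurable_expR R)).
apply: (measurableT_comp (@oppr_measurable R setT)).
apply: measurable_funM => //; apply: (measurableT_comp (@normr_measurable R setT)).
exact: measurable_tnth.
Qed.

Lemma measurable_normal_density2 k d (T : measurableType d) (v x : T -> k.-tuple R) :
  measurable_fun setT v -> measurable_fun setT x ->
  measurable_fun setT (fun t => normal_density (v t) (x t)).
Proof.
move=> mv mx; apply: measurable_prod => i _; apply: measurable_normal_pdf2.
  apply: measurable_fun_sqrt.
  by apply: (measurableT_comp (@measurable_tnth _ _ _ i)).
by apply: (measurableT_comp (@measurable_tnth _ _ _ i)).
Qed.

Lemma exp_density_scaling k (c : k.-tuple R) (h : k.-tuple R -> \bar R) :
  (forall i, 0 < tnth c i) -> measurable_fun setT h -> (forall x, (0 <= h x)%E) ->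
  (\int[lebt k]_e (h (divt e c) * (exp_density [tuple 1 | i < k] e)%:E) =
   \int[lebt k]_y (h y * (exp_density c y)%:E))%E.
Proof.
move=> c0 mh h0.
have pdf1E e : exp_density [tuple 1 | i < k] e =
    \prod_(i < k) exponential_pdf 1 (tnth e i) :> R.
  by apply: eq_bigr => i _; rewrite tnth_mktuple.
under eq_integral do rewrite pdf1E.
apply: (integral_lebesgue_tuple_transport (T := fun i x => x / tnth c i)
  (p := fun i => exponential_pdf 1) (q := fun i => exponential_pdf (tnth c i))) => //.
- by move=> i; exact: measurable_funM.
- by move=> i; exact: measurable_exponential_pdf.
- by move=> i x; rewrite exponential_pdf_ge0.
- by move=> i; exact: measurable_exponential_pdf.
- by move=> i x; rewrite exponential_pdf_ge0// ltW.
- by move=> i g mg g0; exact: exponential_scaling.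
Qed.

Lemma exp_normal_mixture k (c x : k.-tuple R) :
  (forall i, 0 < tnth c i) -> (forall i, tnth x i != 0) ->
  (\int[lebt k]_e (normal_density (divt e c) x * exp_density [tuple 1 | i < k] e)%:E =
  (laplace_density c x)%:E)%E.
Proof.
move=> c0 x0.
transitivity (\int[lebt k]_e (\prod_(i < k)
    (exponential_pdf 1 (tnth e i) * normal_pdf 0 (Num.sqrt (tnth e i / tnth c i)) (tnth x i))%:E))%E.
  apply: eq_integral => e _; rewrite prodEFin; congr EFin.
  rewrite /normal_density /exp_density -big_split/=; apply: eq_bigr => i _.
  by rewrite !tnth_mktuple mulrC.
rewrite (@integral_lebesgue_tuple_prod _ _ (fun i u => (exponential_pdf 1 u *
  normal_pdf 0 (Num.sqrt (u / tnth c i)) (tnth x i))%:E)).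
- by rewrite /laplace_density -prodEFin; apply: eq_bigr => i _; exact: laplace_mixture.
- move=> i; apply/measurable_EFinP; apply: measurable_funM.
    exact: measurable_exponential_pdf.
  apply: measurable_normal_pdf2 => //.
  by apply: measurable_fun_sqrt; exact: measurable_funM.
- by move=> i u; rewrite lee_fin mulr_ge0// ?normal_pdf_ge0// exponential_pdf_ge0.
Qed.

(** Serves twice: the Laplace formula is stated away from 0, and a tuple outside the positive
    orthant with no zero entry has a negative one, where the exponential density vanishes. *)
Lemma lebesgue_tuple_ae_neq0 k :
  {ae lebt k, forall x : k.-tuple R, forall i, tnth x i != 0}.
Proof.
have FF := ae_filter_ringOfSetsType (lebt k).
apply: (@filter_forall _ _ _ _ FF) => i.
exists [set x | tnth x i = 0]; split.
- rewrite -[X in measurable X]setTI.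
  exact: (@measurable_tnth _ _ k i measurableT _ (measurable_set1 (0 : R))).
- exact: lebesgue_tuple_hyperplane.
- by move=> x /= /negP; rewrite negbK => /eqP.
Qed.

(** Tonelli moves the average over [e] inside, where [exp_normal_mixture] evaluates it for almost
    every [x]. *)
Lemma integral_exp_normal k (c : k.-tuple R) (F : k.-tuple R -> \bar R) :
  (forall i, 0 < tnth c i) -> measurable_fun setT F -> (forall x, (0 <= F x)%E) ->
  (\int[lebt k]_e ((\int[lebt k]_x (F x * (normal_density (divt e c) x)%:E)) *
      (exp_density [tuple 1 | i < k] e)%:E) =
   \int[lebt k]_x (F x * (laplace_density c x)%:E))%E.
Proof.
move=> c0 mF F0.
have p0 e : 0 <= exp_density [tuple 1 | i < k] e :> R.
  by apply: exp_density_ge0 => i; rewrite tnth_mktuple.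
have mdiv : measurable_fun setT (fun e => divt e c) by exact: measurable_divt.
pose g (q : k.-tuple R * k.-tuple R) : \bar R := (F q.2 *
  (normal_density (divt q.1 c) q.2 * exp_density [tuple 1 | i < k] q.1)%:E)%E.
have g0 q : (0 <= g q)%E by rewrite mule_ge0// lee_fin mulr_ge0// normal_density_ge0.
have mne : measurable_fun setT (fun q : k.-tuple R * k.-tuple R =>
    normal_density (divt q.1 c) q.2 * exp_density [tuple 1 | i < k] q.1).
  apply: measurable_funM.
    by apply: measurable_normal_density2 => //; exact: (measurableT_comp mdiv).
  by apply: (measurableT_comp (@measurable_exp_density _ _)).
have mg : measurable_fun setT g.
  apply: emeasurable_funM; last exact/measurable_EFinP.
  by apply: (measurableT_comp mF).
transitivity (\int[lebt k]_e \int[lebt k]_x g (e, x))%E.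
  apply: eq_integral => e _; rewrite -ge0_integralZr//; last 3 first.
  - apply: emeasurable_funM => //; apply/measurable_EFinP.
    exact: measurable_normal_density2.
  - by move=> x _; rewrite mule_ge0// lee_fin normal_density_ge0.
  - by rewrite lee_fin.
  by apply: eq_integral => x _; rewrite -muleA -EFinM.
rewrite (fubini_tonelli g)//.
have ml : measurable_fun setT (fun x => (laplace_density c x)%:E).
  by apply/measurable_EFinP; exact: measurable_laplace_density.
have mi x : measurable_fun setT (fun e =>
    (normal_density (divt e c) x * exp_density [tuple 1 | i < k] e)%:E).
  apply/measurable_EFinP; apply: measurable_funM; last exact: measurable_exp_density.
  exact: measurable_normal_density2.
apply: ge0_ae_eq_integral => //.
- exact: (measurable_fun_fubini_tonelli_G (m1 := lebt k) g).
- exact: emeasurable_funM.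
- by move=> x _; apply: integral_ge0 => e _; exact: g0.
- by move=> x _; rewrite mule_ge0// lee_fin laplace_density_ge0.
have aen0 := lebesgue_tuple_ae_neq0 k.
apply: filterS aen0.
move=> x x0 _; rewrite -(exp_normal_mixture c0 x0) /g/=.
rewrite ge0_integralZl//.
by move=> e _; rewrite lee_fin mulr_ge0// normal_density_ge0.
Qed.

End OneStep.

(** * The sectors produce the weights and parameters of the kernel *)

Section Sectors.
Context {R : realType}.
Notation lebt := (@lebesgue_tuple R).

(** By [le_nth_sort], an order statistic of index [i] exceeds [a] exactly when the number [N] of
    entries at most [a] is at most [i], and [N] is a sum of indicators. *)
Lemma measurable_gaps k : measurable_fun setT (@gaps R k).
Proof.
have mnth i : (i < k.+1)%N ->
    measurable_fun setT (fun z : k.+1.-tuple R => nth 0 (sort <=%R (tval z)) i).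
  move=> ik; apply: (measurability _ (RGenOInfty.measurableE R)) => _ [_ [a ->] <-].
  pose N (z : k.+1.-tuple R) : R := \sum_(j < k.+1) \1_(`]-oo, a]%classic) (tnth z j).
  have mN : measurable_fun setT N.
    apply: measurable_sum => j.
    apply: measurableT_comp; last exact: measurable_tnth.
    by apply: measurable_indic; exact: measurable_itv.
  rewrite (_ : _ `&` _ = setT `&` N @^-1` `]-oo, i%:R]).
    by apply: mN => //; exact: measurable_itv.
  congr (_ `&` _); apply/seteqP.
  have E z : (N z <= i%:R) = (a < nth 0 (sort <=%R (tval z)) i).
    rewrite ltNge le_nth_sort ?size_tuple// -leqNgt -(ler_nat R); congr (_ <= _).
    rewrite /N -sum1_count big_tuple natr_sum [RHS]big_mkcond/=.
    apply: eq_bigr => j _; rewrite indicE mem_setE in_itv/=.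
    by case: (_ <= a).
  by split => z /=; rewrite !in_itv/= ?andbT E.
apply/measurable_fun_tnthP => i.
rewrite (_ : _ \o _ = (fun z : k.+1.-tuple R =>
    nth 0 (sort <=%R (tval z)) i.+1 - nth 0 (sort <=%R (tval z)) i)).
  by apply: measurable_funB; apply: mnth; rewrite ltnS// ltnW.
by apply/funext => z /=; rewrite tnth_mktuple.
Qed.

(** The distance between two of the sorted points is the sum of the gaps separating them; the range
    of summation is the condition defining [Eset]. *)
Lemma pts_dist k (y : k.-tuple R) (a b : 'I_k.+1) : (forall i, 0 < tnth y i) ->
  `|tnth (pts 0 y) b - tnth (pts 0 y) a| =
  \sum_(i < k | (minn a b <= i < maxn a b)%N) tnth y i.
Proof.
move=> y0; wlog ab : a b / (a <= b)%N => [H|].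
  have /orP[ab|ba] := leq_total a b; first exact: H.
  by rewrite distrC (H _ _ ba); apply: eq_bigl => i; rewrite minnC maxnC.
rewrite (minn_idPl ab) (maxn_idPr ab) !tnth_mktuple !add0r.
have -> : \sum_(j < k | (j < b)%N) tnth y j - \sum_(j < k | (j < a)%N) tnth y j =
    \sum_(i < k | (a <= i < b)%N) tnth y i.
  rewrite (bigID (fun j : 'I_k => (j < a)%N))/= addrC.
  rewrite (eq_bigl (fun j : 'I_k => (a <= j < b)%N)); last first.
    by move=> j; rewrite -leqNgt andbC.
  rewrite [X in _ + X - _](eq_bigl (fun j : 'I_k => (j < a)%N)) ?addrK// => j.
  by rewrite andbC; case: ltnP => //= ja; rewrite (leq_trans ja ab).
by rewrite ger0_norm// sumr_ge0// => i _; exact: ltW.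
Qed.

(** The path [s 0, ..., s k] visits both [i] and [i+1], so some step must cross between them;
    otherwise [s j <= i] would not depend on [j]. *)
Lemma Eset_nonempty k (s : {perm 'I_k.+1}) (i : 'I_k) : exists j, Eset s i j.
Proof.
apply: contrapT => noE.
have step (j : 'I_k) : (s (widen_ord (leqnSn k) j) <= i)%N = (s (lift ord0 j) <= i)%N.
  apply/idP/idP => h; apply: contrapT => /negP; rewrite -ltnNge => h'; apply: noE;
    exists j; rewrite /Eset.
    by rewrite geq_min h/= leq_max h' orbT.
  by rewrite geq_min h orbT/= leq_max h'.
have all0 (j : 'I_k.+1) : (s j <= i)%N = (s ord0 <= i)%N.
  case: j; elim => [|j IH] jk; first by congr (nat_of_ord (s _) <= i)%N; exact: val_inj.
  have jk' : (j < k)%N by rewrite -ltnS.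
  have := step (Ordinal jk').
  rewrite (_ : widen_ord _ _ = Ordinal (ltnW jk)); last exact: val_inj.
  rewrite (_ : lift _ _ = Ordinal jk); last exact: val_inj.
  by rewrite IH.
have := all0 (s^-1 (widen_ord (leqnSn k) i))%g; have := all0 (s^-1 (lift ord0 i))%g.
by rewrite !permKV/= leqnn /bump/= add1n ltnn => <-.
Qed.

Lemma Fcomp_ge k (s : {perm 'I_k.+1}) (c : k.-tuple R) (i : 'I_k) (m : R) : 0 <= m ->
  (forall j, m <= Num.sqrt (2 * tnth c j)) -> m <= Fcomp s c i.
Proof.
move=> m0 mc; have [j Ej] := Eset_nonempty s i.
rewrite /Fcomp (bigD1 j)//= (le_trans (mc j))// lerDl sumr_ge0//.
Qed.

Lemma Fcomp_gt0 k (s : {perm 'I_k.+1}) (c : k.-tuple R) (i : 'I_k) :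
  (forall j, 0 < tnth c j) -> 0 < Fcomp s c i.
Proof.
move=> c0; have [j Ej] := Eset_nonempty s i.
rewrite /Fcomp (bigD1 j)//=; apply: ltr_wpDr; first exact: sumr_ge0.
by rewrite sqrtr_gt0 mulr_gt0.
Qed.

(** In the exponent, each increment is a sum of the gaps it crosses; exchanging the sums collects,
    for gap [i], the rates of the increments crossing it, that is [Fcomp s c i]. Dividing and
    multiplying by the product of these rates leaves [wt s c] in front. *)
Lemma laplace_density_sector k (s : {perm 'I_k.+1}) (c y : k.-tuple R) :
  (forall i, 0 < tnth c i) -> (forall i, 0 < tnth y i) ->
  laplace_density c (diffs (tperm_tuple s (pts 0 y))) =
  wt s c * exp_density (Fmap s c) y.
Proof.
move=> c0 y0; pose sq i : R := Num.sqrt (2 * tnth c i).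
have E : \sum_(j < k) sq j * `|tnth (diffs (tperm_tuple s (pts 0 y))) j| =
    \sum_(i < k) Fcomp s c i * tnth y i.
  have dE (z : k.+1.-tuple R) j : tnth (diffs (tperm_tuple s z)) j =
      tnth z (s (lift ord0 j)) - tnth z (s (widen_ord (leqnSn k) j)).
    by rewrite tnth_mktuple !(tnth_mktuple (fun i => tnth z (s i))).
  under eq_bigr do rewrite dE pts_dist// mulr_sumr.
  rewrite (exchange_big_dep xpredT)//=; apply: eq_bigr => i _.
  by rewrite /Fcomp mulr_suml.
rewrite /laplace_density /wt /exp_density big_split/= -expR_sum sumrN -/sq E.
have -> : \prod_(i < k) exponential_pdf (tnth (Fmap s c) i) (tnth y i) =
    \prod_(i < k) Fcomp s c i * expR (- \sum_(i < k) Fcomp s c i * tnth y i).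
  rewrite -sumrN expR_sum -big_split/=; apply: eq_bigr => i _.
  by rewrite exponential_pdfE ?ltW// tnth_mktuple mulNr.
rewrite mulrA; congr (_ * _); rewrite -mulrA -big_split/= big_split/= mulrC.
congr (_ * _); first by rewrite prodr_const card_ord exprVn.
by apply: eq_bigr => i _; rewrite divfK// gt_eqF// Fcomp_gt0.
Qed.

Lemma wt_ge0 k (s : {perm 'I_k.+1}) (c : k.-tuple R) : 0 <= wt s c.
Proof.
rewrite mulr_ge0 ?invr_ge0 ?exprn_ge0// prodr_ge0// => i _.
by rewrite divr_ge0 ?sqrtr_ge0// sumr_ge0// => j _; exact: sqrtr_ge0.
Qed.

Lemma integral_laplace_sectors k (c : k.-tuple R) (f : k.-tuple R -> \bar R) :
  (forall i, 0 < tnth c i) -> measurable_fun setT f -> (forall x, (0 <= f x)%E) ->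
  (\int[lebt k]_x (f (gaps (pts 0 x)) * (laplace_density c x)%:E) =
  \sum_(s : {perm 'I_k.+1}) (wt s c)%:E *
    \int[lebt k]_y (f y * (exp_density (Fmap s c) y)%:E))%E.
Proof.
move=> c0 mf f0.
have F0 s i : 0 < tnth (Fmap s c) i by rewrite tnth_mktuple Fcomp_gt0.
have ml : measurable_fun setT (fun x => (laplace_density c x)%:E).
  by apply/measurable_EFinP; exact: measurable_laplace_density.
have mg : measurable_fun setT (fun x => f (gaps (pts 0 x))).
  apply: (measurableT_comp mf); apply: (measurableT_comp (@measurable_gaps k)).
  exact: (measurableT_comp (@measurable_pts _ _) (measurable_pair1 (0 : R))).
have h0 x : (0 <= f (gaps (pts 0 x)) * (laplace_density c x)%:E)%E.
  by rewrite mule_ge0// lee_fin laplace_density_ge0.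
have mh : measurable_fun setT (fun x => f (gaps (pts 0 x)) * (laplace_density c x)%:E)%E.
  exact: emeasurable_funM.
rewrite (integral_sorted_sectors mh h0); apply: eq_bigr => s _.
have me : measurable_fun setT (fun y => f y * (exp_density (Fmap s c) y)%:E)%E.
  by apply: emeasurable_funM => //; apply/measurable_EFinP; exact: measurable_exp_density.
have e0 y : (0 <= f y * (exp_density (Fmap s c) y)%:E)%E.
  by rewrite mule_ge0// lee_fin exp_density_ge0.
rewrite -(@ge0_integralZl _ _ _ (lebt k) _ measurableT _ me)//; last first.
  by rewrite lee_fin wt_ge0.
have mz : measurable_fun setT (fun y => diffs (tperm_tuple s (pts 0 y)) : k.-tuple R).
  apply: (measurableT_comp (@measurable_diffs _ _)).
  apply: (measurableT_comp (@measurable_tperm_tuple _ _ _)).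
  exact: (measurableT_comp (@measurable_pts _ _) (measurable_pair1 (0 : R))).
apply: ge0_ae_eq_integral => //.
- apply: emeasurable_funM; last exact: (measurableT_comp mh mz).
  by apply/measurable_EFinP; apply: measurable_indic; exact: measurable_pos_tuple.
- by apply: emeasurable_funM => //; exact: measurable_cst.
- by move=> y _; rewrite mule_ge0// ?lee_fin//.
- by move=> y _; rewrite mule_ge0// lee_fin wt_ge0.
apply: filterS (@lebesgue_tuple_ae_neq0 R k).
move=> y yn0 _; rewrite indicE.
have [|ypos] := boolP (y \in @pos_tuple R k).
  rewrite inE => /pos_tupleP y0.
  by rewrite mul1e diffs_tperm_pts// laplace_density_sector// EFinM muleCA.
(* Off the positive orthant both integrands vanish. A zero entry has to be excluded, because the
   exponential density is nonzero at 0. *)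
rewrite mul0e; have /existsP[i yi] : [exists i, tnth y i <= 0].
  apply: contrapT => /negP; rewrite negb_exists => /forallP ypos'.
  move/negP : ypos; apply; rewrite inE; apply/pos_tupleP => i.
  by rewrite ltNge.
have yi0 : tnth y i < 0 by rewrite lt_neqAle yn0.
by rewrite /exp_density (bigD1 i)//= lt0_exponential_pdf// mul0r !mule0.
Qed.

End Sectors.

(** * Continuity along sequences and rounding to a finite grid *)

Section SequentialContinuity.
Context {R : realType}.

Definition tuple_cvg n (u : nat -> n.-tuple R) (x : n.-tuple R) :=
  forall i, tnth (u m) i @[m --> \oo] --> tnth x i.

(** The form of continuity that dominated convergence uses and yields; [seqcont_continuous] converts
    it to the one required of test functions. *)
Definition seqcont n (f : n.-tuple R -> R) :=
  forall u x, tuple_cvg u x -> f (u m) @[m --> \oo] --> f x.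

(** If continuity failed at [v], choosing a bad row within [1/(m+1)] of [v] for each [m] would give
    a convergent sequence contradicting the hypothesis. *)
Lemma seqcont_continuous n (f : n.-tuple R -> R) :
  seqcont f -> continuous (f \o @row_to_tuple R n).
Proof.
move=> cf v; suff H e : 0 < e -> nbhs v (fun w => `|f (row_to_tuple v) - f (row_to_tuple w)| < e).
  by have FF := nbhs_filter v; apply/cvgrPdist_lt => e e0; exact: H.
move=> e0; apply: contrapT => nnear.
have bad (m : nat) : exists w : 'rV[R]_n,
    (forall i, `|v ord0 i - w ord0 i| < m.+1%:R^-1) /\
    ~ (`|f (row_to_tuple v) - f (row_to_tuple w)| < e).
  apply: contrapT => nobad; apply: nnear.
  exists (fun i j => [set y | `|v i j - y| < m.+1%:R^-1]) => /=.
    move=> i j; have /cvgrPdist_lt := @cvg_id _ (nbhs (v i j)).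
    by apply; rewrite invr_gt0.
  by move=> w vw; apply: contrapT => H; apply: nobad; exists w.
have [w wP] := choice bad.
have wv : tuple_cvg (fun m => row_to_tuple (w m)) (row_to_tuple v).
  move=> i; apply/cvgrPdist_lt => d d0.
  have /cvgrPdist_lt/(_ _ d0) : m.+1%:R^-1 @[m --> \oo] --> (0 : R) by exact: cvg_harmonic.
  apply: filterS => m /=; rewrite sub0r normrN ger0_norm ?invr_ge0// => md.
  rewrite !tnth_mktuple; have [/(_ i) vw _] := wP m.
  exact: lt_trans vw md.
have /cvgrPdist_lt/(_ _ e0)[m _ /(_ m (leqnn m))] := cf _ _ wv.
by have [_] := wP m.
Qed.

(** Every entry of [s] at most [a] faces an entry of [t] at most [a + e], so the count in
    [le_nth_sort] can only grow. *)
Lemma nth_sort_lipschitz (s t : seq R) i e : size s = size t -> (i < size s)%N ->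
  (forall j, (j < size s)%N -> nth 0 t j <= nth 0 s j + e) ->
  nth 0 (sort <=%R t) i <= nth 0 (sort <=%R s) i + e.
Proof.
move=> st ilt ste; rewrite le_nth_sort -?st//.
have : (i < count (fun x : R => (x <= nth 0 (sort <=%R s) i)%R) s)%N by rewrite -le_nth_sort.
move=> /leq_trans; apply; move: (nth 0 (sort _ s) i) => a.
elim: s t st ste {ilt} => [|x s IH] [|y t]//= [st] ste.
rewrite leq_add//; last by apply: IH => // j js; exact: (ste j.+1).
by have := ste 0%N isT; rewrite /=; case: (leP x a) => //= xa yx; case: leP => //= ya; have := lt_le_trans ya yx; rewrite ltrD2r ltNge xa.
Qed.

Lemma tuple_cvg_gaps k (u : nat -> k.+1.-tuple R) x :
  tuple_cvg u x -> tuple_cvg (fun m => gaps (u m)) (gaps x).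
Proof.
move=> ux.
have nthcvg i : (i < k.+1)%N -> nth 0 (sort <=%R (tval (u m))) i @[m --> \oo] -->
    nth 0 (sort <=%R (tval x)) i.
  move=> ik; apply/cvgrPdist_le => e e0.
  have : \forall m \near \oo, forall j, `|tnth x j - tnth (u m) j| <= e.
    by apply: filter_forall => j; have /cvgrPdist_le/(_ _ e0) := ux j.
  apply: filterS => m xu; rewrite ler_distlC; apply/andP; split.
    rewrite lerBlDr; apply: nth_sort_lipschitz; rewrite ?size_tuple// => j jk.
    by have := xu (Ordinal jk); rewrite ler_distl !(tnth_nth 0) => /andP[_].
  apply: nth_sort_lipschitz; rewrite ?size_tuple// => j jk.
  have := xu (Ordinal jk); rewrite ler_distl !(tnth_nth 0)/= => /andP[+ _].
  by rewrite lerBlDr.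
move=> i; rewrite tnth_mktuple.
under eq_fun do rewrite tnth_mktuple.
by apply: cvgB; apply: nthcvg; rewrite ltnS// ltnW.
Qed.

Lemma seqcont_gaps k (f : k.-tuple R -> R) : seqcont f -> seqcont (fun z => f (@gaps R k z)).
Proof. by move=> cf u x ux; apply: cf; exact: tuple_cvg_gaps. Qed.

(** Mesh [1/(m+1)] over the window from [-(m+1)] to [m+1]; index [(m+1)^2] is the origin. *)
Definition grid (m j : nat) : R := j%:R / m.+1%:R - m.+1%:R.
Definition gridn (m : nat) : nat := (2 * m.+1 * m.+1)%N.
(** Rounds down to the grid. Since [truncn] is 0 on negative numbers and the index is capped, points
    outside the window go to its nearest end. *)
Definition gidx (m : nat) (x : R) : nat :=
  minn (Num.truncn ((x + m.+1%:R) * m.+1%:R)) (gridn m).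
Definition rnd (m : nat) (x : R) : R := grid m (gidx m x).

Lemma gidx_lt m x : (gidx m x < (gridn m).+1)%N.
Proof. by rewrite ltnS geq_minr. Qed.

Lemma grid0 m : grid m (m.+1 * m.+1) = 0.
Proof. by rewrite /grid natrM mulfK ?subrr// pnatr_eq0. Qed.

Lemma grid_lt m i j : (i < j)%N -> grid m i < grid m j.
Proof. by move=> ij; rewrite ltrD2r ltr_pM2r ?invr_gt0// ltr_nat. Qed.

Lemma rnd_dist m (x : R) : `|x| <= m.+1%:R -> `|x - rnd m x| <= m.+1%:R^-1.
Proof.
rewrite /rnd ler_norml => /andP[x1 x2].
have M0 : 0 < m.+1%:R :> R by [].
set y := (x + m.+1%:R) * m.+1%:R.
have y0 : 0 <= y by rewrite mulr_ge0// -lerBlDr sub0r.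
have yN : y <= (gridn m)%:R.
  rewrite /y /gridn !natrM ler_pM2r//.
  by rewrite mulr_natl mulr2n lerD2r.
have /andP[t1 t2] := truncn_itv y0.
have -> : gidx m x = Num.truncn y.
  by apply/minn_idPl; rewrite -(ler_nat R) (le_trans t1).
rewrite /grid.
have xE : x = y / m.+1%:R - m.+1%:R by rewrite /y mulfK ?addrK// gt_eqF.
have -> : x - ((Num.truncn y)%:R / m.+1%:R - m.+1%:R) = (y - (Num.truncn y)%:R) / m.+1%:R.
  rewrite {1}xE mulrBl; move: (y / _) (_%:R / _) => p q; ring.
rewrite ger0_norm; last first.
  by rewrite mulr_ge0 ?invr_ge0// subr_ge0.
by rewrite ler_piMl ?invr_ge0// lerBlDr addrC natr1 ltW.
Qed.

(** The grid level and the argument move together: a convergent sequence is bounded, hence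
    eventually inside the growing window, where the rounding error is at most the mesh. *)
Lemma rnd_cvg (u : nat -> R) (x : R) : u m @[m --> \oo] --> x ->
  rnd m (u m) @[m --> \oo] --> x.
Proof.
move=> ux; suff : u m - rnd m (u m) @[m --> \oo] --> (0 : R).
  move=> d0; have -> : (fun m => rnd m (u m)) = (fun m => u m - (u m - rnd m (u m))).
    by apply/funext => m; ring.
  by rewrite -[x]subr0; apply: cvgB; [exact: ux|exact: d0].
apply/cvgrPdist_lt => e e0.
have : m.+1%:R^-1 @[m --> \oo] --> (0 : R) by exact: cvg_harmonic.
move=> /cvgrPdist_lt /(_ _ e0) hm.
near=> m; rewrite sub0r normrN.
apply: (@le_lt_trans _ _ m.+1%:R^-1).
  apply: rnd_dist; rewrite (@le_trans _ _ (`|x| + 1))//.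
    rewrite -(subrK x (u m)) addrC (le_trans (ler_normD _ _))// lerD2l distrC.
    by near: m; have /cvgrPdist_le := ux; apply.
  rewrite (@le_trans _ _ m%:R) ?ler_nat//.
  by near: m; apply: nbhs_infty_ger.
suff : `|0 - m.+1%:R^-1| < e by rewrite sub0r normrN ger0_norm// invr_ge0.
by near: m; exact: hm.
Unshelve. all: by end_near. Qed.

Lemma measurable_rnd m : measurable_fun setT (rnd m).
Proof.
apply: nondecreasing_measurable => // x y xy; rewrite lerD2r ler_pM2r ?invr_gt0// ler_nat.
rewrite leq_min geq_minr andbT (leq_trans (geq_minl _ _))//.
by apply: le_truncn; rewrite ler_pM2r// lerD2r.
Qed.

Definition rndt n (m : nat) (x : n.-tuple R) : n.-tuple R := [tuple rnd m (tnth x i) | i < n].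
Definition gridt n (m : nat) (J : {ffun 'I_n -> 'I_(gridn m).+1}) : n.-tuple R :=
  [tuple grid m (J i) | i < n].

Lemma rndt_gridt n m (x : n.-tuple R) : exists J, rndt m x = @gridt n m J.
Proof.
exists [ffun i => Ordinal (gidx_lt m (tnth x i))].
by apply: eq_from_tnth => i; rewrite !tnth_mktuple ffunE.
Qed.

Lemma tuple_cvg_rndt n (u : nat -> n.-tuple R) x :
  tuple_cvg u x -> tuple_cvg (fun m => rndt m (u m)) x.
Proof. by move=> ux i; under eq_fun do rewrite tnth_mktuple; apply: rnd_cvg. Qed.

Lemma measurable_rndt_eq n m d (T : measurableType d) (W : T -> n.-tuple R) J :
  measurable_fun setT W -> measurable [set w | rndt m (W w) = @gridt n m J].
Proof.
move=> mW; rewrite (_ : [set w | _] = \bigcap_(i in [set: 'I_n])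
    ((fun w => rnd m (tnth (W w) i)) @^-1` [set grid m (J i)])).
  apply: fin_bigcap_measurable => // i _; rewrite -[X in measurable X]setTI.
  have mf : measurable_fun setT (fun w => rnd m (tnth (W w) i)).
    apply: (measurableT_comp (measurable_rnd m)).
    by apply: (measurableT_comp (@measurable_tnth _ _ _ i)).
  exact: (mf measurableT _ (measurable_set1 (grid m (J i)))).
apply/seteqP; split => [w /= E i _|w E] /=.
  by have := congr1 (fun t => tnth t i) E; rewrite !tnth_mktuple.
by apply: eq_from_tnth => i; rewrite !tnth_mktuple; exact: E.
Qed.

(** A rounded argument takes finitely many values, so a random function may be evaluated at it once
    each frozen evaluation is measurable. Joint measurability of [X] is thereby avoided. *)
Lemma measurable_rndt_comp n m d (T : measurableType d) (W : T -> n.-tuple R)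
    d' (S : measurableType d') (X : T -> n.-tuple R -> S) :
  measurable_fun setT W -> (forall J, measurable_fun setT (fun w => X w (@gridt n m J))) ->
  measurable_fun setT (fun w => X w (rndt m (W w))).
Proof.
move=> mW mX _ A mA; rewrite setTI.
rewrite (_ : _ @^-1` A = \bigcup_(J in [set: {ffun 'I_n -> 'I_(gridn m).+1}])
   ([set w | rndt m (W w) = @gridt n m J] `&` (fun w => X w (@gridt n m J)) @^-1` A)).
  apply: fin_bigcup_measurable => // J _; apply: measurableI.
    exact: measurable_rndt_eq.
  by rewrite -[X in measurable X]setTI; exact: mX.
apply/seteqP; split => [w /= Aw|w [J _ [/= E]]]; last by rewrite E.
have [J EJ] := rndt_gridt m (W w); exists J => //; split => //=.
by rewrite -EJ.
Qed.

(** [f] is the pointwise limit of its compositions with rounding, which take finitely many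
    values. *)
Lemma seqcont_measurable n (f : n.-tuple R -> R) : seqcont f -> measurable_fun setT f.
Proof.
move=> cf; pose h (m : nat) (x : n.-tuple R) := f (rndt m x).
apply: (@measurable_fun_cvg _ _ _ _ h) => [m|x _].
  by apply: (@measurable_rndt_comp n m _ _ id _ _ (fun _ => f)).
by apply: cf; apply: tuple_cvg_rndt => i; exact: cvg_cst.
Qed.

End SequentialContinuity.

Lemma bounded_cvg_integral d (T : measurableType d) (R : realType) (P : probability T R)
    (f : nat -> T -> R) (g : T -> R) :
  (forall m, measurable_fun setT (f m)) -> (forall m x, 0 <= f m x <= 1) ->
  (forall x, f m x @[m --> \oo] --> g x) ->
  (\int[P]_x (f m x)%:E)%E @[m --> \oo] --> (\int[P]_x (g x)%:E)%E.
Proof.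
move=> mf f01 fg.
have mg : measurable_fun setT g by apply: (@measurable_fun_cvg _ _ _ _ f) => // x _.
have := @dominated_convergence _ T R P setT measurableT (fun m x => (f m x)%:E)
  (EFin \o g) (fun=> 1%E).
case.
- by move=> m; exact/measurable_EFinP.
- exact/measurable_EFinP.
- by apply: aeW => x _; apply: cvg_EFin; [exact: nearW|exact: fg].
- exact: finite_measure_integrable_cst.
- apply: aeW => x m _; have /andP[f0 f1] := f01 m x.
  by rewrite /= lee_fin ger0_norm.
by move=> _ _; exact.
Qed.

Lemma integral01 d (T : measurableType d) (R : realType) (P : probability T R) (f : T -> R) :
  measurable_fun setT f -> (forall x, 0 <= f x <= 1) ->
  (0 <= \int[P]_x (f x)%:E <= 1)%E.
Proof.
move=> mf f01; apply/andP; split.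
  by apply: integral_ge0 => x _; rewrite lee_fin; have /andP[] := f01 x.
apply: (@le_trans _ _ (\int[P]_x (cst 1%:E x))%E); last first.
  by rewrite integral_cst//= probability_setT mule1.
apply: ge0_le_integral => //.
- by move=> x _; rewrite lee_fin; have /andP[] := f01 x.
- exact/measurable_EFinP.
- by move=> x _; rewrite lee_fin; have /andP[] := f01 x.
Qed.

Lemma pts_diffs (R : realType) n (z : n.+1.-tuple R) i :
  tnth (pts 0 (diffs z)) i = tnth z i - tnth z ord0.
Proof.
rewrite tnth_mktuple add0r; case: i; elim=> [|i IH] ilt.
  rewrite big_pred0//= (_ : Ordinal ilt = ord0) ?subrr//; exact: val_inj.
have ilt' : (i < n)%N by rewrite -ltnS.
rewrite (bigD1 (Ordinal ilt'))//= (eq_bigl (fun j : 'I_n => (j < i)%N)); last first.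
  by move=> j; rewrite ltnS [in RHS]ltn_neqAle andbC.
rewrite (IH (ltnW ilt)) tnth_mktuple addrA.
have -> : lift ord0 (Ordinal ilt') = Ordinal ilt by apply: val_inj.
have -> : widen_ord (leqnSn n) (Ordinal ilt') = Ordinal (ltnW ilt) by apply: val_inj.
by rewrite subrK.
Qed.

(** * Law and independence of the increments over a fixed list of times *)

Section BrownianIncrements.
Context {R : realType} d (Omega : measurableType d) (P : probability Omega R)
  (B : nat -> Omega -> R -> R) (hB : iid_two_sided_BM P B).
Notation lebt := (@lebesgue_tuple R).

Let mB n t : measurable_fun setT (fun w => B n w t).
Proof. by have [] := hB. Qed.
Let cB n w : continuous (B n w).
Proof. by have [] := hB. Qed.

Definition Btuple n K (v : K.-tuple R) (w : Omega) : K.-tuple R :=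
  [tuple B n w (tnth v i) | i < K].

Lemma measurable_Btuple n K (v : K.-tuple R) : measurable_fun setT (Btuple n v).
Proof.
apply/measurable_fun_tnthP => i.
rewrite (_ : _ \o _ = (fun w => B n w (tnth v i))) //.
by apply/funext => w /=; rewrite tnth_mktuple.
Qed.

Lemma tuple_cvg_Btuple n K u (v : K.-tuple R) w : tuple_cvg u v ->
  tuple_cvg (fun m => Btuple n (u m) w) (Btuple n v w).
Proof.
move=> uv i; rewrite tnth_mktuple; under eq_fun do rewrite tnth_mktuple.
apply: (cvg_comp (fun m => tnth (u m) i) (B n w) (uv i)); exact: cB.
Qed.

Section Grid.
Context r (t : r.+1.-tuple R) (ht : forall i, 0 < tnth (diffs t) i).

Definition incr n (w : Omega) : r.-tuple R := diffs (Btuple n t w).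

Lemma measurable_incr n : measurable_fun setT (incr n).
Proof. by apply: (measurableT_comp (@measurable_diffs R r)); exact: measurable_Btuple. Qed.

Let q (j : 'I_r) : set R -> \bar R := normal_prob 0 (Num.sqrt (tnth (diffs t) j)).

(** Cylinder events of the first [n] motions, seen through their increments over [t]; they form the
    pi-system generating the past. *)
Definition past_rect n (A : nat -> 'I_r -> set R) : set Omega :=
  [set w | forall i, (i < n)%N -> rect (A i) (incr i w)].

Lemma past_rectE n (A : nat -> 'I_r -> set R) : (forall i j, measurable (A i j)) ->
  P (past_rect n A) = (\prod_(i < n) \prod_(j < r) q j (A i j))%E.
Proof.
move=> mA; have [_ _ _ /(_ n r (fun i => tnth t i))] := hB.
have tinc (i : 'I_r) : tnth t (widen_ord (leqnSn r) i) < tnth t (lift ord0 i).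
  by have := ht i; rewrite tnth_mktuple subr_gt0.
move=> /(_ tinc (fun i j => A i j) (fun i j => mA i j)).
rewrite pair_bigA/= => H; transitivity (P (\bigcap_(p in [set: 'I_n * 'I_r])
    [set w | A p.1 p.2 (B p.1 w (tnth t (lift ord0 p.2)) -
      B p.1 w (tnth t (widen_ord (leqnSn r) p.2)))])).
  congr (P _); apply/seteqP; split => [w Aw [i j] _ /=|w Aw i ilt j].
    by have := Aw i (ltn_ord i) j; rewrite !tnth_mktuple.
  by have := Aw (Ordinal ilt, j) I; rewrite /= !tnth_mktuple.
by rewrite H; apply: eq_bigr => p _; rewrite /q tnth_mktuple.
Qed.

(** The cylinder formula with the whole line imposed on the earlier motions, which contributes
    factors 1. *)
Lemma incr_rectE n (S : 'I_r -> set R) : (forall j, measurable (S j)) ->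
  P (incr n @^-1` rect S) = (\prod_(j < r) q j (S j))%E.
Proof.
move=> mS; pose A i : 'I_r -> set R := if i == n then S else fun _ => setT.
have mA i j : measurable (A i j) by rewrite /A; case: eqP.
rewrite (_ : _ @^-1` _ = past_rect n.+1 A); last first.
  apply/seteqP; split => [w Sw i _ j|w /(_ n (ltnSn _))]; rewrite /A ?eqxx//.
  by case: eqP => [->|]//; exact: Sw.
rewrite past_rectE// big_ord_recr/= big1 ?mul1e => [|i _].
  by rewrite /A eqxx.
by rewrite big1// => j _; rewrite /A ltn_eqF// /q probability_setT.
Qed.

Lemma past_incr_indep_rect n (A : nat -> 'I_r -> set R) (S : 'I_r -> set R) :
  (forall i j, measurable (A i j)) -> (forall j, measurable (S j)) ->
  P (past_rect n A `&` incr n @^-1` rect S) = (P (past_rect n A) * P (incr n @^-1` rect S))%E.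
Proof.
move=> mA mS; pose A' i : 'I_r -> set R := if i == n then S else A i.
have mA' i j : measurable (A' i j) by rewrite /A'; case: eqP.
rewrite (_ : _ `&` _ = past_rect n.+1 A'); last first.
  apply/seteqP; split => [w [Aw Sw] i|w Aw].
    rewrite ltnS leq_eqVlt /A' => /predU1P[->|ilt]; first by rewrite eqxx.
    by rewrite ltn_eqF//; exact: Aw.
  split => [i ilt|]; last by have := Aw n (ltnSn n); rewrite /A' eqxx.
  by have := Aw i (ltnW ilt); rewrite /A' ltn_eqF.
rewrite !past_rectE// incr_rectE// big_ord_recr/= /A' eqxx; congr (_ * _)%E.
by apply: eq_bigr => i _; rewrite ltn_eqF.
Qed.

Definition past_sets n : set (set Omega) :=
  [set E | exists A, (forall i j, measurable (A i j)) /\ E = past_rect n A].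

Lemma measurable_past_rect n A : (forall i j, measurable (A i j)) -> measurable (past_rect n A).
Proof.
move=> mA; rewrite (_ : past_rect n A = \bigcap_(i in [set: 'I_n]) (incr i @^-1` rect (A i))).
  apply: fin_bigcap_measurable => // i _; rewrite -[X in measurable X]setTI.
  by apply: measurable_incr => //; exact: measurable_rect.
by apply/seteqP; split => [w Aw i _|w Aw i ilt]; [exact: Aw|exact: (Aw (Ordinal ilt) I)].
Qed.

Lemma past_sigma_measurable n E : <<s past_sets n >> E -> measurable E.
Proof.
apply: smallest_sub; first exact: sigma_algebra_measurable.
by move=> _ [A [mA ->]]; exact: measurable_past_rect.
Qed.

(** Two uniqueness arguments: for a fixed box the identity extends from cylinders to the whole past,
    then for a fixed past event it extends from boxes to all measurable sets. Each compares a
    restriction of [P] with a multiple of [P]. *)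
Lemma past_incr_indep n E S : <<s past_sets n >> E -> measurable S ->
  P (E `&` incr n @^-1` S) = (P E * P (incr n @^-1` S))%E.
Proof.
move=> sE mS; have mE := past_sigma_measurable sE.
have mpre S' : measurable S' -> measurable (incr n @^-1` S').
  by move=> mS'; rewrite -[X in measurable X]setTI; exact: measurable_incr.
have fP A : measurable A -> (fine (P A))%:E = P A.
  by move=> mA; rewrite fineK// fin_num_measure.
have box_indep a b : P (E `&` incr n @^-1` box a b) = (P E * P (incr n @^-1` box a b))%E.
  set Sb := incr n @^-1` _; have mSb : measurable Sb by apply: mpre; exact: measurable_box.
  have r0 : 0 <= fine (P Sb) by rewrite fine_ge0.
  pose rr : {nonneg R} := NngNum r0.
  have H := @g_sigma_algebra_measure_unique _ R Omega (past_sets n) _ (fun=> setT) _ _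
    (mrestr P mSb) (mscale rr P) _ _ _ E sE.
  transitivity (mscale rr P E); last by rewrite /mscale/= fP// muleC.
  apply: H.
  - by move=> _ [A [mA ->]]; exact: measurable_past_rect.
  - move=> _; exists (fun _ _ => setT); split => //.
    by apply/seteqP; split.
  - by apply/seteqP; split => // w _; exists 0%N.
  - move=> _ _ [A [mA ->]] [A' [mA' ->]]; exists (fun i j => A i j `&` A' i j); split.
      by move=> i j; exact: measurableI.
    apply/seteqP; split => [w [Aw Aw'] i ilt j|w Aw]; first by split; [exact: Aw|exact: Aw'].
    by split => i ilt j; have [] := Aw i ilt j.
  - move=> _ [A [mA ->]]; transitivity (P (past_rect n A) * P Sb)%E.
      by apply: past_incr_indep_rect => // j; exact: measurable_itv.
    by rewrite muleC -[P Sb](fP Sb mSb).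
  - move=> _.
    exact: le_lt_trans (probability_le1 P (measurableI _ _ measurableT mSb)) (ltry _).
have r0 : 0 <= fine (P E) by rewrite fine_ge0.
pose rr : {nonneg R} := NngNum r0.
pose p1 : {measure set (r.-tuple R) -> \bar R} := pushforward (mrestr P mE) (incr n).
pose p2 : {measure set (r.-tuple R) -> \bar R} := pushforward (mscale rr P) (incr n).
have H := @box_measure_unique R r (p1 (measurable_incr n)) (p2 (measurable_incr n)) _ _ S mS.
rewrite setIC; transitivity (p2 (measurable_incr n) S); last first.
  by rewrite /p2 /= /pushforward /mscale/= fP.
apply: H.
- by move=> a b; rewrite /p1 /p2 /= /pushforward /mrestr /mscale/= fP// setIC box_indep.
- move=> a b; rewrite /p1 /= /pushforward /mrestr (@le_lt_trans _ _ 1%E) ?ltry// probability_le1//.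
  by apply: measurableI => //; apply: mpre; exact: measurable_box.
Qed.

(** Under the measure of density [\1_E], the increments have [P E] times their law under [P], by
    independence. *)
Lemma integral_past_incr n E (h : r.-tuple R -> \bar R) : <<s past_sets n >> E ->
  measurable_fun setT h -> (forall x, (0 <= h x)%E) ->
  (\int[P]_w ((\1_E w : R)%:E * h (incr n w)) = P E * \int[P]_w h (incr n w))%E.
Proof.
move=> sE mh h0; have mE := past_sigma_measurable sE.
have m1E : measurable_fun setT (\1_E : Omega -> R) by exact: measurable_indic.
have mhi : measurable_fun setT (fun w => h (incr n w)).
  by apply: (measurableT_comp mh); exact: measurable_incr.
have [m mP] := density_measure P m1E (fun w => ler0n _ _).
have mEq A : measurable A -> m A = P (A `&` E).
  by move=> mA; rewrite mP// integral_indic// setIC.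
have fP A : measurable A -> (fine (P A))%:E = P A.
  by move=> mA; rewrite fineK// fin_num_measure.
have r0 : 0 <= fine (P E) by rewrite fine_ge0.
pose rr : {nonneg R} := NngNum r0.
under eq_integral do rewrite muleC.
rewrite -(integral_density m1E (fun w => ler0n _ _) mP mhi)//.
pose p1 : {measure set (r.-tuple R) -> \bar R} := pushforward m (incr n).
pose p2 : {measure set (r.-tuple R) -> \bar R} := pushforward (mscale rr P) (incr n).
have -> : (\int[m]_x h (incr n x) = \int[p1 (measurable_incr n)]_x h x)%E.
  rewrite (@ge0_integral_pushforward _ _ _ _ _ _ (measurable_incr n) m setT h)//.
transitivity (\int[p2 (measurable_incr n)]_x h x)%E.
  apply: eq_measure_integral => A mAA _; rewrite /p1 /p2 /= /pushforward /mscale/= fP//.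
  rewrite mEq; first by rewrite setIC past_incr_indep.
  by rewrite -[X in measurable X]setTI; exact: measurable_incr.
rewrite ge0_integral_pushforward//=; last exact: measurable_incr.
by rewrite preimage_setT ge0_integral_mscale//= fP.
Qed.

Lemma integral_incr_density n (h : r.-tuple R -> \bar R) :
  measurable_fun setT h -> (forall x, (0 <= h x)%E) ->
  (\int[P]_w h (incr n w) = \int[lebt r]_x (h x * (normal_density (diffs t) x)%:E))%E.
Proof.
move=> mh h0.
have mnd : measurable_fun setT (normal_density (diffs t)).
  exact: measurable_normal_density2.
have [m mP] := density_measure (lebt r) mnd (fun x => normal_density_ge0 _ _).
rewrite -(integral_density mnd (fun x => normal_density_ge0 _ _) mP mh)//.
pose p1 : {measure set (r.-tuple R) -> \bar R} := pushforward P (incr n).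
transitivity (\int[p1 (measurable_incr n)]_x h x)%E.
  by rewrite ge0_integral_pushforward//=; exact: measurable_incr.
apply: eq_measure_integral => A mA _; apply: box_measure_unique => //.
  move=> a b; rewrite /p1/= /pushforward incr_rectE; last by move=> j; exact: measurable_itv.
  rewrite mP; last exact: measurable_box.
  rewrite integral_mkcond.
  transitivity (\int[lebt r]_x \prod_(j < r)
     ((\1_(`]a j, b j[%classic : set R) (tnth x j) *
       normal_pdf 0 (Num.sqrt (tnth (diffs t) j)) (tnth x j))%:E))%E; last first.
    apply: eq_integral => x _; rewrite prodEFin big_split/= EFinM.
    rewrite -(prodEFin _ _ (fun j => \1_(`]a j, b j[%classic) (tnth x j))) -indic_rect patchE indicE.
    by rewrite /box; case: ifP => _; rewrite ?mul1e ?mul0e.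
  rewrite (@integral_lebesgue_tuple_prod _ _ (fun j u => (\1_(`]a j, b j[%classic : set R) u *
       normal_pdf 0 (Num.sqrt (tnth (diffs t) j)) u)%:E)).
  - apply: eq_bigr => j _; rewrite /q /normal_prob integral_mkcond.
    apply: eq_integral => u _; rewrite patchE indicE.
    by case: ifP => _; rewrite ?mul1r ?mul0r.
  - move=> j; apply/measurable_EFinP; apply: measurable_funM; last exact: measurable_normal_pdf.
    by apply: measurable_indic; exact: measurable_itv.
  - by move=> j u; rewrite lee_fin mulr_ge0// normal_pdf_ge0.
move=> a b; rewrite /p1/= /pushforward (@le_lt_trans _ _ 1%E) ?ltry// probability_le1//.
by rewrite -[X in measurable X]setTI; apply: measurable_incr => //; exact: measurable_box.
Qed.

End Grid.
End BrownianIncrements.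

Lemma tval_map (R : realType) n (p q : n.-tuple R) (g : R -> R) :
  (forall i, tnth p i = g (tnth q i)) -> tval p = map g q.
Proof.
move=> H; have -> : p = map_tuple g q; last by [].
by apply: eq_from_tnth => i; rewrite tnth_map H.
Qed.

(** * Composing with one more motion, and its action on gaps *)

Section BrownianStep.
Context {R : realType} d (Omega : measurableType d) (P : probability Omega R)
  (B : nat -> Omega -> R -> R) (hB : iid_two_sided_BM P B).
Notation lebt := (@lebesgue_tuple R).

(** Values in [0, 1] make the constant 1 a dominating function and all integrals finite; the class
    is stable under the averaging operators below. *)
Definition unit_test K (f : K.-tuple R -> R) := (forall x, 0 <= f x <= 1) /\ seqcont f.

Let cB n w : continuous (B n w).
Proof. by have [] := hB. Qed.

Definition BM_mean n K (f : K.-tuple R -> R) (v : K.-tuple R) : R :=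
  fine (\int[P]_w (f (Btuple B n v w))%:E).

Lemma measurable_test_Btuple n K (f : K.-tuple R -> R) v : unit_test f ->
  measurable_fun setT (fun w => f (Btuple B n v w)).
Proof.
move=> [_ cf]; apply: (measurableT_comp (seqcont_measurable cf)).
exact: (measurable_Btuple hB).
Qed.

Lemma BM_meanE n K (f : K.-tuple R -> R) v : unit_test f ->
  (BM_mean n f v)%:E = (\int[P]_w (f (Btuple B n v w))%:E)%E.
Proof.
move=> tf; have mf := measurable_test_Btuple n v tf.
have /andP[i0 i1] := integral01 P mf (fun w => tf.1 _).
by rewrite fineK// ge0_fin_numE// (le_lt_trans i1)// ltry.
Qed.

Lemma BM_mean_test n K (f : K.-tuple R -> R) : unit_test f -> unit_test (BM_mean n f).
Proof.
move=> tf; split=> [v|u v uv].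
  have mf := measurable_test_Btuple n v tf.
  by have := integral01 P mf (fun w => tf.1 _); rewrite -(BM_meanE n v tf) !lee_fin.
apply: fine_cvg; rewrite BM_meanE//.
apply: bounded_cvg_integral => [m|m w|w].
- exact: measurable_test_Btuple.
- exact: tf.1.
- by apply: tf.2; exact: (tuple_cvg_Btuple hB).
Qed.

(** Rounding before each motion ensures that only grid values of the motions are used, so that stage
    [n] is a function of the grid increments of the first [n] motions. *)
Fixpoint rnd_iter K (t : K.-tuple R) m n (w : Omega) : K.-tuple R :=
  if n is n'.+1 then Btuple B n' (rndt m (rnd_iter t m n' w)) w else t.

Definition iterBM_tuple K (t : K.-tuple R) n (w : Omega) : K.-tuple R :=
  [tuple iterBM (fun m => B m w) n (tnth t i) | i < K].

Lemma iterBM_tupleS K (t : K.-tuple R) n w :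
  iterBM_tuple t n.+1 w = Btuple B n (iterBM_tuple t n w) w.
Proof. by apply: eq_from_tnth => i; rewrite !tnth_mktuple. Qed.

Lemma rnd_iter_cvg K (t : K.-tuple R) n w :
  tuple_cvg (fun m => rnd_iter t m n w) (iterBM_tuple t n w).
Proof.
elim: n => [|n IH].
  have -> : iterBM_tuple t 0 w = t by apply: eq_from_tnth => i; rewrite tnth_mktuple.
  by move=> i; rewrite /=; apply: cvg_cst.
by rewrite iterBM_tupleS; apply: (tuple_cvg_Btuple hB); exact: tuple_cvg_rndt.
Qed.

Lemma measurable_rnd_iter K (t : K.-tuple R) m n : measurable_fun setT (rnd_iter t m n).
Proof.
elim: n => [|n IH]; first exact: measurable_cst.
apply: (@measurable_rndt_comp _ K m _ _ (rnd_iter t m n) _ _ (fun w v => Btuple B n v w)) => //.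
by move=> J; exact: (measurable_Btuple hB).
Qed.

Definition grid_tuple m : (gridn m).+1.-tuple R := [tuple grid m i | i < (gridn m).+1].

Lemma grid_tuple_incr m i : 0 < tnth (diffs (grid_tuple m)) i.
Proof. by rewrite !tnth_mktuple subr_gt0; apply: grid_lt; rewrite /= /bump add1n. Qed.

Lemma grid0_lt m : (m.+1 * m.+1 < (gridn m).+1)%N.
Proof. by rewrite ltnS /gridn -mulnA mul2n -addnn leq_addr. Qed.

(* The grid contains 0, where the paths vanish, so the increments determine the
   values on the grid. *)
Lemma B_grid m n w (j : 'I_(gridn m).+1) :
  B n w (grid m j) = tnth (pts 0 (incr B (grid_tuple m) n w)) j -
    tnth (pts 0 (incr B (grid_tuple m) n w)) (Ordinal (grid0_lt m)).
Proof.
rewrite /incr !pts_diffs !tnth_mktuple grid0.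
by have [_ _ /(_ n w) -> _] := hB; ring.
Qed.

Definition grid_values m K (J : {ffun 'I_K -> 'I_(gridn m).+1})
    (x : (gridn m).-tuple R) : K.-tuple R :=
  [tuple tnth (pts 0 x) (J i) - tnth (pts 0 x) (Ordinal (grid0_lt m)) | i < K].

Lemma Btuple_gridt m n K (J : {ffun 'I_K -> 'I_(gridn m).+1}) w :
  Btuple B n (gridt J) w = grid_values J (incr B (grid_tuple m) n w).
Proof.
apply: eq_from_tnth => i.
by rewrite [LHS]tnth_mktuple [RHS]tnth_mktuple [tnth (gridt J) i]tnth_mktuple B_grid.
Qed.

Lemma measurable_grid_values m K (J : {ffun 'I_K -> 'I_(gridn m).+1}) :
  measurable_fun setT (@grid_values m K J).
Proof.
have mpts i : measurable_fun setT (fun x : (gridn m).-tuple R => tnth (pts 0 x) i).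
  apply: (measurableT_comp (@measurable_tnth _ _ _ i)).
  exact: (measurableT_comp (@measurable_pts _ _) (measurable_pair1 (0 : R))).
apply/measurable_fun_tnthP => i.
rewrite (_ : _ \o _ = (fun x => tnth (pts 0 x) (J i) -
    tnth (pts 0 x) (Ordinal (grid0_lt m)))).
  exact: measurable_funB.
by apply/funext => x /=; rewrite tnth_mktuple.
Qed.

Lemma past_measurable_incr m n i : (i < n)%N ->
  measurable_fun (setT : set (g_sigma_algebraType (past_sets B (grid_tuple m) n)))
    (incr B (grid_tuple m) i).
Proof.
move=> ilt; apply/measurable_fun_tnthP => j _ A mA; rewrite setTI.
apply: sub_sigma_algebra.
exists (fun i' j' => if (i' == i) && (j' == j) then A else setT); split.
  by move=> i' j'; case: ifP.
apply/seteqP; split => [w Aw i' _ j'|w /(_ i ilt j)]; last by rewrite !eqxx.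
by case: ifP => // /andP[/eqP -> /eqP ->].
Qed.

Lemma past_measurable_rnd_iter K (t : K.-tuple R) m n i : (i <= n)%N ->
  measurable_fun (setT : set (g_sigma_algebraType (past_sets B (grid_tuple m) n)))
    (rnd_iter t m i).
Proof.
elim: i => [_|i IH ilt]; first exact: measurable_cst.
apply: (@measurable_rndt_comp R K m _ (g_sigma_algebraType (past_sets B (grid_tuple m) n))
  (rnd_iter t m i) _ _ (fun w v => Btuple B i v w)).
  exact: IH (ltnW ilt).
move=> J; under eq_fun do rewrite Btuple_gridt.
apply: (measurableT_comp (@measurable_grid_values m K J)).
exact: past_measurable_incr.
Qed.

Lemma gridt_inj m K : injective (@gridt R K m).
Proof.
move=> J J' E; apply/ffunP => i; apply: val_inj; apply/eqP.
have := congr1 (fun v => tnth v i) E; rewrite !tnth_mktuple => E'.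
by case: (ltngtP (J i) (J' i)) => // /(grid_lt (R := R) m); rewrite E' ltxx.
Qed.

Lemma sum_indic_rndt m K (V : Omega -> K.-tuple R) (w : Omega) (h : K.-tuple R -> \bar R) :
  h (rndt m (V w)) = (\sum_(J : {ffun 'I_K -> 'I_(gridn m).+1})
    (\1_[set w | rndt m (V w) = gridt J] w : R)%:E * h (gridt J))%E.
Proof.
have [J EJ] := rndt_gridt m (V w); rewrite (bigD1 J)//= big1 ?adde0.
  by rewrite indicE mem_set ?mul1e ?EJ.
move=> J' JJ'; rewrite indicE memNset ?mul0e//= EJ => /gridt_inj E.
by rewrite E eqxx in JJ'.
Qed.

(** The rounded position takes finitely many values. On each event [E J], which belongs to the past,
    the points are frozen and the values of [B n] there depend on its grid increments only, so
    independence factors the integral. *)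
Lemma BM_step_rnd K (t : K.-tuple R) m n (f : K.-tuple R -> R) : unit_test f ->
  (\int[P]_w (f (Btuple B n (rndt m (rnd_iter t m n w)) w))%:E =
   \int[P]_w (BM_mean n f (rndt m (rnd_iter t m n w)))%:E)%E.
Proof.
move=> tf; set V := rnd_iter t m n.
pose E J := [set w | rndt m (V w) = @gridt R K m J].
have sE J : <<s past_sets B (grid_tuple m) n >> (E J).
  have H := @measurable_rndt_eq R K m _ (g_sigma_algebraType (past_sets B (grid_tuple m) n))
    (rnd_iter t m n) J (@past_measurable_rnd_iter K t m n n (leqnn n)).
  exact H.
have mE J : measurable (E J) by apply: (past_sigma_measurable hB (sE J)).
have m1E J : measurable_fun setT (fun w => (\1_(E J) w : R)%:E).
  by apply/measurable_EFinP; exact: measurable_indic.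
have iE J : (\int[P]_w (\1_(E J) w : R)%:E = P (E J))%E by rewrite integral_indic// setIT.
have f0 x : (0 <= (f x)%:E)%E by rewrite lee_fin; have /andP[] := tf.1 x.
have mf : measurable_fun setT (fun x => (f x)%:E).
  by apply/measurable_EFinP; exact: seqcont_measurable tf.2.
transitivity (\sum_(J : {ffun 'I_K -> 'I_(gridn m).+1}) P (E J) * (BM_mean n f (gridt J))%:E)%E.
  under eq_integral => w _ do
    rewrite (@sum_indic_rndt m K V w (fun v => (f (Btuple B n v w))%:E)).
  rewrite ge0_integral_sum//.
  - apply: eq_bigr => J _; rewrite BM_meanE//.
    have H := integral_past_incr hB (grid_tuple_incr (m := m)) (sE J)
      (h := fun x => (f (grid_values J x))%:E).
    under eq_integral do rewrite Btuple_gridt.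
    rewrite H//; last by apply: (measurableT_comp mf); exact: measurable_grid_values.
    by congr (_ * _)%E; apply: eq_integral => w _; rewrite Btuple_gridt.
  - move=> J; apply: emeasurable_funM; first exact: (m1E J).
    by apply/measurable_EFinP; exact: measurable_test_Btuple.
  - by move=> J w _; rewrite mule_ge0// lee_fin.
under [RHS]eq_integral => w _ do
  rewrite (@sum_indic_rndt m K V w (fun v => (BM_mean n f v)%:E)).
have b0 v : (0 <= (BM_mean n f v)%:E)%E.
  by rewrite lee_fin; have /andP[] := (BM_mean_test n tf).1 v.
rewrite ge0_integral_sum//.
- by apply: eq_bigr => J _; rewrite -iE -ge0_integralZr.
- by move=> J; apply: emeasurable_funM; [exact: (m1E J)|exact: measurable_cst].
- by move=> J w _; rewrite mule_ge0// lee_fin.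
Qed.

(** Both sides of [BM_step_rnd] converge as the grid is refined, by continuity of the paths and of
    the averaged test function. *)
Lemma BM_step K (t : K.-tuple R) n (f : K.-tuple R -> R) : unit_test f ->
  (\int[P]_w (f (iterBM_tuple t n.+1 w))%:E =
   \int[P]_w (BM_mean n f (iterBM_tuple t n w))%:E)%E.
Proof.
move=> tf; have tb := BM_mean_test n tf.
have mr m : measurable_fun setT (fun w => rndt m (rnd_iter t m n w)).
  apply: (@measurable_rndt_comp _ K m _ _ (rnd_iter t m n) _ _ (fun _ v => v)) => //.
  exact: measurable_rnd_iter.
have c1 : (\int[P]_w (f (rnd_iter t m n.+1 w))%:E)%E @[m --> \oo] -->
    (\int[P]_w (f (iterBM_tuple t n.+1 w))%:E)%E.
  apply: bounded_cvg_integral => [m|m w|w].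
  - apply: (measurableT_comp (seqcont_measurable tf.2)); exact: measurable_rnd_iter.
  - exact: tf.1.
  - by apply: tf.2; exact: rnd_iter_cvg.
have c2 : (\int[P]_w (BM_mean n f (rndt m (rnd_iter t m n w)))%:E)%E @[m --> \oo] -->
    (\int[P]_w (BM_mean n f (iterBM_tuple t n w))%:E)%E.
  apply: bounded_cvg_integral => [m|m w|w].
  - exact: (measurableT_comp (seqcont_measurable tb.2) (mr m)).
  - exact: tb.1.
  - by apply: tb.2; apply: tuple_cvg_rndt; exact: rnd_iter_cvg.
have E : (fun m => \int[P]_w (f (rnd_iter t m n.+1 w))%:E)%E =
    (fun m => \int[P]_w (BM_mean n f (rndt m (rnd_iter t m n w)))%:E)%E.
  by apply/funext => m; exact: BM_step_rnd.
by rewrite E in c1; exact: (cvg_unique _ c1 c2).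
Qed.

(** Transition operator of the gaps under one composition. The choices of motion 0 and base point 0
    are immaterial: [BM_mean_gaps] recovers any motion and any points with the same gaps. *)
Definition Kop k (f : k.-tuple R -> R) (y : k.-tuple R) : R :=
  BM_mean 0 (fun z => f (@gaps R k z)) (pts 0 y).

Lemma test_gaps k (f : k.-tuple R -> R) : unit_test f -> unit_test (fun z => f (@gaps R k z)).
Proof. by move=> [f01 cf]; split => [x|]; [exact: f01|exact: seqcont_gaps]. Qed.

Lemma tuple_cvg_pts k (u : nat -> k.-tuple R) x : tuple_cvg u x ->
  tuple_cvg (fun m => pts 0 (u m)) (pts 0 x).
Proof.
move=> ux i; rewrite tnth_mktuple; under eq_fun do rewrite tnth_mktuple.
apply: cvgD; first exact: cvg_cst.
move: (index_enum _) => s; elim: s => [|j s IH].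
  by rewrite big_nil; under eq_fun do rewrite big_nil; exact: cvg_cst.
rewrite big_cons; under eq_fun do rewrite big_cons.
by case: ifP => _ //; apply: cvgD => //; exact: ux.
Qed.

Lemma Kop_test k (f : k.-tuple R -> R) : unit_test f -> unit_test (Kop f).
Proof.
move=> tf; have [b01 cb] := BM_mean_test 0 (test_gaps tf).
by split => [y|u y uy]; [exact: b01|apply: cb; exact: tuple_cvg_pts].
Qed.

Lemma gaps_tcons_shift k a (x : k.-tuple R) : gaps (pts a x) = gaps (pts 0 x).
Proof.
pose z := pts 0 x; pose p := sort <=%R (tval z).
have sp : sorted <=%R p by apply: sort_sorted; exact: le_total.
have zE i : tnth (pts a x) i = a + tnth z i by rewrite !tnth_mktuple add0r.
have szp : size p == k.+1 by rewrite size_sort size_tuple.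
pose q := [tuple a + tnth (Tuple szp) i | i < k.+1].
have -> : gaps (pts 0 x) = diffs (Tuple szp).
  by apply: gaps_sorted => //=; rewrite perm_sym perm_sort.
rewrite (@gaps_sorted _ _ q).
- by apply: eq_from_tnth => i; rewrite !tnth_mktuple; ring.
- apply/(sortedP 0) => i; rewrite size_tuple => ik.
  rewrite -!(tnth_nth 0 q (Ordinal ik)) -(tnth_nth 0 q (Ordinal (ltnW ik))) !tnth_mktuple.
  rewrite lerD2l !(tnth_nth 0)/=; move/(sortedP 0) : sp => /(_ i); apply.
  by rewrite (eqP szp).
- have -> : tval q = map (fun u => a + u) p.
    by rewrite (@tval_map _ _ q (Tuple szp) (fun u => a + u))// => i; rewrite tnth_mktuple.
  rewrite (@tval_map _ _ (pts a x) z (fun u => a + u))//.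
  by apply: perm_map; rewrite perm_sym perm_sort.
Qed.

Lemma pts_Btuple n k (z : k.+1.-tuple R) w :
  Btuple B n z w = pts (B n w (tnth z ord0)) (incr B z n w).
Proof.
apply: eq_from_tnth => i; have := pts_diffs (Btuple B n z w) i.
rewrite -/(incr B z n w) ![tnth (Btuple _ _ _ _) _]tnth_mktuple !tnth_mktuple add0r => ->.
by ring.
Qed.

(** Gaps ignore order and translation, so the points may be sorted and the value at the first one
    dropped; what remains are increments over positive time gaps, with their Gaussian density. *)
Lemma BM_mean_uniq n k (f : k.-tuple R -> R) (v : k.+1.-tuple R) : unit_test f -> uniq v ->
  ((BM_mean n (fun z => f (@gaps R k z)) v)%:E = \int[lebt k]_x
     ((f (gaps (pts 0 x)))%:E * (normal_density (gaps v) x)%:E))%E.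
Proof.
move=> tf uv; have szv : size (sort <=%R (tval v)) == k.+1 by rewrite size_sort size_tuple.
pose z := Tuple szv.
have zv : perm_eq v z by rewrite perm_sym perm_sort.
have sz : sorted <%R z by rewrite sort_lt_sorted.
have zpos i : 0 < tnth (diffs z) i by move: i; apply/pos_tupleP/pos_diffs_sorted.
have szle : sorted <=%R z by apply: sort_sorted; exact: le_total.
rewrite BM_meanE; last exact: test_gaps.
rewrite (gaps_sorted szle zv).
have mg : measurable_fun setT (fun x => (f (gaps (pts 0 x)))%:E).
  apply/measurable_EFinP; apply: (measurableT_comp (seqcont_measurable tf.2)).
  apply: (measurableT_comp (@measurable_gaps R k)).
  exact: (measurableT_comp (@measurable_pts _ _) (measurable_pair1 (0 : R))).
rewrite -(integral_incr_density hB zpos n mg); last first.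
  by move=> x; rewrite lee_fin; have /andP[] := tf.1 (gaps (pts 0 x)).
apply: eq_integral => w _; congr (f _)%:E.
rewrite -(gaps_tcons_shift (B n w (tnth z ord0))) -pts_Btuple.
pose s := sort <=%R (tval (Btuple B n z w)).
have szs : size s == k.+1 by rewrite size_sort size_tuple.
have ss : sorted <=%R (Tuple szs) by apply: sort_sorted; exact: le_total.
rewrite (@gaps_sorted _ _ (Tuple szs) (Btuple B n z w))//=; last first.
  by rewrite perm_sym perm_sort.
apply: gaps_sorted => //=; rewrite perm_sym perm_sort.
have mE (u : k.+1.-tuple R) : tval (Btuple B n u w) = map (B n w) u.
  by apply: tval_map => i; rewrite tnth_mktuple.
by rewrite !mE; apply: perm_map; rewrite perm_sym.
Qed.

Lemma gaps_pts_pos k a (y : k.-tuple R) : (forall i, 0 < tnth y i) -> gaps (pts a y) = y.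
Proof.
move=> y0; rewrite (@gaps_sorted _ _ (pts a y)) ?diffs_pts//.
have : sorted <%R (pts a y) by apply/pos_diffs_sorted; rewrite diffs_pts; exact/pos_tupleP.
by rewrite lt_sorted_uniq_le => /andP[].
Qed.

Lemma uniq_pts k a (y : k.-tuple R) : (forall i, 0 < tnth y i) -> uniq (pts a y).
Proof.
move=> y0; have : sorted <%R (pts a y).
  by apply/pos_diffs_sorted; rewrite diffs_pts; exact/pos_tupleP.
by rewrite lt_sorted_uniq_le => /andP[].
Qed.

Lemma uniq_gaps_gt0 k (v : k.+1.-tuple R) : uniq v -> forall i, 0 < tnth (gaps v) i.
Proof.
move=> uv; have szv : size (sort <=%R (tval v)) == k.+1 by rewrite size_sort size_tuple.
have sz : sorted <%R (Tuple szv) by rewrite sort_lt_sorted.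
rewrite (@gaps_sorted _ _ (Tuple szv)).
- exact/pos_tupleP/pos_diffs_sorted.
- by apply: sort_sorted; exact: le_total.
- by rewrite perm_sym perm_sort.
Qed.

Lemma BM_mean_gaps_uniq n k (f : k.-tuple R -> R) (v : k.+1.-tuple R) :
  unit_test f -> uniq v -> BM_mean n (fun z => f (@gaps R k z)) v = Kop f (gaps v).
Proof.
move=> tf uv; have gv := uniq_gaps_gt0 uv.
have H1 := @BM_mean_uniq n k f v tf uv.
have H2 := @BM_mean_uniq 0 k f (pts 0 (gaps v)) tf (uniq_pts 0 gv).
rewrite (gaps_pts_pos 0 gv) in H2.
exact: EFin_inj (etrans H1 (esym H2)).
Qed.

(* Points with repetitions are limits of separated ones. *)
Lemma BM_mean_gaps n k (f : k.-tuple R -> R) (v : k.+1.-tuple R) :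
  unit_test f -> BM_mean n (fun z => f (@gaps R k z)) v = Kop f (gaps v).
Proof.
move=> tf; pose u m : k.+1.-tuple R := [tuple tnth v i + i%:R * m.+1%:R^-1 | i < k.+1].
have uv : tuple_cvg u v.
  move=> i; under eq_fun do rewrite tnth_mktuple.
  have H : tnth v i + i%:R * m.+1%:R^-1 @[m --> \oo] --> tnth v i + i%:R * (0 : R).
    by apply: cvgD; [exact: cvg_cst|apply: cvgM; [exact: cvg_cst|exact: cvg_harmonic]].
  by rewrite mulr0 addr0 in H.
have uu : \forall m \near \oo, uniq (u m).
  have : \forall m \near \oo, forall p : 'I_k.+1 * 'I_k.+1, p.1 != p.2 ->
      tnth (u m) p.1 != tnth (u m) p.2.
    apply: filter_forall => -[i j] /=; have [<-|ij] := eqVneq i j; first exact: nearW.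
    have [vij|vij] := eqVneq (tnth v i) (tnth v j).
      apply: nearW => m _; rewrite !tnth_mktuple vij (inj_eq (addrI _)).
      have m0 : m.+1%:R^-1 != 0 :> R by rewrite invr_eq0 pnatr_eq0.
      by rewrite (inj_eq (mulIf m0)) eqr_nat.
    have vd : 0 < `|tnth v i - tnth v j| by rewrite normr_gt0 subr_eq0.
    have dc : tnth (u m) i - tnth (u m) j @[m --> \oo] --> tnth v i - tnth v j.
      by apply: cvgB; exact: uv.
    move/cvgrPdist_lt : dc => /(_ _ vd); apply: filterS => m H _.
    by apply: contraTneq H => E; rewrite -leNgt E subrr subr0.
  apply: filterS => m H; apply/(uniqP 0) => i j; rewrite !inE size_tuple => ilt jlt.
  move=> /eqP; apply: contraTeq => ij.
  by have := H (Ordinal ilt, Ordinal jlt); rewrite !(tnth_nth 0); exact.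
have c1 := (BM_mean_test n (test_gaps tf)).2 _ _ uv.
have c2 := (Kop_test tf).2 _ _ (tuple_cvg_gaps uv).
have E : Kop f (gaps (u m)) @[m --> \oo] --> BM_mean n (fun z => f (@gaps R k z)) v.
  apply: cvg_trans c1; apply: near_eq_cvg; apply: filterS uu => m um.
  exact: (BM_mean_gaps_uniq n tf um).
exact: (cvg_unique _ E c2).
Qed.

Lemma iter_Kop_test k (f : k.-tuple R -> R) n : unit_test f -> unit_test (iter n (@Kop k) f).
Proof. by move=> tf; elim: n => //= n IH; exact: Kop_test. Qed.

(** The outermost motion is integrated first: the test function absorbs one factor [Kop], and the
    induction goes on with that new function. *)
Lemma integral_iterBM_gaps k (f : k.-tuple R -> R) (t : k.+1.-tuple R) n : unit_test f ->
  (\int[P]_w (f (gaps (iterBM_tuple t n w)))%:E = (iter n (@Kop k) f (gaps t))%:E)%E.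
Proof.
elim: n f => [|n IH] f tf.
  under eq_integral => w _.
    rewrite (_ : iterBM_tuple t 0 w = t); last by apply: eq_from_tnth => i; rewrite tnth_mktuple.
    over.
  by rewrite integral_cst//= probability_setT mule1.
rewrite (BM_step t n (test_gaps tf)).
under eq_integral do rewrite BM_mean_gaps//.
by rewrite IH ?iterSr//; exact: Kop_test.
Qed.

End BrownianStep.

(** * Averaging over independent exponential variables *)

Section ExponentialTuple.
Context {R : realType}.
Notation leb := (@lebesgue_measure R).
Notation lebt := (@lebesgue_tuple R).

Definition ones k : k.-tuple R := [tuple 1 | i < k].

Lemma ones_gt0 k i : 0 < tnth (ones k) i.
Proof. by rewrite tnth_mktuple. Qed.

Lemma exp_rectE k (A : 'I_k -> set R) : (forall i, measurable (A i)) ->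
  (\int[lebt k]_(x in rect A) (exp_density (ones k) x)%:E =
   \prod_(i < k) exponential_prob 1 (A i))%E.
Proof.
move=> mA; rewrite integral_mkcond.
transitivity (\int[lebt k]_x \prod_(j < k)
   ((\1_(A j) (tnth x j) * exponential_pdf 1 (tnth x j))%:E))%E.
  apply: eq_integral => x _; rewrite prodEFin big_split/= EFinM.
  rewrite -(prodEFin _ _ (fun j => \1_(A j) (tnth x j))) -indic_rect patchE indicE.
  have -> : \prod_(i < k) exponential_pdf 1 (tnth x i) = exp_density (ones k) x.
    by apply: eq_bigr => i _; rewrite tnth_mktuple.
  by case: ifP => _; rewrite ?mul1e ?mul0e.
rewrite (@integral_lebesgue_tuple_prod _ _ (fun j u => (\1_(A j) u * exponential_pdf 1 u)%:E)).
- apply: eq_bigr => j _; rewrite /exponential_prob [RHS]integral_mkcond.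
  apply: eq_integral => u _; rewrite patchE indicE.
  by case: ifP => _; rewrite ?mul1r ?mul0r.
- move=> j; apply/measurable_EFinP; apply: measurable_funM; last exact: measurable_exponential_pdf.
  exact: measurable_indic.
- by move=> j u; rewrite lee_fin mulr_ge0// exponential_pdf_ge0.
Qed.

Lemma exp_tuple_prob_ex k : exists p : probability (k.-tuple R) R,
  forall A, measurable A -> p A = (\int[lebt k]_(x in A) (exp_density (ones k) x)%:E)%E.
Proof.
have p0 x : 0 <= exp_density (ones k) x by exact: exp_density_ge0 (@ones_gt0 k).
have [m mP] := density_measure (lebt k) (@measurable_exp_density R k (ones k)) p0.
have m1 : m setT = 1%E.
  have -> : [set: k.-tuple R] = rect (fun=> [set: R]).
    by apply/seteqP; split; [move=> x _ i; exact: I|move=> x _; exact: I].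
  rewrite mP; last by apply: measurable_rect => i; exact: measurableT.
  rewrite exp_rectE//.
  by rewrite big1// => i _; rewrite /exponential_prob integral_exponential_pdf.
(* The total mass is already 1: normalising only supplies the structure of a probability. *)
exists (mnormalize m (\d_(ones k))) => A mA.
rewrite /= /mnormalize m1 onee_eq0 /=.
by rewrite invr1 mule1 mP.
Qed.

Definition exp_tuple_prob k : probability (k.-tuple R) R := sval (cid (exp_tuple_prob_ex k)).

Lemma exp_tuple_probE k A : measurable A ->
  exp_tuple_prob k A = (\int[lebt k]_(x in A) (exp_density (ones k) x)%:E)%E.
Proof. by rewrite /exp_tuple_prob; case: cid => p /= pP; exact: pP. Qed.

Lemma integral_exp_tuple k (h : k.-tuple R -> \bar R) :
  measurable_fun setT h -> (forall x, (0 <= h x)%E) ->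
  (\int[exp_tuple_prob k]_x h x = \int[lebt k]_x (h x * (exp_density (ones k) x)%:E))%E.
Proof.
move=> mh h0; apply: (integral_density (@measurable_exp_density R k (ones k))) => //.
  by move=> x; exact: exp_density_ge0 (@ones_gt0 k).
exact: exp_tuple_probE.
Qed.

Lemma eq_integral_exp_tuple k (g h : k.-tuple R -> \bar R) :
  measurable_fun setT g -> (forall x, (0 <= g x)%E) ->
  measurable_fun setT h -> (forall x, (0 <= h x)%E) ->
  (forall x, (forall i, 0 < tnth x i) -> g x = h x) ->
  (\int[exp_tuple_prob k]_x g x = \int[exp_tuple_prob k]_x h x)%E.
Proof.
move=> mg g0 mh h0 gh; rewrite !integral_exp_tuple//.
have me : measurable_fun setT (fun x : k.-tuple R => (exp_density (ones k) x)%:E).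
  by apply/measurable_EFinP; exact: measurable_exp_density.
have e0 (x : k.-tuple R) : (0 <= (exp_density (ones k) x)%:E)%E.
  by rewrite lee_fin; exact: exp_density_ge0 (@ones_gt0 k).
apply: ge0_ae_eq_integral => //.
- exact: emeasurable_funM.
- exact: emeasurable_funM.
- by move=> x _; rewrite mule_ge0.
- by move=> x _; rewrite mule_ge0.
apply: filterS (@lebesgue_tuple_ae_neq0 R k) => x xn0 _.
have [xpos|] := pselect (forall i, 0 < tnth x i); first by rewrite gh.
move=> /existsNP[i /negP]; rewrite -leNgt => xi.
have xi0 : tnth x i < 0 by rewrite lt_neqAle xn0.
by rewrite /exp_density (bigD1 i)//= tnth_mktuple lt0_exponential_pdf// mul0r !mule0.
Qed.

(** Expectation of [f] under independent exponentials of parameters [c], written with standard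
    exponentials so that [c] enters only through the argument of [f]. *)
Definition Lop k (f : k.-tuple R -> R) (c : k.-tuple R) : R :=
  fine (\int[exp_tuple_prob k]_e (f (divt e c))%:E).

Lemma measurable_test_divt k (f : k.-tuple R -> R) c : unit_test f ->
  measurable_fun setT (fun e => f (divt e c)).
Proof.
move=> tf; apply: (measurableT_comp (seqcont_measurable tf.2)).
exact: measurable_divt.
Qed.

Lemma LopE k (f : k.-tuple R -> R) c : unit_test f ->
  (Lop f c)%:E = (\int[exp_tuple_prob k]_e (f (divt e c))%:E)%E.
Proof.
move=> tf; have /andP[i0 i1] := integral01 (exp_tuple_prob k) (measurable_test_divt c tf)
  (fun e => tf.1 _).
by rewrite fineK// ge0_fin_numE// (le_lt_trans i1)// ltry.
Qed.

Lemma Lop01 k (f : k.-tuple R -> R) c : unit_test f -> 0 <= Lop f c <= 1.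
Proof.
move=> tf; have := integral01 (exp_tuple_prob k) (measurable_test_divt c tf) (fun e => tf.1 _).
by rewrite -LopE// !lee_fin.
Qed.

Lemma Lop_cvg k (f : k.-tuple R -> R) u (c : k.-tuple R) : unit_test f ->
  (forall i, 0 < tnth c i) -> tuple_cvg u c -> Lop f (u m) @[m --> \oo] --> Lop f c.
Proof.
move=> tf c0 uc; apply: fine_cvg; rewrite LopE//.
apply: bounded_cvg_integral => [m|m e|e].
- exact: measurable_test_divt.
- exact: tf.1.
- apply: tf.2 => i; rewrite tnth_mktuple; under eq_fun do rewrite tnth_mktuple.
  apply: cvgM; first exact: cvg_cst.
  by apply: cvgV; [rewrite gt_eqF|exact: uc].
Qed.

(** Coordinatewise maximum with [eps], in a form whose continuity follows from that of the absolute
    value. *)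
Definition clamp k (eps : R) (c : k.-tuple R) : k.-tuple R :=
  [tuple (tnth c i + eps + `|tnth c i - eps|) / 2 | i < k].

Lemma clamp_id k eps (c : k.-tuple R) : (forall i, eps <= tnth c i) -> clamp eps c = c.
Proof.
move=> ec; apply: eq_from_tnth => i; rewrite tnth_mktuple ger0_norm ?subr_ge0//.
by field.
Qed.

Lemma clamp_gt0 k eps (c : k.-tuple R) i : 0 < eps -> 0 < tnth (clamp eps c) i.
Proof.
move=> e0; rewrite tnth_mktuple divr_gt0//.
have : - (tnth c i - eps) <= `|tnth c i - eps| by rewrite -normrN ler_norm.
move: (tnth c i) `|_| => x y; lra.
Qed.

Lemma Lop_clamp_test k (f : k.-tuple R -> R) eps : unit_test f -> 0 < eps ->
  unit_test (fun c => Lop f (clamp eps c)).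
Proof.
move=> tf e0; split => [c|u c uc]; first exact: Lop01.
apply: Lop_cvg => // [i|i]; first exact: clamp_gt0.
rewrite tnth_mktuple; under eq_fun do rewrite tnth_mktuple.
apply: cvgM; last exact: cvg_cst.
apply: cvgD; first by apply: cvgD; [exact: uc|exact: cvg_cst].
by apply: cvg_norm; apply: cvgB; [exact: uc|exact: cvg_cst].
Qed.

(** Every [Fmap s] sends [2, oo)^k into itself, so the iterates at such a [c] only see values of the
    function there. *)
Lemma iter_Qop_eq k (g h : k.-tuple R -> R) n (c : k.-tuple R) :
  (forall c, (forall i, 2 <= tnth c i) -> g c = h c) -> (forall i, 2 <= tnth c i) ->
  iter n (@Qop R k) g c = iter n (@Qop R k) h c.
Proof.
move=> gh; elim: n c => [|n IH] c c2; first exact: gh.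
rewrite !iterS; apply: eq_bigr => s _; congr (_ * _); apply: IH => i.
rewrite tnth_mktuple; apply: Fcomp_ge; first by [].
move=> j; have cj := c2 j.
have h2 : Num.sqrt (2 ^+ 2 : R) <= Num.sqrt (2 * tnth c j).
  by apply: ler_wsqrtr; rewrite expr2 ler_pM2l.
by move: h2; rewrite sqrtr_sqr ger0_norm.
Qed.

End ExponentialTuple.

(** * The intertwining relation L K = Q L *)

Section KernelIntertwining.
Context {R : realType} d (Omega : measurableType d) (P : probability Omega R)
  (B : nat -> Omega -> R -> R) (hB : iid_two_sided_BM P B).
Notation lebt := (@lebesgue_tuple R).
Notation Kop := (@Kop R d Omega P B _).

Lemma Lop_Kop k (f : k.-tuple R -> R) (c : k.-tuple R) : unit_test f ->
  (forall i, 0 < tnth c i) -> Lop (Kop f) c = Qop (Lop f) c.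
Proof.
move=> tf c0; have tK : unit_test (Kop f) by exact: (Kop_test hB tf).
have mf : measurable_fun setT (fun y => (f y)%:E).
  by apply/measurable_EFinP; exact: seqcont_measurable tf.2.
have f0 y : (0 <= (f y)%:E)%E by rewrite lee_fin; have /andP[] := tf.1 y.
pose F (x : k.-tuple R) : \bar R := (f (gaps (pts 0 x)))%:E.
have F0 x : (0 <= F x)%E by exact: f0.
have mF : measurable_fun setT F.
  apply: (measurableT_comp mf); apply: (measurableT_comp (@measurable_gaps R k)).
  exact: (measurableT_comp (@measurable_pts _ _) (measurable_pair1 (0 : R))).
pose g (q : k.-tuple R * k.-tuple R) : \bar R :=
  (F q.2 * (normal_density (divt q.1 c) q.2)%:E)%E.
have mdiv : measurable_fun setT (fun e => divt e c) by exact: measurable_divt.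
have mne : measurable_fun setT
    (fun q : k.-tuple R * k.-tuple R => normal_density (divt q.1 c) q.2).
  by apply: measurable_normal_density2 => //; exact: (measurableT_comp mdiv).
have mg : measurable_fun setT g.
  apply: emeasurable_funM; last exact/measurable_EFinP.
  by apply: (measurableT_comp mF).
have g0 q : (0 <= g q)%E by rewrite mule_ge0// lee_fin normal_density_ge0.
pose G (e : k.-tuple R) : \bar R :=
  (\int[lebt k]_x (F x * (normal_density (divt e c) x)%:E))%E.
have mG : measurable_fun setT G.
  exact: (measurable_fun_fubini_tonelli_F (m2 := lebt k) g).
have G0 e : (0 <= G e)%E by apply: integral_ge0 => x _; exact: (g0 (e, x)).
apply: EFin_inj; apply: etrans (LopE c tK) _.
(* The Gaussian formula for [Kop] requires distinct points, which positive gaps guarantee; standard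
   exponentials are almost surely positive. *)
have KG : (\int[exp_tuple_prob k]_e (Kop f (divt e c))%:E = \int[exp_tuple_prob k]_e G e)%E.
  apply: eq_integral_exp_tuple.
  - by apply/measurable_EFinP; exact: measurable_test_divt.
  - by move=> e; rewrite lee_fin; have /andP[] := tK.1 (divt e c).
  - exact: mG.
  - exact: G0.
  - move=> e e0; have y0 i : 0 < tnth (divt e c) i by rewrite tnth_mktuple divr_gt0.
    have H := @BM_mean_uniq _ _ _ _ _ hB 0%N k f _ tf (uniq_pts 0 y0).
    by rewrite (gaps_pts_pos 0 y0) in H; exact: H.
apply: etrans KG _; apply: etrans (integral_exp_tuple mG G0) _.
apply: etrans (integral_exp_normal c0 mF F0) _.
apply: etrans (integral_laplace_sectors c0 mf f0) _.
rewrite /Qop -sumEFin; apply: eq_bigr => s _.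
have Fs0 i : 0 < tnth (Fmap s c) i by rewrite tnth_mktuple Fcomp_gt0.
have mfd : measurable_fun setT (fun e => (f (divt e (Fmap s c)))%:E).
  by apply/measurable_EFinP; exact: measurable_test_divt.
have LE : (Lop f (Fmap s c))%:E =
    (\int[lebt k]_y ((f y)%:E * (exp_density (Fmap s c) y)%:E))%E.
  apply: etrans (LopE (Fmap s c) tf) _.
  apply: etrans (integral_exp_tuple mfd (fun e => f0 (divt e (Fmap s c)))) _.
  exact: (exp_density_scaling Fs0 mf f0).
by rewrite [RHS]EFinM LE.
Qed.

(** [Lop_Kop] is applied at each successive parameter; these stay positive because every [Fcomp]
    is. *)
Lemma iter_Qop_Lop k (f : k.-tuple R -> R) n (c : k.-tuple R) : unit_test f ->
  (forall i, 0 < tnth c i) -> iter n (@Qop R k) (Lop f) c = Lop (iter n Kop f) c.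
Proof.
move=> tf; elim: n c => // n IH c c0.
rewrite [RHS]/= Lop_Kop//; last exact: (iter_Kop_test hB).
apply: eq_bigr => s _; congr (_ * _); apply: IH => i.
by rewrite tnth_mktuple Fcomp_gt0.
Qed.

End KernelIntertwining.

Lemma probability_setC0 {R : realType} d (T : measurableType d)
    (m : probability T R) (A : set T) :
  measurable A -> m A = 1%E -> m (~` A) = 0%E.
Proof. by move=> mA A1; rewrite probability_setC// A1 subee. Qed.

(** * Measurability of the kernel, for integrating its iterates against a Dirac mass *)

Section QMeasurability.
Context {R : realType}.

Lemma measurable_Fcomp k (s : {perm 'I_k.+1}) i :
  measurable_fun setT (fun c : k.-tuple R => Fcomp s c i).
Proof.
rewrite (_ : (fun c => _) = (fun c : k.-tuple R =>
    \sum_(j < k) if Eset s i j then Num.sqrt (2 * tnth c j) else 0)); last first.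
  by apply/funext => c; rewrite /Fcomp big_mkcond.
apply: measurable_sum => j; case: (Eset s i j) => //.
by apply: measurable_fun_sqrt; apply: measurable_funM => //; exact: measurable_tnth.
Qed.

Lemma measurable_Qop k (f : k.-tuple R -> R) :
  measurable_fun setT f -> measurable_fun setT (Qop f).
Proof.
move=> mf; apply: measurable_sum => s; apply: measurable_funM; last first.
  apply: (measurableT_comp mf); apply/measurable_fun_tnthP => i.
  rewrite (_ : _ \o _ = (fun c : k.-tuple R => Fcomp s c i)).
    exact: measurable_Fcomp.
  by apply/funext => c /=; rewrite tnth_mktuple.
apply: measurable_funM => //; apply: measurable_prod => i _; apply: measurable_funM.
  by apply: measurable_fun_sqrt; apply: measurable_funM => //; exact: measurable_tnth.
by apply: measurable_funV; exact: measurable_Fcomp.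
Qed.

End QMeasurability.

(** * Limits of the iterates on the Brownian side and on the kernel side *)

Section Limits.
Context {R : realType} (k : nat) (hk : (1 <= k)%N).

Definition twos : k.-tuple R := [tuple 2 | i < k].

Lemma tnth_twos i : tnth twos i = 2.
Proof. by rewrite tnth_mktuple. Qed.

Lemma test_bounded_continuous n (f : n.-tuple R -> R) : unit_test f -> bounded_continuous f.
Proof.
move=> [f01 cf]; split; first exact: seqcont_continuous.
by exists 1 => x; have /andP[f0 f1] := f01 x; rewrite ger0_norm.
Qed.

(** For each positive [e], the iterates of [Kop] at the gaps [e / 2] converge to a limit independent
    of [e]; dominated convergence then averages over [e]. The indicator [I] keeps only the positive
    [e], where the times are distinct. *)
Lemma gaps_limit d (Omega : measurableType d) (P : probability Omega R)
    (B : nat -> Omega -> R -> R) (hB : iid_two_sided_BM P B)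
    (mu : probability (k.+1.-tuple R) R)
    (hmu : forall t : k.+1.-tuple R, uniq t -> (forall i, tnth t i != 0) ->
      cvg_in_law P
        (fun n w => [tuple iterBM (fun m => B m w) n (tnth t i) | i < k.+1]) mu)
    (f : k.-tuple R -> R) : unit_test f ->
  (iter n (@Qop R k) (Lop f) twos)%:E @[n --> \oo] --> (\int[mu]_z (f (gaps z))%:E)%E.
Proof.
move=> tf; have tg := test_gaps tf.
have mg := seqcont_measurable tg.2.
set l := (\int[mu]_z _)%E.
have l01 : (0 <= l <= 1)%E by exact: (integral01 mu mg (fun z => tg.1 z)).
have lfin : (fine l)%:E = l.
  by have /andP[l0 l1] := l01; rewrite fineK// ge0_fin_numE// (le_lt_trans l1)// ltry.
have fl01 : 0 <= fine l <= 1 by rewrite -!lee_fin lfin.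
pose I (e : k.-tuple R) : R := \1_(@pos_tuple R k) e.
have mI : measurable_fun setT I by apply: measurable_indic; exact: measurable_pos_tuple.
have I1 e : (forall i, 0 < tnth e i) -> I e = 1.
  by move=> e0; rewrite /I indicE mem_set//; exact/pos_tupleP.
have I01 e : 0 <= I e <= 1 by rewrite /I indicE; case: (_ \in _); rewrite /= ?lexx ?ler01.
pose h n (e : k.-tuple R) : R := iter n (@Kop R d Omega P B k) f (divt e twos) * I e.
have tK n : unit_test (iter n (@Kop R d Omega P B k) f) by exact: (iter_Kop_test hB).
have mh n : measurable_fun setT (h n).
  by apply: measurable_funM => //; exact: measurable_test_divt.
have M01 (x y : R) : 0 <= x <= 1 -> 0 <= y <= 1 -> 0 <= x * y <= 1.
  by move=> /andP[x0 x1] /andP[y0 y1]; rewrite mulr_ge0//= mulr_ile1.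
have h01 n e : 0 <= h n e <= 1 by apply: M01 => //; exact: (tK n).1.
have hcvg e : h n e @[n --> \oo] --> fine l * I e.
  rewrite /h; have [epos|] := pselect (@pos_tuple R k e); last first.
    move=> ne; rewrite /I indicE memNset// mulr0.
    by under eq_fun do rewrite mulr0; exact: cvg_cst.
  move/pos_tupleP : epos => e0; rewrite I1// mulr1; under eq_fun do rewrite mulr1.
  have y0 i : 0 < tnth (divt e twos) i by rewrite tnth_mktuple divr_gt0// tnth_twos.
  (* Base point 1 instead of 0: the convergence in law is assumed for nonzero times only. *)
  have tn0 i : tnth (pts 1 (divt e twos)) i != 0.
    rewrite tnth_mktuple gt_eqF// ltr_wpDr// sumr_ge0// => j _; exact/ltW/y0.
  have := hmu _ (uniq_pts 1 y0) tn0 _ (test_bounded_continuous tg).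
  have -> : (fun n => \int[P]_w (f (gaps [tuple iterBM (fun m => B m w) n
      (tnth (pts 1 (divt e twos)) i) | i < k.+1]))%:E)%E =
      (fun n => (iter n (@Kop R d Omega P B k) f (divt e twos))%:E).
    apply/funext => n; have H := integral_iterBM_gaps hB (pts 1 (divt e twos)) n tf.
    by rewrite (gaps_pts_pos 1 y0) in H; exact: H.
  by rewrite -/l -lfin => /fine_cvg.
have := bounded_cvg_integral (P := exp_tuple_prob k) mh h01 hcvg.
have -> : (\int[exp_tuple_prob k]_e (fine l * I e)%:E)%E = l.
  transitivity (\int[exp_tuple_prob k]_e (cst l e))%E; last first.
    by rewrite integral_cst//= probability_setT mule1.
  apply: eq_integral_exp_tuple => //.
  - by apply/measurable_EFinP; exact: measurable_funM.
  - by move=> e; rewrite lee_fin; have /andP[] := M01 _ _ fl01 (I01 e).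
  - by move=> e; have /andP[] := l01.
  - by move=> e e0; rewrite I1// mulr1 lfin.
suff -> : (fun n => (\int[exp_tuple_prob k]_e (h n e)%:E)%E) =
  (fun n => (iter n (@Qop R k) (Lop f) twos)%:E) by [].
apply/funext => n.
rewrite (iter_Qop_Lop hB)//; last by move=> i; rewrite tnth_twos.
rewrite LopE//; apply: eq_integral_exp_tuple.
- by apply/measurable_EFinP; exact: (mh n).
- by move=> e; rewrite lee_fin; have /andP[] := h01 n e.
- by apply/measurable_EFinP; exact: measurable_test_divt.
- by move=> e; rewrite lee_fin; have /andP[] := (tK n).1 (divt e twos).
- by move=> e e0; rewrite /h I1// mulr1.
Qed.

(** For each level [1/(m+1)], the clamped [Lop f] is an admissible test function, and by
    [iter_Qop_eq] its iterates at [twos] are those of [Lop f]; hence all clamped integrals equal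
    [l]. At a positive [c] the clamp is eventually the identity as the level decreases. *)
Lemma nu_limit (nu : probability (k.-tuple R) R) (hnu : is_nu_k nu)
    (f : k.-tuple R -> R) (l : \bar R) : unit_test f ->
  (iter n (@Qop R k) (Lop f) twos)%:E @[n --> \oo] --> l ->
  (\int[nu]_(c in @pos_tuple R k) (Lop f c)%:E = l)%E.
Proof.
move=> tf Ql; have [nupos nucvg] := hnu.
have posE : [set c : k.-tuple R | forall i, 0 < tnth c i] = @pos_tuple R k.
  by apply/seteqP; split => c /= /pos_tupleP.
rewrite posE in nupos.
have clampl m : (\int[nu]_c (Lop f (clamp m.+1%:R^-1 c))%:E = l)%E.
  have m0 : 0 < m.+1%:R^-1 :> R by rewrite invr_gt0.
  have tc := Lop_clamp_test tf m0.
  (* The starting law is the Dirac mass at [twos]; it lies in the prescribed cube because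
     [1 <= k]. *)
  have nu0 : (\d_twos : probability (k.-tuple R) R)
      [set c | forall i, 2 <= tnth c i <= 2 * (k ^ 2)%:R] = 1%E.
    transitivity ((\1_[set c : k.-tuple R | forall i, 2 <= tnth c i <= 2 * (k ^ 2)%:R]
      twos : R)%:E); first by [].
    rewrite indicE mem_set// => i; rewrite tnth_twos lexx/= ler_pMr// ler1n.
    by rewrite expn_gt0 hk.
  have := nucvg _ nu0 _ (test_bounded_continuous tc).
  have -> : (fun n => \int[\d_twos]_c
      (iter n (@Qop R k) (fun c => Lop f (clamp m.+1%:R^-1 c)) c)%:E)%E =
      (fun n => (iter n (@Qop R k) (Lop f) twos)%:E).
    apply/funext => n; rewrite integral_dirac//=; last first.
      apply/measurable_EFinP; elim: n => [|n IH]; last exact: measurable_Qop.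
      exact: seqcont_measurable tc.2.
    rewrite diracT mul1e (@iter_Qop_eq _ _ _ (Lop f))//; last by move=> i; rewrite tnth_twos.
    move=> c c2; rewrite clamp_id// => i; rewrite (le_trans _ (c2 i))//.
    by rewrite (@le_trans _ _ 1)// ?invf_le1// ler1n.
  by move=> H; exact: (cvg_unique _ H Ql).
pose I (c : k.-tuple R) : R := \1_(@pos_tuple R k) c.
have mI : measurable_fun setT I by apply: measurable_indic; exact: measurable_pos_tuple.
pose h m (c : k.-tuple R) : R := Lop f (clamp m.+1%:R^-1 c) * I c.
have mclamp m : measurable_fun setT (fun c : k.-tuple R => Lop f (clamp m.+1%:R^-1 c)).
  have m0 : 0 < m.+1%:R^-1 :> R by rewrite invr_gt0.
  exact: seqcont_measurable (Lop_clamp_test tf m0).2.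
have mh m : measurable_fun setT (h m) by apply: measurable_funM.
have h01 m c : 0 <= h m c <= 1.
  rewrite /h /I indicE; case: (_ \in _); rewrite ?mulr1 ?mulr0 ?lexx ?ler01//.
  exact: Lop01.
have hcvg c : h m c @[m --> \oo] --> Lop f c * I c.
  rewrite /h; have [cpos|ncpos] := pselect (@pos_tuple R k c); last first.
    rewrite /I indicE memNset// mulr0.
    by under eq_fun do rewrite mulr0; exact: cvg_cst.
  apply: cvg_near_cst.
  have : \forall m \near \oo, forall i, m.+1%:R^-1 <= tnth c i.
    apply: filter_forall => i; move/pos_tupleP : cpos => /(_ i) ci.
    have : m.+1%:R^-1 @[m --> \oo] --> (0 : R) by exact: cvg_harmonic.
    move=> /cvgrPdist_lt /(_ _ ci); apply: filterS => m /=.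
    by rewrite sub0r normrN ger0_norm ?invr_ge0// => /ltW.
  by apply: filterS => m mc; rewrite clamp_id.
have := bounded_cvg_integral (P := nu) mh h01 hcvg.
have -> : (fun m => \int[nu]_c (h m c)%:E)%E = (fun=> l).
  apply/funext => m; rewrite -(clampl m); apply: ge0_ae_eq_integral => //.
  - exact/measurable_EFinP.
  - exact/measurable_EFinP.
  - by move=> c _; rewrite lee_fin; have /andP[] := h01 m c.
  - by move=> c _; rewrite lee_fin; have /andP[] := Lop01 (clamp m.+1%:R^-1 c) tf.
  - exists (~` @pos_tuple R k); split.
    + by apply: measurableC; exact: measurable_pos_tuple.
    + exact: probability_setC0 (@measurable_pos_tuple R k) nupos.
    + move=> c /= H cpos; apply: H => _.
      by rewrite /h /I indicE mem_set// mulr1.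
move=> H; rewrite (cvg_unique _ (cvg_cst l) H)//.
rewrite integral_mkcond; apply: eq_integral => c _.
by rewrite patchE /I indicE; case: ifP => _; rewrite ?mulr1 ?mulr0.
Qed.

End Limits.

(** * Test functions separate laws *)

Section Bumps.
Context {R : realType}.

Definition posp (x : R) : R := (x + `|x|) / 2.

(** With [v] equal to [m] times the positive parts of [u - a] and [b - u], the quotient
    [v / (1 + v)] is continuous, vanishes off the open interval and tends to 1 inside it. *)
Definition bump (m : nat) (a b u : R) : R :=
  let v := m%:R * (posp (u - a) * posp (b - u)) in v / (1 + v).

Lemma posp_ge0 x : 0 <= posp x.
Proof.
by rewrite /posp divr_ge0// addrC -lerBlDr sub0r (le_trans (ler_norm _))// normrN.
Qed.

Lemma posp_gt0 x : 0 < x -> posp x = x.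
Proof. by move=> x0; rewrite /posp gtr0_norm//; field. Qed.

Lemma posp_le0 x : x <= 0 -> posp x = 0.
Proof. by move=> x0; rewrite /posp ler0_norm// subrr mul0r. Qed.

Lemma bump_arg_ge0 (m : nat) (a b u : R) : 0 <= m%:R * (posp (u - a) * posp (b - u)).
Proof.
exact: (mulr_ge0 (ler0n R m) (mulr_ge0 (posp_ge0 (u - a)) (posp_ge0 (b - u)))).
Qed.

Lemma frac01 (v : R) : 0 <= v -> 0 <= v / (1 + v) <= 1.
Proof.
move=> v0; have v1 : 0 < 1 + v by rewrite ltr_pwDl.
by rewrite divr_ge0 ?(ltW v1)//= ler_pdivrMr// mul1r lerDr.
Qed.

Lemma bump01 m a b u : 0 <= bump m a b u <= 1.
Proof. exact: (frac01 (bump_arg_ge0 m a b u)). Qed.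

Lemma bump_cvg_arg m a b (u : nat -> R) (x : R) : u n @[n --> \oo] --> x ->
  bump m a b (u n) @[n --> \oo] --> bump m a b x.
Proof.
move=> ux; have pc (v : nat -> R) (y : R) : v n @[n --> \oo] --> y ->
    posp (v n) @[n --> \oo] --> posp y.
  by move=> vy; apply: cvgM; [apply: cvgD => //; exact: cvg_norm|exact: cvg_cst].
have vc : m%:R * (posp (u n - a) * posp (b - u n)) @[n --> \oo] -->
    m%:R * (posp (x - a) * posp (b - x)).
  apply: cvgM; first exact: cvg_cst.
  by apply: cvgM; apply: pc; apply: cvgB => //; exact: cvg_cst.
apply: cvgM => //; apply: cvgV; last by apply: cvgD => //; exact: cvg_cst.
rewrite gt_eqF// ltr_pwDl//; apply: mulr_ge0 => //.
by apply: mulr_ge0; exact: posp_ge0.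
Qed.

Lemma bump_cvg_indic a b (u : R) :
  bump m a b u @[m --> \oo] --> (\1_(`]a, b[%classic : set R) u : R).
Proof.
rewrite indicE mem_setE in_itv/=; rewrite /bump; set p := posp _ * posp _.
have [/andP[au ub]|nab] := boolP (a < u < b).
  have p0 : 0 < p by rewrite /p !posp_gt0 ?subr_gt0// mulr_gt0 ?subr_gt0.
  (* Index 0 is skipped, since the rewriting below divides by [m]. *)
  rewrite -cvg_shiftS /=.
  have H : (1 + (m.+1%:R^-1 : R) * p^-1)^-1 @[m --> \oo] --> (1 + 0 * p^-1)^-1.
    apply: cvgV; first by rewrite mul0r addr0 oner_neq0.
    apply: cvgD; first exact: cvg_cst.
    by apply: cvgM; [exact: cvg_harmonic|exact: cvg_cst].
  rewrite mul0r addr0 invr1 in H; apply: cvg_trans H; apply: near_eq_cvg.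
  apply: nearW => m; have m0 : 0 < m.+1%:R :> R by [].
  move: (m.+1%:R) m0 => q q0.
  have qp : q * p != 0 by rewrite mulf_neq0// gt_eqF.
  have E : (1 + q^-1 * p^-1)^-1 = q * p / (1 + q * p).
    rewrite -invfM; move: (q * p) qp => r r0.
    by have -> : 1 + r^-1 = (1 + r) / r; [field|rewrite invf_div].
  by rewrite E.
have -> : p = 0.
  rewrite /p; move: nab; rewrite negb_and -!leNgt => /orP[ua|bu].
    by rewrite (posp_le0 (x := u - a)) ?subr_le0// mul0r.
  by rewrite (posp_le0 (x := b - u)) ?subr_le0// mulr0.
by under eq_fun do rewrite mulr0 mul0r; exact: cvg_cst.
Qed.

Lemma cvg_prod_ord n (F : 'I_n -> nat -> R) (l : 'I_n -> R) :
  (forall i, F i m @[m --> \oo] --> l i) ->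
  \prod_(i < n) F i m @[m --> \oo] --> \prod_(i < n) l i.
Proof.
move=> Fl; move: (index_enum _) => s; elim: s => [|j s IH].
  by rewrite big_nil; under eq_fun do rewrite big_nil; exact: cvg_cst.
rewrite big_cons; under eq_fun do rewrite big_cons.
by apply: cvgM => //; exact: Fl.
Qed.

Lemma prod01 n (F : 'I_n -> R) : (forall i, 0 <= F i <= 1) -> 0 <= \prod_(i < n) F i <= 1.
Proof.
move=> F01; elim/big_ind : _ => [|x y /andP[x0 x1] /andP[y0 y1]|i _].
- by rewrite lexx ler01.
- by rewrite mulr_ge0//= mulr_ile1.
- exact: F01.
Qed.

(** Products of bumps are test functions converging to indicators of open boxes, and boxes determine
    the laws. *)
Lemma unit_test_law_unique n d1 (T1 : measurableType d1) (m1 : probability T1 R)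
    (X1 : T1 -> n.-tuple R) (mX1 : measurable_fun setT X1)
    d2 (T2 : measurableType d2) (m2 : probability T2 R)
    (X2 : T2 -> n.-tuple R) (mX2 : measurable_fun setT X2) :
  (forall f, unit_test f -> (\int[m1]_x (f (X1 x))%:E = \int[m2]_x (f (X2 x))%:E)%E) ->
  forall S, measurable S -> m1 (X1 @^-1` S) = m2 (X2 @^-1` S).
Proof.
move=> H S mS.
pose F a b m (x : n.-tuple R) : R := \prod_(i < n) bump m (a i) (b i) (tnth x i).
have tF a b m : unit_test (F a b m).
  split => [x|u x ux]; first by apply: prod01 => i; exact: bump01.
  by apply: cvg_prod_ord => i; apply: bump_cvg_arg; exact: ux.
have Fc a b x : F a b m x @[m --> \oo] --> (\1_(box a b) x : R).
  have -> : (\1_(box a b) x : R) = \prod_(i < n) \1_(`]a i, b i[%classic) (tnth x i).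
    by apply: EFin_inj; rewrite indic_rect prodEFin.
  by apply: cvg_prod_ord => i; exact: bump_cvg_indic.
have mpre d (T : measurableType d) (X : T -> n.-tuple R) a b :
    measurable_fun setT X -> measurable (X @^-1` box a b).
  by move=> mX; rewrite -[X in measurable X]setTI; apply: mX => //; exact: measurable_box.
have c d (T : measurableType d) (mm : probability T R) (X : T -> n.-tuple R) a b :
    measurable_fun setT X ->
    (\int[mm]_x (F a b m (X x))%:E)%E @[m --> \oo] --> mm (X @^-1` box a b).
  move=> mX; have -> : mm (X @^-1` box a b) = (\int[mm]_x (\1_(box a b) (X x) : R)%:E)%E.
    transitivity (\int[mm]_x (\1_(X @^-1` box a b) x : R)%:E)%E; last by [].
    by rewrite integral_indic ?setIT//; exact: mpre.
  apply: bounded_cvg_integral => [m|m x|x].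
  - exact: (measurableT_comp (seqcont_measurable (tF a b m).2) mX).
  - exact: (tF a b m).1.
  - exact: Fc.
pose p1 : {measure set (n.-tuple R) -> \bar R} := pushforward m1 X1.
pose p2 : {measure set (n.-tuple R) -> \bar R} := pushforward m2 X2.
apply: (@box_measure_unique R n (p1 mX1) (p2 mX2)) => // a b.
  have c1 := c _ _ m1 X1 a b mX1; have c2 := c _ _ m2 X2 a b mX2.
  rewrite (_ : (fun m => _) = (fun m => \int[m2]_x (F a b m (X2 x))%:E)%E) in c1.
    exact: (cvg_unique _ c1 c2).
  by apply/funext => m; exact: H.
exact: le_lt_trans (probability_le1 m1 (mpre _ _ X1 a b mX1)) (ltry _).
Qed.

End Bumps.

(** * The law of the ratio *)

Section RandomRatio.
Context {R : realType} (k : nat) (nu : probability (k.-tuple R) R)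
  d2 (Omega2 : measurableType d2) (P2 : probability Omega2 R)
  (E : 'I_k -> Omega2 -> R) (C : Omega2 -> k.-tuple R)
  (hE : forall i, measurable_fun setT (E i)) (hC : measurable_fun setT C)
  (hEC : forall (A : 'I_k -> set R) (S : set (k.-tuple R)),
     (forall i, measurable (A i)) -> measurable S ->
     P2 ((\bigcap_(i in [set: 'I_k]) (E i @^-1` (A i))) `&` (C @^-1` S))
     = ((\prod_(i < k) exponential_prob 1 (A i)) * nu S)%E).

Let Et (w : Omega2) : k.-tuple R := [tuple E i w | i < k].

Let mEt : measurable_fun setT Et.
Proof.
apply/measurable_fun_tnthP => i; rewrite (_ : _ \o _ = E i); first exact: hE.
by apply/funext => w /=; rewrite tnth_mktuple.
Qed.

(** The hypothesis gives the case where [A] is a rectangle; for fixed [S] both sides are finite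
    measures in [A] agreeing on boxes. *)
Lemma joint_law_prod A S : measurable A -> measurable S ->
  P2 (Et @^-1` A `&` C @^-1` S) = (exp_tuple_prob k A * nu S)%E.
Proof.
move=> mA mS.
have mCS : measurable (C @^-1` S) by rewrite -[X in measurable X]setTI; exact: hC.
have fP : (fine (nu S))%:E = nu S by rewrite fineK// fin_num_measure.
have r0 : 0 <= fine (nu S) by rewrite fine_ge0.
pose rr : {nonneg R} := NngNum r0.
pose p1 : {measure set (k.-tuple R) -> \bar R} := pushforward (mrestr P2 mCS) Et.
have H := @box_measure_unique R k (p1 mEt) (mscale rr (exp_tuple_prob k)) _ _ A mA.
transitivity (mscale rr (exp_tuple_prob k) A); last by rewrite muleC -[nu S]fP.
apply: H => a b.
  transitivity (exp_tuple_prob k (box a b) * nu S)%E; last by rewrite muleC -[nu S]fP.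
  have mi (i : 'I_k) : measurable (`]a i, b i[%classic : set R) by exact: measurable_itv.
  rewrite exp_tuple_probE; last exact: measurable_box.
  rewrite (exp_rectE mi) -(hEC mi mS).
  congr (P2 (_ `&` _)); apply/seteqP; split => [w /= wab i _|w wab i] /=.
    by have := wab i; rewrite tnth_mktuple.
  by have := wab i I; rewrite /= tnth_mktuple.
have mpre : measurable (Et @^-1` box a b).
  by rewrite -[X in measurable X]setTI; apply: mEt => //; exact: measurable_box.
exact: le_lt_trans (probability_le1 P2 (measurableI _ _ mpre mCS)) (ltry _).
Qed.

Lemma measurable_Lop (f : k.-tuple R -> R) : unit_test f ->
  measurable_fun setT (fun c => (Lop f c)%:E).
Proof.
move=> tf; pose g (q : k.-tuple R * k.-tuple R) : \bar R := (f (divt q.1 q.2))%:E.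
have mg : measurable_fun setT g.
  apply/measurable_EFinP; apply: (measurableT_comp (seqcont_measurable tf.2)).
  exact: measurable_divt.
have g0 q : (0 <= g q)%E by rewrite lee_fin; have /andP[] := tf.1 (divt q.1 q.2).
rewrite (_ : (fun c => _) = (fun c => \int[exp_tuple_prob k]_e g (e, c))%E).
  exact: (measurable_fun_fubini_tonelli_G (m1 := exp_tuple_prob k) g).
by apply/funext => c; rewrite LopE.
Qed.

(** The joint law of the two vectors is the product measure, and Tonelli integrates the exponentials
    first, which produces [Lop f]. *)
Lemma integral_ratio (f : k.-tuple R -> R) : unit_test f ->
  (\int[P2]_w (f (divt (Et w) (C w)))%:E = \int[nu]_c (Lop f c)%:E)%E.
Proof.
move=> tf; pose g (q : k.-tuple R * k.-tuple R) : \bar R := (f (divt q.1 q.2))%:E.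
have mg : measurable_fun setT g.
  apply/measurable_EFinP; apply: (measurableT_comp (seqcont_measurable tf.2)).
  exact: measurable_divt.
have g0 q : (0 <= g q)%E by rewrite lee_fin; have /andP[] := tf.1 (divt q.1 q.2).
have mEC : measurable_fun setT (fun w => (Et w, C w)) by exact: measurable_fun_pair.
pose p : {measure set (k.-tuple R * k.-tuple R) -> \bar R} :=
  pushforward P2 (fun w => (Et w, C w)).
have pE := @product_measure_unique _ _ _ _ R (exp_tuple_prob k) nu (p mEC)
  (fun A S mA mS => joint_law_prod mA mS).
transitivity (\int[p mEC]_q g q)%E.
  by rewrite (@ge0_integral_pushforward _ _ _ _ _ _ mEC P2 setT g).
transitivity (\int[exp_tuple_prob k \x nu]_q g q)%E.
  by apply: eq_measure_integral => A mA _; first [exact: pE | exact/esym/pE].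
rewrite (fubini_tonelli2 g)//; apply: eq_integral => c _.
by rewrite LopE.
Qed.

End RandomRatio.

Theorem theorem1 (R : realType) (k : nat) (hk : (1 <= k)%N)
  (d : measure_display) (Omega : measurableType d) (P : probability Omega R)
  (B : nat -> Omega -> R -> R) (hB : iid_two_sided_BM P B)
  (mu : probability (k.+1.-tuple R) R)
  (hmu : forall t : k.+1.-tuple R, uniq t -> (forall i, tnth t i != 0) ->
     cvg_in_law P
       (fun n w => [tuple iterBM (fun m => B m w) n (tnth t i) | i < k.+1]) mu)
  (nu : probability (k.-tuple R) R) (hnu : is_nu_k nu)
  (d2 : measure_display) (Omega2 : measurableType d2) (P2 : probability Omega2 R)
  (E : 'I_k -> Omega2 -> R) (C : Omega2 -> k.-tuple R)
  (hE : forall i, measurable_fun setT (E i)) (hC : measurable_fun setT C)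
  (hEC : forall (A : 'I_k -> set R) (S : set (k.-tuple R)),
     (forall i, measurable (A i)) -> measurable S ->
     P2 ((\bigcap_(i in [set: 'I_k]) (E i @^-1` A i)) `&` (C @^-1` S))
     = ((\prod_(i < k) exponential_prob 1 (A i)) * nu S)%E) :
  forall S : set (k.-tuple R), measurable S ->
    mu (@gaps R k @^-1` S) = P2 [set w | S [tuple E i w / tnth (C w) i | i < k]].
Proof.
pose Et (w : Omega2) : k.-tuple R := [tuple E i w | i < k].
have mEt : measurable_fun setT Et.
  apply/measurable_fun_tnthP => i; rewrite (_ : _ \o _ = E i); first exact: hE.
  by apply/funext => w /=; rewrite tnth_mktuple.
have X2E w : [tuple E i w / tnth (C w) i | i < k] = divt (Et w) (C w).
  by apply: eq_from_tnth => i; rewrite !tnth_mktuple.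
move=> S mS.
transitivity (P2 ((fun w => divt (Et w) (C w)) @^-1` S)); last first.
  by congr (P2 _); apply/seteqP; split => w /=; rewrite X2E.
apply: unit_test_law_unique => //.
- exact: measurable_gaps.
- exact: measurable_divt.
move=> f tf; rewrite (integral_ratio hE hC hEC tf).
rewrite -(nu_limit hk hnu tf (gaps_limit hB hmu tf)) integral_mkcond.
have mpos := @measurable_pos_tuple R k.
have mL := @measurable_Lop R k f tf.
have L0 c : (0 <= (Lop f c)%:E)%E by rewrite lee_fin; have /andP[] := Lop01 c tf.
apply: ge0_ae_eq_integral => //.
- by apply/(measurable_restrictT _ _).1 => //; exact: measurable_funTS.
- by move=> c _; rewrite patchE; case: ifP.
(* [nu_limit] integrates over the positive orthant only; its complement is null by the first clause
   of [is_nu_k]. *)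
exists (~` @pos_tuple R k); split.
- exact: measurableC.
- have posE : [set c : k.-tuple R | forall i, 0 < tnth c i] = @pos_tuple R k.
    by apply/seteqP; split => c /= /pos_tupleP.
  apply: probability_setC0 => //; by rewrite -posE hnu.1.
- by move=> c /= H cpos; apply: H => _; rewrite patchE mem_set.
Qed.
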